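(* Let $(A_S,S)$ be an Artin–Tits system (not necessarily of spherical type), let $X,Y\subset S$ and let $g\in A_S^+$. Then $g\in Conj^+(S;X,Y)$ if and only if there exist subsets $X_0=X, X_1,\dots,X_n=Y$ of $S$ and a factorization $g=g_n\cdots g_1$ such that, for each $i\in\{1,\dots,n\}$, $g_i$ is an elementary positive $X_i$-ribbon-$X_{i-1}$.
   Context: Let $S$ be a finite set and $M=(m_{s,t})_{s,t\in S}$ a symmetric matrix with $m_{s,s}=1$ and $m_{s,t}\in\{2,3,\dots\}\cup\{\infty\}$ for $s\neq t$. The associated Artin–Tits system is $(A_S,S)$, where $A_S$ is the group with generators $S$ and relations $\underbrace{sts\cdots}_{m_{s,t}}=\underbrace{tst\cdots}_{m_{s,t}}$ for all $s\ne t$ in $S$ with $m_{s,t}\neq\infty$. The associated Coxeter group $W_S$ is obtained by adding the relations $s^2=1$, $s\in S$. $A_S^+$ is the submonoid of $A_S$ generated by $S$; it has, as a monoid, the same presentation as $A_S$. For $X\subset S$, $A_X^+$ is the submonoid generated by $X$. A subset $X\subset S$ is of spherical type if the subgroup $W_X$ of $W_S$ generated by $X$ is finite; in that case $\Delta_X$ denotes the least common multiple of $X$ in $A_X^+$ (for both left and right divisibility). A subset $T\subset S$ is decomposable if it has a nontrivial partition $T=T_1\cup T_2$ with $m_{s,t}=2$ for all $s\in T_1$, $t\in T_2$; otherwise it is indecomposable. The indecomposable components of $T$ are its maximal indecomposable subsets. Positive conjugator: $Conj^+(S;X,Y)=\{g\in A_S^+\mid gX=Yg\}$ (equality of sets).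 Elementary ribbons: let $X\subset S$ and $t\in S$ be such that the indecomposable component $X(t)$ of $X\cup\{t\}$ containing $t$ is of spherical type. If $t\notin X$ put $d_{X,t}=\Delta_{X(t)}\Delta_{X(t)-\{t\}}^{-1}$; if $t\in X$ put $d_{X,t}=\Delta_{X(t)}$. In both cases $d_{X,t} \in A_S^+$ and there is a unique subset $Y\subset X\cup\{t\}$ with $Yd_{X,t}=d_{X,t}X$; one then says that $d_{X,t}$ is an elementary positive $Y$-ribbon-$X$. The length $n\ge 0$ of a factorization may be $0$, in which case $X=Y$ and $g=1$. *)

(* Defs.v *)
From HB Require Import structures.
From mathcomp Require Import all_boot.
From mathcomp Require Import boolp classical_sets cardinality.

Set Implicit Arguments.
Unset Strict Implicit.
Unset Printing Implicit Defensive.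

Local Open Scope classical_set_scope.
Local Open Scope group_scope.

(* The letter (x, false) stands for the generator x and (x, true) for its
   formal inverse. *)
Definition word (T : Type) := seq (T * bool).

Definition positive_word (T : Type) (s : seq T) : word T :=
  [seq (x, false) | x <- s].

Definition inv_word (T : Type) (w : word T) : word T :=
  rev [seq (l.1, ~~ l.2) | l <- w].

Inductive pres_cong (T : Type) (R : word T -> word T -> Prop) :
    word T -> word T -> Prop :=
| pres_rel u v : R u v -> pres_cong R u v
| pres_cancel x b : pres_cong R [:: (x, b); (x, ~~ b)] [::]
| pres_refl u : pres_cong R u u
| pres_sym u v : pres_cong R u v -> pres_cong R v u
| pres_trans u v w : pres_cong R u v -> pres_cong R v w -> pres_cong R u w
| pres_cat u u' v v' :
    pres_cong R u u' -> pres_cong R v v' -> pres_cong R (u ++ v) (u' ++ v').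

Section PresentedGroup.
Context (T : choiceType) (R : word T -> word T -> Prop).

Definition pres_congb (u v : word T) : bool := `[< pres_cong R u v >].

Lemma pres_congb_equiv : equiv_class_of pres_congb.
Proof.
split=> [u|u v|v u w]; first by apply/asboolP; exact: pres_refl.
- by apply/asboolP/asboolP; exact: pres_sym.
- by move=> /asboolP uv /asboolP vw; apply/asboolP; exact: pres_trans uv vw.
Qed.

Definition pres_equiv : equiv_rel (word T) := EquivRelPack pres_congb_equiv.

(* The group with set of generators T and set of relations u = v, R u v. *)
Definition presented_group := {eq_quot pres_equiv}%qT.

HB.instance Definition _ := Choice.on presented_group.

Definition pres_class (w : word T) : presented_group :=
  \pi_({eq_quot pres_equiv})%qT w.

Definition pres_repr (a : presented_group) : word T := repr a.

Lemma pres_reprK a : pres_class (pres_repr a) = a.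
Proof. exact: reprK. Qed.

Lemma pres_classP u v : pres_class u = pres_class v <-> pres_cong R u v.
Proof. by split=> [/eqmodP/asboolP//|uv]; apply/eqmodP/asboolP. Qed.

Definition pres_one : presented_group := pres_class [::].
Definition pres_mul (a b : presented_group) : presented_group :=
  pres_class (pres_repr a ++ pres_repr b).
Definition pres_inv (a : presented_group) : presented_group :=
  pres_class (inv_word (pres_repr a)).

Lemma pres_class_repr u : pres_cong R (pres_repr (pres_class u)) u.
Proof. by apply/pres_classP; rewrite pres_reprK. Qed.

Lemma pres_mulE u v : pres_mul (pres_class u) (pres_class v) = pres_class (u ++ v).
Proof. by apply/pres_classP/pres_cat; exact: pres_class_repr. Qed.

Lemma pres_mulA : associative pres_mul.
Proof.
move=> a b c; rewrite -(pres_reprK a) -(pres_reprK b) -(pres_reprK c).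
by rewrite !pres_mulE catA.
Qed.

Lemma pres_mul1 : left_id pres_one pres_mul.
Proof. by move=> a; rewrite -(pres_reprK a) pres_mulE. Qed.

Lemma pres_mulr1 : right_id pres_one pres_mul.
Proof. by move=> a; rewrite -(pres_reprK a) pres_mulE cats0. Qed.

Lemma inv_wordK : involutive (@inv_word T).
Proof.
move=> w; rewrite /inv_word map_rev revK -map_comp.
by apply: map_id_in => -[x b] _ /=; rewrite negbK.
Qed.

Lemma inv_word_cong u : pres_cong R (u ++ inv_word u) [::].
Proof.
elim: u => [|[x b] u IHu]; first exact: pres_refl.
rewrite /inv_word /= rev_cons -cats1 catA -cat1s.
apply: (@pres_trans _ _ _ ([:: (x, b)] ++ [::] ++ [:: (x, ~~ b)])).
  apply: pres_cat; first exact: pres_refl.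
  by apply: pres_cat; [exact: IHu | exact: pres_refl].
exact: pres_cancel.
Qed.

Lemma pres_mulVr : left_inverse pres_one pres_inv pres_mul.
Proof.
move=> a; rewrite -{2}(pres_reprK a) pres_mulE; apply/pres_classP.
by rewrite -{2}(inv_wordK (pres_repr a)); exact: inv_word_cong.
Qed.

Lemma pres_mulrV : right_inverse pres_one pres_inv pres_mul.
Proof.
move=> a; rewrite -{1}(pres_reprK a) pres_mulE; apply/pres_classP.
exact: inv_word_cong.
Qed.

HB.instance Definition _ := isGroup.Build presented_group
  pres_mulA pres_mul1 pres_mulr1 pres_mulVr pres_mulrV.

Definition pres_gen (x : T) : presented_group := pres_class [:: (x, false)].

End PresentedGroup.

Definition monoid_closed_set (G : groupType) (M : set G) : Prop :=
  M 1 /\ forall a b, M a -> M b -> M (a * b).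

Definition group_closed_set (G : groupType) (H : set G) : Prop :=
  monoid_closed_set H /\ forall a, H a -> H a^-1.

Definition submonoid_gen (G : groupType) (A : set G) : set G :=
  smallest (@monoid_closed_set G) A.

Definition subgroup_gen (G : groupType) (A : set G) : set G :=
  smallest (@group_closed_set G) A.

Definition left_divides (G : groupType) (M : set G) (a b : G) : Prop :=
  exists2 c, M c & b = a * c.

Definition right_divides (G : groupType) (M : set G) (a b : G) : Prop :=
  exists2 c, M c & b = c * a.

Definition is_lcm (G : groupType) (M : set G) (divides : G -> G -> Prop)
    (A : set G) (d : G) : Prop :=
  [/\ M d, forall a, A a -> divides a d
    & forall e, M e -> (forall a, A a -> divides a e) -> divides d e].

(* [None] encodes the entry infinity. *)
Record coxeter_matrix (S : finType) := CoxeterMatrix {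
  cox_entry :> S -> S -> option nat;
  cox_sym : forall s t, cox_entry s t = cox_entry t s;
  cox_diag : forall s, cox_entry s s = Some 1%N;
  cox_offdiag : forall s t k, s != t -> cox_entry s t = Some k -> (2 <= k)%N
}.

(* The word s t s ... with k letters. *)
Fixpoint alternating (S : Type) (s t : S) (k : nat) : seq S :=
  if k is k'.+1 then s :: alternating t s k' else [::].

Section ArtinTits.
Context (S : finType) (m : coxeter_matrix S).

Inductive braid_rel : word S -> word S -> Prop :=
| BraidRel s t k : s != t -> m s t = Some k ->
    braid_rel (positive_word (alternating s t k))
              (positive_word (alternating t s k)).

Inductive coxeter_rel : word S -> word S -> Prop :=
| CoxeterBraid u v : braid_rel u v -> coxeter_rel u v
| CoxeterSquare s : coxeter_rel (positive_word [:: s; s]) [::].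

Definition artin_group := presented_group braid_rel.
Definition coxeter_group := presented_group coxeter_rel.

Definition artin_gen (s : S) : artin_group := pres_gen braid_rel s.
Definition coxeter_gen (s : S) : coxeter_group := pres_gen coxeter_rel s.

(* A_X^+, inside the group; it is not defined by a monoid presentation. *)
Definition artin_monoid (X : {set S}) : set artin_group :=
  submonoid_gen (artin_gen @` [set` X]).

Definition spherical (X : {set S}) : Prop :=
  finite_set (subgroup_gen (coxeter_gen @` [set` X])).

(* When X has no element that is its lcm on both sides (so X is not of spherical
   type), the value is the default 1. *)
Definition Delta (X : {set S}) : artin_group :=
  let M := artin_monoid X in let A := artin_gen @` [set` X] in
  xget 1 [set d | is_lcm M (left_divides M) A d
               /\ is_lcm M (right_divides M) A d].

Definition decomposable (T : {set S}) : bool :=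
  [exists T1 : {set S}, exists T2 : {set S},
    [&& T1 != finset.set0, T2 != finset.set0,
        T1 :&: T2 == finset.set0, T == T1 :|: T2
      & [forall s in T1, forall t in T2, m s t == Some 2]]].

Definition indec_component (T C : {set S}) : bool :=
  maxset [pred U : {set S} | (U \subset T) && ~~ decomposable U] C.

Definition conj_sets (X Y : {set S}) (g : artin_group) : Prop :=
  [set g * artin_gen x | x in [set` X]] = [set artin_gen y * g | y in [set` Y]].

Definition conj_pos (X Y : {set S}) : set artin_group :=
  [set g | artin_monoid [set: S]%SET g /\ conj_sets X Y g].

(* The element d_{X,t}, where [C] is the indecomposable component X(t). *)
Definition ribbon_elt (X : {set S}) (t : S) (C : {set S}) : artin_group :=
  if t \in X then Delta C else Delta C * (Delta (C :\ t)%SET)^-1.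

(* "Y-ribbon-X", with Y d = d X: the target Y comes first, whereas
   conj_sets X Y and conj_pos X Y take the source X first. *)
Definition elementary_ribbon (Y X : {set S}) (d : artin_group) : Prop :=
  exists (t : S) (C : {set S}),
    [/\ indec_component (t |: X)%SET C, t \in C, spherical C,
        d = ribbon_elt X t C
      & Y \subset (t |: X)%SET /\ conj_sets X Y d].

End ArtinTits.

Arguments artin_monoid {S} m X.
Arguments artin_gen {S} m s.
Arguments coxeter_gen {S} m s.
Arguments spherical {S} m X.
Arguments Delta {S} m X.
Arguments decomposable {S} m T.
Arguments indec_component {S} m T C.
Arguments ribbon_elt {S} m X t C.

(* Main.v *)
Require Import Defs.
From HB Require Import structures.
From mathcomp Require Import all_boot all_order all_algebra.
From mathcomp Require Import boolp classical_sets cardinality.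
From mathcomp Require Import zify ring lra.

(* Replace the labels infinity by a large integer k and unfold the Coxeter graph into a simply laced
   triangle-free graph whose vertices lie above the generators. The Artin group of such a graph acts
   on the functions on positive roots by the Lawrence-Krammer-Paris operators; at a degenerate value
   of the parameter a generator s becomes a nonnegative operator P_s that kills the simple root of s.
   A root that survives a positive word detects that s is not a left divisor of the word. Hence two
   generators with a common multiple have their alternating word as least common multiple, and
   positive elements with a common multiple have a least one, all inside the group.

   Let g X = Y g and let the generator t divide g on the right, C being the component of t in
   X + {t}. If t lies in X, all of C divides g, and Delta_C splits off. If not, the positive roots
   killed by the reversal of g form a set stable under W_X; it contains the roots above t, and it is
   so small that some of them has an orbit whose size is bounded independently of k. This bounds the
   length of the square-free words over C - {t}, so C - {t} has a common multiple. Then C divides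
   g Delta_{C - {t}}, and Delta_C Delta_{C - {t}}^-1 splits off g. In both cases g gets shorter. W_C is
   finite because multiplication by C permutes the images of the square-free divisors of Delta_C. *)

Set Implicit Arguments.
Unset Strict Implicit.
Unset Printing Implicit Defensive.
Import Order.TTheory GRing.Theory Num.Theory.

(** * Roots of a simply laced graph *)

(** [artin_monoid] lives inside the group, so two positive words are equal as soon as the group
    identifies them. Divisibility therefore cannot be read off a monoid presentation and is
    extracted from operators. A group action needs them invertible: a parameter x is kept different
    from 0 until an identity between positive words is obtained, and only then set to 0, where
    positivity becomes available. Unfolding leaves only the labels 2 and 3: a label p is represented
    by paths of type A with p - 1 vertices, whose Coxeter number is p. The absence of triangles is
    what makes the recursive forms well defined. An infinite label becomes k, and the words under
    study have fewer than k letters, so that they cannot contain the alternating word of length k.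
    The delicate case is t outside X, where nothing bounds C a priori. The number of roots above a
    generator grows with k, but so does the number of roots that one letter can kill, and a
    pigeonhole argument cancels the two. Passing to a bonded generator squares the bound, once per
    step of a path in the graph. Square-free elements stand in for reduced words of the Coxeter
    group. *)

Section Roots.
Local Open Scope ring_scope.
Variables (V : finType) (adj : rel V).
Hypothesis adjC : symmetric adj.
Hypothesis adjxx : irreflexive adj.

Notation vec := {ffun V -> int}.

(** The pairing of b with the coroot of s for the Cartan matrix with entries 2, -1 and 0; b is given
    by its coordinates in the simple roots. *)
Definition dot (s : V) (b : vec) : int := b s *+ 2 - \sum_(u | adj s u) b u.
Definition simple (s : V) : vec := [ffun u => (u == s)%:R].
Definition refl (s : V) (b : vec) : vec :=
  [ffun u => b u - (if u == s then dot s b else 0)].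

Lemma dot_refl s u b : dot s (refl u b) =
  dot s b - (if s == u then dot u b *+ 2 else if adj s u then - dot u b else 0).
Proof.
rewrite {1}/dot !ffunE; under eq_bigr do rewrite ffunE.
rewrite sumrB -big_mkcondr /=.
have -> : \sum_(i | adj s i && (i == u)) dot u b = if adj s u then dot u b else 0.
  case: ifP => su; first by rewrite (big_pred1 u) // => i /=; case: (altP (i =P u)) => [->|]; rewrite ?su ?andbF.
  by rewrite big_pred0 // => i /=; case: (altP (i =P u)) => [->|]; rewrite ?su ?andbF.
rewrite /dot; case: (altP (s =P u)) => [->|_]; first by rewrite adjxx; ring.
by case: ifP => _; ring.
Qed.

Lemma dot_refl1 s b : dot s (refl s b) = - dot s b.
Proof. by rewrite dot_refl eqxx; ring. Qed.
Lemma dot_reflA s u b : adj s u -> dot s (refl u b) = dot s b + dot u b.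
Proof.
move=> su; have /negPf nsu : s != u by apply: contraTneq su => ->; rewrite adjxx.
by rewrite dot_refl su nsu; ring.
Qed.
Lemma dot_reflN s u b : s != u -> ~~ adj s u -> dot s (refl u b) = dot s b.
Proof. by move=> /negPf su /negPf nsu; rewrite dot_refl su nsu; ring. Qed.

Lemma dot_simple s u : dot s (simple u) = if s == u then 2 else if adj s u then -1 else 0.
Proof.
rewrite /dot ffunE; under eq_bigr do rewrite ffunE.
rewrite -natr_sum -big_mkcondr /= sum1_card.
case: (altP (s =P u)) => [->|nsu].
  rewrite (fintype.eq_card0 (A := fun i => _)) ?subr0 // => i.
  by rewrite unfold_in; case: eqP => [->|]; rewrite ?adjxx ?andbF.
case: ifP => su.
  rewrite (fintype.eq_card1 (x := u)) // => i.
  by rewrite unfold_in !inE; case: eqP => [->|]; rewrite ?su ?andbF.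
rewrite (fintype.eq_card0 (A := fun i => _)) ?subr0 // => i.
by rewrite unfold_in; case: eqP => [->|]; rewrite ?su ?andbF.
Qed.

Lemma reflE s b u : refl s b u = b u - (if u == s then dot s b else 0).
Proof. exact: ffunE. Qed.

Lemma reflK s : involutive (refl s).
Proof.
move=> b; apply/ffunP => u; rewrite !ffunE dot_refl1.
by case: ifP => _; ring.
Qed.

Lemma refl_inj s : injective (refl s).
Proof. exact: inv_inj (reflK s). Qed.

Lemma refl_comm s t b : s != t -> ~~ adj s t -> refl s (refl t b) = refl t (refl s b).
Proof.
move=> st nst; apply/ffunP => u; rewrite !ffunE !dot_reflN //; last by rewrite adjC.
  by case: ifP => _; case: ifP => _; ring.
by rewrite eq_sym.
Qed.

Lemma refl_braid s t b : adj s t ->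
  refl s (refl t (refl s b)) = refl t (refl s (refl t b)).
Proof.
move=> st; have ts : adj t s by rewrite adjC.
have nst : s != t by apply: contraTneq st => ->; rewrite adjxx.
apply/ffunP => u; rewrite !ffunE !(dot_refl1, dot_reflA) //.
case: (altP (u =P s)) => [->|_]; first by rewrite (negPf nst); ring.
by case: ifP => _; ring.
Qed.

Lemma refl_fix s b : dot s b = 0 -> refl s b = b.
Proof. by move=> e; apply/ffunP => u; rewrite ffunE e; case: ifP; rewrite subr0. Qed.

Definition ht (b : vec) : int := \sum_v b v.

Lemma ht_refl s b : ht (refl s b) = ht b - dot s b.
Proof.
rewrite /ht; under eq_bigr do rewrite ffunE.
by rewrite sumrB -big_mkcond big_pred1_eq.
Qed.

Lemma ht_simple s : ht (simple s) = 1.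
Proof.
rewrite /ht; under eq_bigr do rewrite ffunE.
by rewrite -natr_sum -big_mkcond sum1_card card1.
Qed.

(* Real positive roots, generated by reflections that raise the height only. *)
Inductive posroot : vec -> Prop :=
| posroot_simple s : posroot (simple s)
| posroot_up t b : posroot b -> dot t b < 0 -> posroot (refl t b).

Lemma posroot_ht b : posroot b -> 0 < ht b.
Proof.
elim=> [s|t {}b _ IH lt]; first by rewrite ht_simple.
by rewrite ht_refl; lia.
Qed.

Lemma nadj_neq s t : adj s t -> s != t.
Proof. by apply: contraTneq => ->; rewrite adjxx. Qed.

Lemma refl_simple s t : adj s t -> refl s (simple t) = refl t (simple s).
Proof.
move=> st; have nst := nadj_neq st.
have ts : adj t s by rewrite adjC.
have nts : t != s by rewrite eq_sym.
apply/ffunP => u; rewrite !ffunE !dot_simple (negPf nst) (negPf nts) st ts.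
by case: (altP (u =P s)) => [->|_]; rewrite ?(negPf nst); case: (u == t).
Qed.

(** Only the case of positive pairing is not a constructor. There b comes from a lower root c by a
    raising reflection in t, and commutation or the braid relation of s and t moves the question to
    roots lower than b. *)
Lemma posroot_refl s b : posroot b -> b != simple s -> posroot (refl s b).
Proof.
have [n le] := ubnP `|ht b|%N; elim: n => // n IHn in s b le *.
move=> rb nb; have [lt|lt|eq0] := ltgtP (dot s b) 0; first exact: posroot_up; last by rewrite refl_fix.
case: rb nb le lt => [u|t c rc lt] nb le lt0.
  by move: lt0; rewrite dot_simple; case: eqP => [e|_]; [rewrite e eqxx in nb | case: ifP].
have := posroot_ht rc; rewrite ht_refl in le => ht0.
have lec : (`|ht c| < n)%N by lia.
have [->|nst] := eqVneq s t; first by rewrite reflK.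
case: (boolP (adj s t)) => [st|nst']; last first.
  have nc : c != simple s.
    by apply: contraTneq lt => ->; rewrite dot_simple eq_sym (negPf nst) adjC (negPf nst').
  rewrite refl_comm //; apply: posroot_up; first exact: IHn.
  by rewrite dot_reflN // 1?eq_sym // adjC.
have ts : adj t s by rewrite adjC.
rewrite dot_reflA // in lt0.
have [e|nc] := eqVneq c (simple s).
  by rewrite e -refl_simple // reflK; exact: posroot_simple.
have rsc := IHn s c lec rc nc.
have nsc : refl s c != simple t.
  apply: contraTneq lt => e; have -> : dot t c = 1; last by [].
  by rewrite -(reflK s c) e dot_reflA // !dot_simple eqxx (negPf nst) st.
have le1 : (`|ht (refl s c)| < n)%N by have := posroot_ht rsc; rewrite ht_refl; lia.
have r1 := IHn t _ le1 rsc nsc.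
have r2 : posroot (refl s (refl t (refl s c))).
  by apply: posroot_up => //; rewrite dot_reflA // dot_refl1 dot_reflA //; lia.
rewrite -(reflK t (refl s _)) -refl_braid //; apply: posroot_up => //.
rewrite refl_braid // dot_refl1 dot_reflA // dot_refl1 dot_reflA //; lia.
Qed.

Lemma posroot_low b : posroot b -> exists t, 0 < dot t b.
Proof.
case=> [s|t c _ lt]; first by exists s; rewrite dot_simple eqxx.
by exists t; rewrite dot_refl1; lia.
Qed.
End Roots.

(** * Operators on the functions on positive roots *)

Section Forms.
Local Open Scope ring_scope.
Variables (V : finType) (adj : rel V).
Hypothesis adjC : symmetric adj.
Hypothesis adjxx : irreflexive adj.
Hypothesis adj_tri : forall u v w, adj u v -> adj v w -> adj u w -> False.

Notation vec := {ffun V -> int}.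
Local Notation dot := (dot adj).
Local Notation refl := (refl adj).
Local Notation posroot := (posroot adj).

Lemma neq_simple v u c : dot v c != (if v == u then 2 else if adj v u then -1 else 0) ->
  c != simple u.
Proof. by apply: contraNneq => ->; rewrite dot_simple. Qed.

Lemma posroot_down u c : posroot c -> 0 < dot u c -> c != simple u ->
  posroot (refl u c) /\ ht (refl u c) = ht c - dot u c.
Proof. by move=> rc lt nc; split; [exact: posroot_refl | exact: ht_refl]. Qed.

(* The recursion for the linear forms of Paris's version of the Lawrence-Krammer representation,
   at a parameter for which all values are integers. *)
Definition phi_step (phi : V -> vec -> int) (s t : V) (b : vec) : int :=
  let c := refl t b in
  if b == simple t then 1
  else if ~~ adj s t then phi s c
  else if 0 < dot s c then 2 * phi t (refl s c)
  else if dot s c == 0 then 2 * phi t c - phi s c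
  else phi s c + 2 * phi t c.

(** The recursion is on fuel. Each call lowers the height of the root, so any fuel above the height
    gives the same value. *)
Fixpoint phi_rec (n : nat) (s : V) (b : vec) : int :=
  if n is n'.+1 then
    if 0 < dot s b then (if b == simple s then 2 else 0)
    else if [pick t | 0 < dot t b] is Some t then phi_step (phi_rec n') s t b else 0
  else 0.

Definition phi s b := phi_rec `|ht b|.+1 s b.

Lemma phi_step_ext (f g : V -> vec -> int) s t b :
  posroot b -> dot s b <= 0 -> 0 < dot t b ->
  (forall u c, posroot c -> ht c < ht b -> f u c = g u c) ->
  phi_step f s t b = phi_step g s t b.
Proof.
move=> rb sb tb fg; rewrite /phi_step; case: (altP (b =P simple t)) => // nb.
have [rc hc] := posroot_down rb tb nb.
have hlt : ht (refl t b) < ht b by lia.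
have eq1 u := fg u _ rc hlt.
case: (boolP (adj s t)) => //= st; rewrite ?eq1 //.
case: ifP => // sc; congr (2 * _); apply: fg; last by rewrite ht_refl; lia.
apply: posroot_refl => //; apply/eqP => e.
have /negPf nst := nadj_neq adjxx st.
move: sb; rewrite -(reflK adjxx t b) e dot_reflA // !dot_simple // eqxx.
by rewrite eq_sym nst adjC st.
Qed.

Lemma phi_fuel n n' s b : posroot b -> (`|ht b| < n)%N -> (`|ht b| < n')%N ->
  phi_rec n s b = phi_rec n' s b.
Proof.
elim: n n' s b => [|n IHn] [|n'] s b // rb le le' /=.
case: (ltP 0 (dot s b)) => // sb; case: pickP => // t tb.
apply: phi_step_ext => // u c rc hc; have := posroot_ht rc; have := posroot_ht rb => h1 h2.
by apply: IHn => //; lia.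
Qed.

Lemma phi_gt0 s b : 0 < dot s b -> phi s b = if b == simple s then 2 else 0.
Proof. by move=> sb; rewrite /phi /= sb. Qed.

Lemma phi_pick s b : posroot b -> dot s b <= 0 ->
  exists2 t, 0 < dot t b & phi s b = phi_step phi s t b.
Proof.
move=> rb sb; rewrite {1}/phi /= ltNge sb /=; case: pickP => [t tb|no]; last first.
  by have [t] := posroot_low adjxx rb; rewrite no.
exists t => //; apply: phi_step_ext => // u c rc hc.
by have := posroot_ht rc; have := posroot_ht rb => h1 h2; apply: phi_fuel => //; lia.
Qed.

Lemma phi_stepN s t b : b != simple t -> ~~ adj s t -> phi_step phi s t b = phi s (refl t b).
Proof. by rewrite /phi_step => /negPf -> ->. Qed.

Lemma phi_stepP s t b : b != simple t -> adj s t -> 0 < dot s b + dot t b ->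
  phi_step phi s t b = 2 * phi t (refl s (refl t b)).
Proof. by rewrite /phi_step => /negPf -> st; rewrite dot_reflA // st /= => ->. Qed.

Lemma phi_step0 s t b : adj s t -> dot s b + dot t b = 0 ->
  phi_step phi s t b = 2 * phi t (refl t b) - phi s (refl t b).
Proof.
move=> st e; have /negPf nb : b != simple t.
  have /negPf nst := nadj_neq adjxx st.
  by apply: contra_eqN e => /eqP ->; rewrite !dot_simple // eqxx nst st.
by rewrite /phi_step nb dot_reflA // st e.
Qed.

Lemma phi_stepM s t b : adj s t -> dot s b + dot t b < 0 ->
  phi_step phi s t b = phi s (refl t b) + 2 * phi t (refl t b).
Proof.
move=> st e; have /negPf nb : b != simple t.
  have /negPf nst := nadj_neq adjxx st.
  by apply: contraTneq e => ->; rewrite !dot_simple // eqxx nst st.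
by rewrite /phi_step nb dot_reflA // st /= ltNge (ltW e) /= lt_eqF.
Qed.

Lemma phi_simple s t : s != t -> phi s (simple t) = 1.
Proof.
move=> st; have sb : dot s (simple t) <= 0.
  by rewrite dot_simple // (negPf st); case: ifP.
have [u ub ->] := phi_pick (posroot_simple _ t) sb.
move: ub; rewrite dot_simple //; case: eqP => [->|_]; last by case: ifP.
by rewrite /phi_step eqxx.
Qed.
Lemma dotE s u b : dot s (refl u b) =
  dot s b - (if s == u then 2 * dot u b else if adj s u then - dot u b else 0).
Proof. by rewrite dot_refl //; case: ifP => _; lia. Qed.

(* [phi s b] is read off along one chosen descent of b; comparing two descents inside rank-two
   parabolic subgroups shows that every descent gives the same value. *)
Section Confluence.
Variables (ph : V -> vec -> int) (st : V -> V -> vec -> int).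
Hypothesis ph_simple : forall s t, s != t -> ph s (simple t) = 1.
Hypothesis st_simple : forall s t, st s t (simple t) = 1.
Hypothesis stN : forall s t b, b != simple t -> ~~ adj s t -> st s t b = ph s (refl t b).
Hypothesis stP : forall s t b, b != simple t -> adj s t -> 0 < dot s b + dot t b ->
  st s t b = 2 * ph t (refl s (refl t b)).
Hypothesis st0 : forall s t b, adj s t -> dot s b + dot t b = 0 ->
  st s t b = 2 * ph t (refl t b) - ph s (refl t b).
Hypothesis stM : forall s t b, adj s t -> dot s b + dot t b < 0 ->
  st s t b = ph s (refl t b) + 2 * ph t (refl t b).

Definition form_rule b := forall s t, dot s b <= 0 -> 0 < dot t b -> ph s b = st s t b.
(** Neither reflection moves such a root, so descents along s or t give nothing. The equality is
    what [Pop t (frm s) = Pop s (frm t)] becomes there. *)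
Definition form_flat b := forall s t, adj s t -> dot s b = 0 -> dot t b = 0 -> ph s b = ph t b.

Variable b : vec.
Hypothesis rb : posroot b.
Hypothesis IH : forall c, posroot c -> ht c < ht b -> form_rule c /\ form_flat c.

Lemma ruleN s t c : posroot c -> ht c < ht b ->
  dot s c <= 0 -> 0 < dot t c -> c != simple t -> ~~ adj s t -> ph s c = ph s (refl t c).
Proof. by move=> rc hc sc tc nc nst; rewrite (proj1 (IH rc hc) s t) // stN. Qed.
Lemma ruleP s t c : posroot c -> ht c < ht b ->
  dot s c <= 0 -> 0 < dot t c -> c != simple t -> 0 < dot s c + dot t c -> adj s t ->
  ph s c = 2 * ph t (refl s (refl t c)).
Proof. by move=> rc hc sc tc nc p ast; rewrite (proj1 (IH rc hc) s t) // stP. Qed.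
Lemma rule0 s t c : posroot c -> ht c < ht b ->
  dot s c <= 0 -> 0 < dot t c -> dot s c + dot t c = 0 -> adj s t ->
  ph s c = 2 * ph t (refl t c) - ph s (refl t c).
Proof. by move=> rc hc sc tc p ast; rewrite (proj1 (IH rc hc) s t) // st0. Qed.
Lemma ruleM s t c : posroot c -> ht c < ht b ->
  dot s c <= 0 -> 0 < dot t c -> dot s c + dot t c < 0 -> adj s t ->
  ph s c = ph s (refl t c) + 2 * ph t (refl t c).
Proof. by move=> rc hc sc tc p ast; rewrite (proj1 (IH rc hc) s t) // stM. Qed.

Let sC s t b' : s != t -> ~~ adj s t -> refl s (refl t b') = refl t (refl s b').
Proof. exact: refl_comm. Qed.
Let sB s t b' : adj s t -> refl s (refl t (refl s b')) = refl t (refl s (refl t b')).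
Proof. exact: refl_braid. Qed.

Let pR s c : posroot c -> c != simple s -> posroot (refl s c).
Proof. exact: posroot_refl. Qed.

Ltac klia := repeat match goal with
  | H : is_true (_ <= _) |- _ => revert H
  | H : is_true (_ < _) |- _ => revert H 
  | H : @eq ?A _ _ |- _ => unify A int; revert H end; clear; intros; lia.
Ltac sgn E := rewrite ?ht_refl ?dotE ?E /=; klia.
Ltac ns E s t r := first [ assumption
  | apply: (neq_simple (v := s)); sgn E | apply: (neq_simple (v := t)); sgn E
  | apply: (neq_simple (v := r)); sgn E ].
Ltac rt E s t r := first [ assumption | apply: pR; [rt E s t r | ns E s t r] ].
Ltac side E s t r := first
  [ assumption | match goal with |- posroot _ => rt E s t r
           | |- is_true (_ != _) => ns E s t r | _ => sgn E end ].
(* Applies a descent rule. Its side conditions (positive root, smaller height, signs, not a simple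
   root) become linear arithmetic on the pairings of b with s, t and r once [E] has decided all
   equalities and adjacencies. *)
Tactic Notation "rew" constr(l) constr(E) constr(s) constr(t) constr(r) :=
  rewrite l; [ | solve [side E s t r] ..].

(** Here s is the middle vertex of an A3 with ends t and r. Both sides are pushed down by the rules
    until they agree. Ordering the pairings of r and t leaves six of the nine sign patterns. *)
Lemma form_confl_mid s t r : dot s b <= 0 -> 0 < dot t b -> 0 < dot r b -> t != r ->
  adj s t -> adj s r -> ~~ adj t r -> dot r b <= dot t b ->
  st s t b = st s r b.
Proof.
move=> sb tb rb' ntr ast asr tr le.
have nst := negPf (nadj_neq adjxx ast); have nsr := negPf (nadj_neq adjxx asr).
have E := (eqxx, nst, nsr, negPf ntr, eq_sym t s, eq_sym r s, eq_sym r t, ast, asr, negPf tr,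
  adjC t s, adjC r s, adjC r t).
have ts : adj t s by rewrite adjC.
have rs : adj r s by rewrite adjC.
have art : ~~ adj r t by rewrite adjC.
have nrt : r != t by rewrite eq_sym.
have nbt : b != simple t by apply: (neq_simple (v := r)); sgn E.
have nbr : b != simple r by apply: (neq_simple (v := t)); sgn E.
have C := sC b nrt art.
have [p|p|p] := ltgtP (dot s b + dot t b) 0; have [q|q|q] := ltgtP (dot s b + dot r b) 0.
all: try (exfalso; klia).
- rewrite (stM ast p) (stM asr q).
  rew (@ruleN t r (refl t b)) E s t r.
  rew (@ruleN r t (refl r b)) E s t r.
  have [z|z|z] := ltgtP (dot s b + dot t b + dot r b) 0.
  + rew (@ruleM s r (refl t b)) E s t r.
    rew (@ruleM s t (refl r b)) E s t r.
    by rewrite C; ring.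
  + rew (@ruleP s r (refl t b)) E s t r.
    rew (@ruleP s t (refl r b)) E s t r.
    rewrite C.
    rew (@ruleM t s (refl t (refl r b))) E s t r.
    rew (@ruleM r s (refl t (refl r b))) E s t r.
    by ring.
  + rew (@rule0 s r (refl t b)) E s t r.
    rew (@rule0 s t (refl r b)) E s t r.
    by rewrite C; ring.
- rewrite (stP nbt ast p) (stM asr q).
  rew (@ruleN t r (refl s (refl t b))) E s t r.
  rew (@ruleM t s (refl r (refl s (refl t b)))) E s t r.
  rewrite sB // C.
  rew (@ruleP s t (refl r b)) E s t r.
  rew (@ruleN r t (refl r b)) E s t r.
  rew (@ruleP r s (refl t (refl r b))) E s t r.
  rew (@ruleN t r (refl s (refl t (refl r b)))) E s t r.
  by ring.
- rewrite (stP nbt ast p) (stP nbr asr q).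
  have [e|ne] := eqVneq (refl s (refl t b)) (simple r).
    have -> : refl s (refl r b) = simple t.
      rewrite -(reflK adjxx t b) -(reflK adjxx s (refl t b)) e (refl_simple adjC adjxx asr).
      by rewrite (sC _ nrt art) reflK // (refl_simple adjC adjxx ts) reflK.
    by rewrite e !ph_simple.
  have [e|ne'] := eqVneq (refl s (refl r b)) (simple t).
    case/eqP: ne.
    rewrite -(reflK adjxx r b) -(reflK adjxx s (refl r b)) e (refl_simple adjC adjxx ast).
    by rewrite (sC _ ntr tr) reflK // (refl_simple adjC adjxx rs) reflK.
  rew (@ruleN t r (refl s (refl t b))) E s t r.
  rew (@ruleP t s (refl r (refl s (refl t b)))) E s t r.
  rew (@ruleN r t (refl s (refl r b))) E s t r.
  rew (@ruleP r s (refl t (refl s (refl r b)))) E s t r.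
  by rewrite (sB _ asr) (sB _ ast) C (sC _ ntr tr).
- rewrite (stP nbt ast p) (st0 asr q).
  rew (@ruleN t r (refl s (refl t b))) E s t r.
  rew (@rule0 t s (refl r (refl s (refl t b)))) E s t r.
  rewrite sB // C.
  rew (@ruleN r t (refl r b)) E s t r.
  rew (@ruleP s t (refl r b)) E s t r.
  rew (@ruleP r s (refl t (refl r b))) E s t r.
  rew (@ruleN t r (refl s (refl t (refl r b)))) E s t r.
  by ring.
- rewrite (st0 ast p) (stM asr q).
  rew (@ruleN t r (refl t b)) E s t r.
  rew (@ruleP s r (refl t b)) E s t r.
  rew (@ruleP s t (refl r b)) E s t r.
  rew (@ruleN r t (refl r b)) E s t r.
  rewrite C.
  rew (@ruleM t s (refl t (refl r b))) E s t r.
  rew (@rule0 r s (refl t (refl r b))) E s t r.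
  by ring.
- rewrite (st0 ast p) (st0 asr q).
  rew (@ruleN t r (refl t b)) E s t r.
  rew (@ruleP s r (refl t b)) E s t r.
  rew (@ruleP s t (refl r b)) E s t r.
  rew (@ruleN r t (refl r b)) E s t r.
  rewrite C.
  rew (@rule0 t s (refl t (refl r b))) E s t r.
  rew (@rule0 r s (refl t (refl r b))) E s t r.
  by ring.
Qed.

(** The reflection in r commutes with those in s and t, so the descent along r can be exchanged with
    every step inside {s, t}. *)
Lemma form_confl_far s t r : dot s b <= 0 -> 0 < dot t b -> 0 < dot r b -> t != r ->
  ~~ adj s r -> ~~ adj t r -> st s t b = st s r b.
Proof.
move=> sb tb rb' ntr asr tr.
have nst : s == t = false by apply: contraTF tb => /eqP <-; rewrite -leNgt.
have nsr : s == r = false by apply: contraTF rb' => /eqP <-; rewrite -leNgt.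
have E0 := (eqxx, nst, nsr, negPf ntr, eq_sym t s, eq_sym r s, eq_sym r t, negPf asr, negPf tr,
  adjC t s, adjC r s, adjC r t).
have art : ~~ adj r t by rewrite adjC.
have nrt : r != t by rewrite eq_sym.
have nrs : r != s by rewrite eq_sym nsr.
have ars : ~~ adj r s by rewrite adjC.
have nbt : b != simple t by apply: (neq_simple (v := r)); sgn E0.
have nbr : b != simple r by apply: (neq_simple (v := t)); sgn E0.
have C := sC b nrt art.
rewrite (stN nbr asr).
case: (boolP (adj s t)) => ast; last first.
  have E := (negPf ast, E0).
  rewrite stN //.
  rew (@ruleN s r (refl t b)) E s t r.
  rew (@ruleN s t (refl r b)) E s t r.
  by rewrite C.
have E := (ast, E0).
have [p|p|p] := ltgtP (dot s b + dot t b) 0.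
- rewrite (stM ast p).
  rew (@ruleN t r (refl t b)) E s t r.
  rew (@ruleN s r (refl t b)) E s t r.
  rew (@ruleM s t (refl r b)) E s t r.
  by rewrite C.
- rewrite (stP nbt ast p).
  rew (@ruleN t r (refl s (refl t b))) E s t r.
  rew (@ruleP s t (refl r b)) E s t r.
  by rewrite (sC _ nrs ars) C.
- rewrite (st0 ast p).
  rew (@ruleN t r (refl t b)) E s t r.
  rew (@ruleN s r (refl t b)) E s t r.
  rew (@rule0 s t (refl r b)) E s t r.
  by rewrite C.
Qed.

(** The two descents are compared through the braid relation of t and r; if s is joined to t as
    well, the three vertices form an A3 with middle t. *)
Lemma form_confl_adj s t r : dot s b <= 0 -> 0 < dot t b -> 0 < dot r b ->
  ~~ adj s r -> adj t r -> st s t b = st s r b.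
Proof.
move=> sb tb rb' asr tr.
have ntr := nadj_neq adjxx tr.
have nst : s == t = false by apply: contraTF tb => /eqP <-; rewrite -leNgt.
have nsr : s == r = false by apply: contraTF rb' => /eqP <-; rewrite -leNgt.
have E0 := (eqxx, nst, nsr, negPf ntr, eq_sym t s, eq_sym r s, eq_sym r t, negPf asr, tr,
  adjC t s, adjC r s, adjC r t).
have art : adj r t by rewrite adjC.
have nrt : r != t by rewrite eq_sym.
have nrs : r != s by rewrite eq_sym nsr.
have ars : ~~ adj r s by rewrite adjC.
have nbt : b != simple t by apply: (neq_simple (v := r)); sgn E0.
have nbr : b != simple r by apply: (neq_simple (v := t)); sgn E0.
rewrite (stN nbr asr).
(* In this case b is the sum of the simple roots of t and r, and one descent already reaches a
   simple root, where the rules stop. *)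
have [e|ne] := eqVneq (refl t b) (simple r).
  have be : b = refl t (simple r) by rewrite -e reflK.
  have -> : refl r b = simple t by rewrite be -(refl_simple adjC adjxx art) reflK.
  rewrite (ph_simple (negbT nst)).
  case: (boolP (adj s t)) => ast; last by rewrite stN // e (ph_simple (negbT nsr)).
  rewrite st0 ?e ?(ph_simple (negbT nsr)) ?(ph_simple ntr) //.
  by rewrite be !dotE !dot_simple // !(ast, E0).
have ne' : refl r b != simple t.
  apply: contra_neq ne => e; have be : b = refl r (simple t) by rewrite -e reflK.
  by rewrite be (refl_simple adjC adjxx art) reflK.
have B := sB b tr.
case: (boolP (adj s t)) => ast; last first.
  have E := (negPf ast, E0).
  rewrite stN //.
  rew (@ruleN s r (refl t b)) E s t r.
  rew (@ruleN s t (refl r (refl t b))) E s t r.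
  rew (@ruleN s t (refl r b)) E s t r.
  rew (@ruleN s r (refl t (refl r b))) E s t r.
  by rewrite B.
have E := (ast, E0).
have [p|p|p] := ltgtP (dot s b + dot t b) 0.
- rewrite (stM ast p).
  rew (@ruleN s r (refl t b)) E s t r.
  rew (@ruleP t r (refl t b)) E s t r.
  have [z|z|z] := ltgtP (dot s b + dot t b + dot r b) 0.
  + rew (@ruleM s t (refl r (refl t b))) E s t r.
    rew (@ruleM s t (refl r b)) E s t r.
    rew (@ruleN s r (refl t (refl r b))) E s t r.
    rew (@ruleM t r (refl t (refl r b))) E s t r.
    by rewrite B; ring.
  + rew (@ruleP s t (refl r (refl t b))) E s t r.
    rew (@ruleP s t (refl r b)) E s t r.
    rew (@ruleM t r (refl s (refl t (refl r b)))) E s t r.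
    rewrite (sC _ nrs ars) B.
    rew (@ruleN r s (refl r (refl t (refl r b)))) E s t r.
    by ring.
  + rew (@rule0 s t (refl r (refl t b))) E s t r.
    rew (@rule0 s t (refl r b)) E s t r.
    rew (@ruleN s r (refl t (refl r b))) E s t r.
    rew (@ruleM t r (refl t (refl r b))) E s t r.
    by rewrite B; ring.
- rewrite (stP nbt ast p).
  rew (@ruleP t r (refl s (refl t b))) E s t r.
  rew (@ruleP s t (refl r b)) E s t r.
  rew (@ruleP t r (refl s (refl t (refl r b)))) E s t r.
  rew (@ruleN r s (refl t (refl r (refl s (refl t b))))) E s t r.
  rewrite (sC (refl t b) nrs ars) (sB _ ast) B (sC _ nrs ars).
  by [].
- rewrite (st0 ast p).
  rew (@ruleP t r (refl t b)) E s t r.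
  rew (@ruleN s r (refl t b)) E s t r.
  rew (@ruleP s t (refl r (refl t b))) E s t r.
  rew (@ruleP s t (refl r b)) E s t r.
  rew (@rule0 t r (refl s (refl t (refl r b)))) E s t r.
  rewrite (sC _ nrs ars) B.
  rew (@ruleN r s (refl r (refl t (refl r b)))) E s t r.
  by ring.
Qed.

Lemma form_confl s t r : dot s b <= 0 -> 0 < dot t b -> 0 < dot r b ->
  st s t b = st s r b.
Proof.
move=> sb tb rb'; have [->//|ntr] := eqVneq t r.
have nrt : r != t by rewrite eq_sym.
case: (boolP (adj t r)) => tr; last first.
  have art : ~~ adj r t by rewrite adjC.
  case: (boolP (adj s r)) => asr; last exact: form_confl_far.
  case: (boolP (adj s t)) => ast; last by apply/esym/form_confl_far.
  by case: (leP (dot r b) (dot t b)) => [|/ltW] le; [|apply/esym]; exact: form_confl_mid.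
case: (boolP (adj s r)) => asr; last exact: form_confl_adj.
(* The only configuration left would be a triangle. *)
have ast : ~~ adj s t by apply/negP => ast; exact: (adj_tri ast tr asr).
by apply/esym/form_confl_adj => //; rewrite adjC.
Qed.

Hypothesis ruleb : form_rule b.

Lemma form_confl_flat_adj s t r : adj s t -> dot s b = 0 -> dot t b = 0 -> 0 < dot r b ->
  adj t r -> ph s b = ph t b.
Proof.
move=> ast sb0 tb0 rb' tr.
have asr : ~~ adj s r by apply/negP => asr; exact: (adj_tri ast tr asr).
have nst := negPf (nadj_neq adjxx ast).
have ntr := negPf (nadj_neq adjxx tr).
have nsr : s == r = false by apply: contraTF rb' => /eqP <-; rewrite sb0.
have E := (eqxx, nst, nsr, ntr, eq_sym t s, eq_sym r s, eq_sym r t, negPf asr, tr, ast,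
  adjC t s, adjC r s, adjC r t).
have ars : ~~ adj r s by rewrite adjC.
have art : adj r t by rewrite adjC.
have nbr : b != simple r by apply: (neq_simple (v := t)); sgn E.
rewrite (ruleb (s := s) (t := r)) ?sb0 // (ruleb (s := t) (t := r)) ?tb0 //.
rewrite stN // stP ?tb0 ?add0r //.
rew (@ruleP s t (refl r b)) E s t r.
have ne : refl t (refl r b) != simple s.
  apply/eqP => e; have := congr1 (fun c => dot s c) e; have := congr1 (fun c => dot t c) e.
  rewrite !dotE !dot_simple // !E /=; klia.
rew (@ruleN r s (refl t (refl r b))) E s t r.
by congr (2 * _); apply: (proj2 (IH _ _)) => //; [rt E s t r | sgn E ..].
Qed.

Lemma form_confl_flat : form_flat b.
Proof.
move=> s t ast sb0 tb0; have [r rb'] := posroot_low adjxx rb.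
have nsr : s != r by apply: contraTneq rb' => <-; rewrite sb0.
have ntr : t != r by apply: contraTneq rb' => <-; rewrite tb0.
have ats : adj t s by rewrite adjC.
case: (boolP (adj t r)) => tr; first exact: form_confl_flat_adj tr.
case: (boolP (adj s r)) => sr; first by apply/esym; exact: form_confl_flat_adj sr.
rewrite (ruleb (s := s) (t := r)) ?sb0 // (ruleb (s := t) (t := r)) ?tb0 //.
have [->|nbr] := eqVneq b (simple r); first by rewrite !st_simple.
rewrite !stN //.
apply: (proj2 (IH _ _)) => //; first exact: pR.
- by rewrite ht_refl; lia.
- by rewrite dot_reflN.
- by rewrite dot_reflN.
Qed.
End Confluence.

Lemma phi_rules b : posroot b -> form_rule phi (phi_step phi) b /\ form_flat phi b.
Proof.
have [n le] := ubnP `|ht b|%N; elim: n => // n IHn in b le *.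
move=> rb; have IH c : posroot c -> ht c < ht b -> form_rule phi (phi_step phi) c /\ form_flat phi c.
  by move=> rc lt; apply: IHn => //; have := posroot_ht rc; have := posroot_ht rb; lia.
have R : form_rule phi (phi_step phi) b.
{ move=> s t sb tb; have [r rb' ->] := phi_pick rb sb.
  apply: (@form_confl phi (phi_step phi)) => //.
  all: by move=> *; first [exact: phi_simple | exact: phi_stepN | exact: phi_stepP
    | exact: phi_step0 | exact: phi_stepM | rewrite /phi_step eqxx]. }
split=> //; apply: (@form_confl_flat phi (phi_step phi)) => //.
all: by move=> *; first [exact: phi_simple | exact: phi_stepN | exact: phi_stepP
  | exact: phi_step0 | exact: phi_stepM | rewrite /phi_step eqxx].
Qed.

Record is_form (ph : V -> vec -> int) : Prop := IsForm {
  form_gt0 : forall s b, 0 < dot s b -> ph s b = if b == simple s then 2 else 0;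
  form_simple : forall s t, s != t -> ph s (simple t) = 1;
  formN : forall s t b, posroot b -> dot s b <= 0 -> 0 < dot t b -> b != simple t ->
    ~~ adj s t -> ph s b = ph s (refl t b);
  formP : forall s t b, posroot b -> dot s b <= 0 -> 0 < dot t b -> b != simple t ->
    adj s t -> 0 < dot s b + dot t b -> ph s b = 2 * ph t (refl s (refl t b));
  form0 : forall s t b, posroot b -> dot s b <= 0 -> 0 < dot t b ->
    adj s t -> dot s b + dot t b = 0 -> ph s b = 2 * ph t (refl t b) - ph s (refl t b);
  formM : forall s t b, posroot b -> dot s b <= 0 -> 0 < dot t b ->
    adj s t -> dot s b + dot t b < 0 -> ph s b = ph s (refl t b) + 2 * ph t (refl t b);
  form_flat0 : forall s t b, posroot b -> adj s t -> dot s b = 0 -> dot t b = 0 ->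
    ph s b = ph t b }.

Lemma exists_form : exists ph, is_form ph.
Proof.
exists phi; split.
- exact: phi_gt0.
- exact: phi_simple.
- by move=> s t b rb sb tb nb nst; rewrite (proj1 (phi_rules rb) s t sb tb) phi_stepN.
- by move=> s t b rb sb tb nb st p; rewrite (proj1 (phi_rules rb) s t sb tb) phi_stepP.
- by move=> s t b rb sb tb st p; rewrite (proj1 (phi_rules rb) s t sb tb) phi_step0.
- by move=> s t b rb sb tb st p; rewrite (proj1 (phi_rules rb) s t sb tb) phi_stepM.
- by move=> s t b rb; exact: (proj2 (phi_rules rb)).
Qed.
End Forms.

(** * The degenerate operators and their braid relations *)

Section Operators.
Local Open Scope ring_scope.
Opaque refl dot simple.
Variables (V : finType) (adj : rel V).
Hypothesis adjC : symmetric adj.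
Hypothesis adjxx : irreflexive adj.
Hypothesis adj_tri : forall u v w, adj u v -> adj v w -> adj u w -> False.

Notation vec := {ffun V -> int}.
Local Notation dot := (dot adj).
Local Notation refl := (refl adj).
Local Notation posroot := (posroot adj).

(** The Lawrence-Krammer-Paris operator in a rescaled basis, with one parameter at 1/2 and the other
    at 0. At 1/2 both coefficients of the last case on roots are positive, so nonnegative functions
    stay nonnegative. *)
Definition Pop (s : V) (h : vec -> rat) (b : vec) : rat :=
  if `[< posroot b >] then
    if b == simple s then 0
    else if 0 < dot s b then h (refl s b)
    else if dot s b == 0 then h b
    else (h b + h (refl s b)) / 2
  else h b.

Lemma Pop_out s h b : ~ posroot b -> Pop s h b = h b.
Proof. by rewrite /Pop => nb; case: asboolP. Qed.
Lemma Pop_simple s h : Pop s h (simple s) = 0.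
Proof. by rewrite /Pop eqxx; case: asboolP => // -[]; exact: posroot_simple. Qed.
Lemma Pop_gt s h b : posroot b -> b != simple s -> 0 < dot s b -> Pop s h b = h (refl s b).
Proof. by rewrite /Pop => rb /negPf -> ->; case: asboolP. Qed.
Lemma Pop_eq s h b : posroot b -> dot s b = 0 -> Pop s h b = h b.
Proof.
rewrite /Pop => rb e; case: asboolP => // _; rewrite e /= ifF //.
by apply/negP => /eqP eb; move: e; rewrite eb dot_simple // eqxx.
Qed.
Lemma Pop_lt s h b : posroot b -> dot s b < 0 -> Pop s h b = (h b + h (refl s b)) / 2.
Proof.
rewrite /Pop => rb lt; case: asboolP => // _; rewrite ltNge (ltW lt) /= (lt_eqF lt) ifF //.
by apply/negP => /eqP eb; move: lt; rewrite eb dot_simple // eqxx.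
Qed.

Lemma Pop_lin s h k c : Pop s (fun b => h b + c * k b) = (fun b => Pop s h b + c * Pop s k b).
Proof.
apply: funext => b; rewrite /Pop; case: asboolP => // _.
by case: ifP => _; [ring|case: ifP => _ //; case: ifP => _ //; field].
Qed.

Ltac klia := repeat match goal with
  | H : is_true (_ <= _) |- _ => revert H
  | H : is_true (_ < _) |- _ => revert H 
  | H : @eq ?A _ _ |- _ => unify A int; revert H end; clear; intros; lia.

Let pR s c : posroot c -> c != simple s -> posroot (refl s c).
Proof. exact: posroot_refl. Qed.

Lemma posroot_refl_neq s b : posroot b -> refl s b != simple s.
Proof.
move=> rb; apply/eqP => e; have := posroot_ht rb.
by rewrite -(reflK adjxx s b) e ht_refl ht_simple dot_simple // eqxx.
Qed.

Let dE s u b : dot s (refl u b) =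
  dot s b - (if s == u then 2 * dot u b else if adj s u then - dot u b else 0).
Proof. exact: dotE. Qed.

Ltac evalP E P := repeat match goal with |- context [Pop ?u ?h ?x] =>
  first [ rewrite (@Pop_gt u h x); [| solve [P] | solve [P] | rewrite ?dE ?E /=; klia]
        | rewrite (@Pop_eq u h x); [| solve [P] | rewrite ?dE ?E /=; klia]
        | rewrite (@Pop_lt u h x); [| solve [P] | rewrite ?dE ?E /=; klia] ] end.

Lemma Pop_comm s t h : s != t -> ~~ adj s t -> Pop s (Pop t h) = Pop t (Pop s h).
Proof.
move=> nst ast; apply: funext => b.
case: (asboolP (posroot b)) => [rb|nb]; last by rewrite !Pop_out.
have ats : ~~ adj t s by rewrite adjC.
have E := (eqxx, negPf nst, eq_sym t s, negPf ast, negPf ats).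
have [->|ns] := eqVneq b (simple s).
  rewrite Pop_simple Pop_eq ?Pop_simple //; first exact: posroot_simple.
  by rewrite dot_simple // !E.
have [->|nt] := eqVneq b (simple t).
  rewrite Pop_simple Pop_eq ?Pop_simple //; first exact: posroot_simple.
  by rewrite dot_simple // !E.
have rs := pR rb ns; have rt := pR rb nt.
have n1 : refl s b != simple t.
  apply: contraNneq nt => e.
  by rewrite -(reflK adjxx s b) e refl_fix // dot_simple // !E.
have n2 : refl t b != simple s.
  apply: contraNneq ns => e.
  by rewrite -(reflK adjxx t b) e refl_fix // dot_simple // !E.
have C := refl_comm adjC adjxx b nst ast.
have [a|a|a] := ltgtP (dot s b) 0; have [c|c|c] := ltgtP (dot t b) 0.
all: evalP E assumption.
all: rewrite ?C //; lra.
Qed.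

(** A Hecke-type relation with eigenvalues 1 and -1/2. It is restricted to functions vanishing at
    the simple root of s because the operator kills the value there. *)
Lemma Pop_quad s h : h (simple s) = 0 ->
  Pop s (Pop s h) = (fun b => if `[< posroot b >] then 2^-1 * h b + 2^-1 * Pop s h b else h b).
Proof.
move=> h0; apply: funext => b; case: asboolP => [rb|nb]; last by rewrite !Pop_out.
have [->|ns] := eqVneq b (simple s); first by rewrite !Pop_simple h0; ring.
have E := eqxx; have rs := pR rb ns; have rn := posroot_refl_neq s rb.
have [a|a|a] := ltgtP (dot s b) 0; evalP E assumption; rewrite ?reflK //; lra.
Qed.

Section Braid.
Variables s t : V.
Hypothesis ast : adj s t.
Let ats : adj t s. Proof. by rewrite adjC. Qed.
Let nst : s != t. Proof. exact: nadj_neq ast. Qed.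
Let E := (eqxx, negPf nst, eq_sym t s, ast, ats).
Local Notation g := (refl s (simple t)).

Let geE : refl t (simple s) = g. Proof. by rewrite refl_simple. Qed.
Let gs : dot s g = 1. Proof. by rewrite dotE // !dot_simple // !E. Qed.
Let gt : dot t g = 1. Proof. by rewrite dotE // !dot_simple // !E. Qed.
Let gr : posroot g.
Proof. by apply: posroot_up; [exact: posroot_simple | rewrite dot_simple // !E]. Qed.
Let gns : g != simple s. Proof. exact/posroot_refl_neq/posroot_simple. Qed.
Let gnt : g != simple t. Proof. by rewrite -geE; apply/posroot_refl_neq/posroot_simple. Qed.
Let simr u : posroot (simple u). Proof. exact: posroot_simple. Qed.

(** The roots outside the A2 spanned by s and t: both reflections preserve this set, so the braid
    relation on it is a computation with signs. The three positive roots of the A2 are checked one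
    by one. *)
Definition generic b := [/\ posroot b, b != simple s, b != simple t & b != g].

Lemma generic_refl_s b : generic b -> generic (refl s b).
Proof.
move=> [rb n1 n2 n3]; split; [exact: pR | exact: posroot_refl_neq | |].
  by apply: contraNneq n3 => e; rewrite -(reflK adjxx s b) e.
by apply: contraNneq n2 => e; rewrite -(reflK adjxx s b) e reflK.
Qed.
Lemma generic_refl_t b : generic b -> generic (refl t b).
Proof.
move=> [rb n1 n2 n3]; split; [exact: pR | | exact: posroot_refl_neq |].
  by apply: contraNneq n3 => e; rewrite -(reflK adjxx t b) e geE.
by apply: contraNneq n1 => e; rewrite -(reflK adjxx t b) e -geE reflK.
Qed.

Lemma generic_posroot b : generic b -> posroot b. Proof. by case. Qed.
Lemma generic_neq_s b : generic b -> b != simple s. Proof. by case. Qed.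
Lemma generic_neq_t b : generic b -> b != simple t. Proof. by case. Qed.

Lemma generic_cases b : posroot b -> [\/ b = simple s, b = simple t, b = g | generic b].
Proof.
move=> rb; have [->|n1] := eqVneq b (simple s); first by constructor 1.
have [->|n2] := eqVneq b (simple t); first by constructor 2.
have [->|n3] := eqVneq b g; first by constructor 3.
by constructor 4.
Qed.

Ltac gen := lazymatch goal with
  | |- generic (refl ?u _) =>
      first [constr_eq u s; simple apply generic_refl_s | simple apply generic_refl_t]; gen
  | _ => assumption end.
Ltac gside := idtac; lazymatch goal with
  | |- posroot _ => simple apply generic_posroot; gen
  | |- is_true (_ != simple ?u) =>
      first [constr_eq u s; simple apply generic_neq_s | simple apply generic_neq_t]; gen end.

Lemma Pop_t_s h : Pop t h (simple s) = (h (simple s) + h g) / 2.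
Proof. by rewrite Pop_lt ?geE // dot_simple // !E. Qed.
Lemma Pop_s_t h : Pop s h (simple t) = (h (simple t) + h g) / 2.
Proof. by rewrite Pop_lt // dot_simple // !E. Qed.
Lemma Pop_s_g h : Pop s h g = h (simple t).
Proof. by rewrite Pop_gt ?gs // reflK. Qed.
Lemma Pop_t_g h : Pop t h g = h (simple s).
Proof. by rewrite Pop_gt ?gt // -geE reflK. Qed.

Lemma Pop_braid h : Pop s (Pop t (Pop s h)) = Pop t (Pop s (Pop t h)).
Proof.
apply: funext => b; case: (asboolP (posroot b)) => [rb|nb]; last by rewrite !Pop_out.
case: (generic_cases rb) => [->|->|->|gb].
- by rewrite Pop_t_s Pop_s_g !Pop_simple; ring.
- by rewrite Pop_s_t Pop_t_g !Pop_simple; ring.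
- by rewrite Pop_s_g Pop_t_g !Pop_simple.
have B := refl_braid adjC adjxx b ast.
have [a|a|a] := ltgtP (dot s b) 0; have [c|c|c] := ltgtP (dot t b) 0.
all: have [z|z|z] := ltgtP (dot s b + dot t b) 0; try (exfalso; klia).
all: evalP E gside.
all: rewrite ?reflK ?B //; lra.
Qed.

End Braid.

End Operators.

(** * The rank-one deformation and its inverse *)

Section Operators.
Local Open Scope ring_scope.
Opaque refl dot simple.
Variables (V : finType) (adj : rel V).
Hypothesis adjC : symmetric adj.
Hypothesis adjxx : irreflexive adj.
Hypothesis adj_tri : forall u v w, adj u v -> adj v w -> adj u w -> False.

Notation vec := {ffun V -> int}.
Local Notation dot := (dot adj).
Local Notation refl := (refl adj).
Local Notation posroot := (posroot adj).

Local Notation Pop := (Pop adj).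
Local Notation generic := (generic adj).

Let pR s c : posroot c -> c != simple s -> posroot (refl s c).
Proof. exact: posroot_refl. Qed.
Let dE s u b : dot s (refl u b) =
  dot s b - (if s == u then 2 * dot u b else if adj s u then - dot u b else 0).
Proof. exact: dotE. Qed.

Ltac klia := repeat match goal with
  | H : is_true (_ <= _) |- _ => revert H
  | H : is_true (_ < _) |- _ => revert H 
  | H : @eq ?A _ _ |- _ => unify A int; revert H end; clear; intros; lia.

Variable phi : V -> vec -> int.
Hypothesis phiP : is_form adj phi.

(** The shift by 1 relates two normalizations: the recursion for [phi] has no constant terms, while
    the form entering the representation is 1 at the simple root of s, 0 at the other simple roots,
    and -1 at the remaining roots of positive pairing with s. *)
Definition frm (s : V) (b : vec) : rat := if `[< posroot b >] then (phi s b - 1)%:~R else 0.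

Lemma frm_gt u b : posroot b -> b != simple u -> 0 < dot u b -> frm u b = -1.
Proof. by move=> rb /negPf nb lt; rewrite /frm (form_gt0 phiP) // nb; case: asboolP. Qed.
Lemma frm_phi u b : posroot b -> frm u b = (phi u b)%:~R - 1.
Proof. by move=> rb; rewrite /frm; case: asboolP => // _; rewrite rmorphB. Qed.
Lemma frm_simple s t : frm s (simple t) = (s == t)%:R.
Proof.
have rt := posroot_simple adj t; rewrite frm_phi //.
have [->|nst] := eqVneq s t; last by rewrite (form_simple phiP).
by rewrite (form_gt0 phiP) ?eqxx // dot_simple // eqxx.
Qed.

Lemma frm_out s b : ~ posroot b -> frm s b = 0.
Proof. by rewrite /frm; case: asboolP. Qed.

(** One of the two conditions under which the rank-one terms of [psi] respect the defining
    relations; the other one is [Pop_frm_adj]. *)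
Lemma Pop_frm_comm s t : s != t -> ~~ adj s t -> Pop t (frm s) = frm s.
Proof.
move=> nst ast; apply: funext => b.
case: (asboolP (posroot b)) => [rb|nb]; last by rewrite Pop_out.
have ats : ~~ adj t s by rewrite adjC.
have E := (eqxx, negPf nst, eq_sym t s, negPf ast, negPf ats).
have [->|nt] := eqVneq b (simple t); first by rewrite Pop_simple frm_simple // !E.
have up c : posroot c -> c != simple t -> 0 < dot t c -> frm s (refl t c) = frm s c.
  move=> rc nc ct; have rt := pR rc nc; rewrite !frm_phi //.
  have [ge0|le0] := ltP 0 (dot s c); last by rewrite (formN phiP rc le0 ct nc ast).
  rewrite !(form_gt0 phiP) ?dE ?E /= ?subr0 //.
  have nE d : 0 < dot t d \/ dot t d < 0 -> (d == simple s) = false.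
    by move=> h; apply/negP => /eqP e; move: h; rewrite e dot_simple // !E => -[].
  by rewrite !nE //; [left|right; rewrite dE !E; klia].
have [a|a|a] := ltgtP (dot t b) 0; last by rewrite Pop_eq.
  rewrite Pop_lt // -(up (refl t b)) ?reflK //; last by rewrite dE !E; klia.
  - by field.
  - exact: pR.
  - exact: posroot_refl_neq.
by rewrite Pop_gt // up.
Qed.

(** The two sign conditions select patterns from which all others follow by exchanging s and t. *)
Lemma frm_adj_generic s t b : adj s t -> generic s t b ->
  (dot s b < 0 -> dot t b < 0) -> (dot s b = 0 -> dot t b <= 0) ->
  Pop t (frm s) b = Pop s (frm t) b.
Proof.
move=> ast gb h1 h2.
have ats : adj t s by rewrite adjC.
have nst := nadj_neq adjxx ast.
have E := (eqxx, negPf nst, eq_sym t s, ast, ats).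
have rb := generic_posroot gb.
have gs := generic_refl_s adjC adjxx gb; have gt := generic_refl_t adjC adjxx ast gb.
have rs := generic_posroot gs; have rt := generic_posroot gt.
have ns := generic_neq_s gb; have nt := generic_neq_t gb.
have ds : dot t (refl s b) = dot s b + dot t b by rewrite dE !E; klia.
have dt : dot s (refl t b) = dot s b + dot t b by rewrite dE !E; klia.
have ds1 : dot s (refl s b) = - dot s b by rewrite dE !E; klia.
have dt1 : dot t (refl t b) = - dot t b by rewrite dE !E; klia.
have ns' := generic_neq_t gs; have nt' := generic_neq_s gt.
have nss := generic_neq_s gs; have ntt := generic_neq_t gt.
have rs2 := reflK adjxx s b; have rt2 := reflK adjxx t b.
case: (ltgtP (dot s b) 0) h1 h2 => a h1 h2.
- have c := h1 isT; rewrite !Pop_lt // !frm_phi //.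
  have -> : phi s (refl t b) = phi s b + 2 * phi t b.
    by rewrite (formM phiP rt (s := s) (t := t)) ?rt2 ?dt ?dt1 //; klia.
  have -> : phi t (refl s b) = phi t b + 2 * phi s b.
    by rewrite (formM phiP rs (s := t) (t := s)) ?rs2 ?ds ?ds1 //; klia.
  by rewrite !rmorphD !rmorphM /=; field.
- rewrite [RHS]Pop_gt //; case: (ltgtP (dot t b) 0) => c.
  + rewrite Pop_lt // (frm_gt rb) //.
    have [z|z] := ltP 0 (dot s b + dot t b).
      by rewrite !frm_gt ?ds ?dt //; field.
    rewrite !frm_phi //.
    have -> : phi s (refl t b) = 2 * phi t (refl s b).
      by rewrite (formP phiP rt (s := s) (t := t)) ?rt2 ?dt ?dt1 //; klia.
    by rewrite rmorphM /=; field.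
  + by rewrite Pop_gt // !frm_gt ?ds ?dt //; klia.
  + by rewrite Pop_eq // !frm_gt // ds c addr0.
- have c := h2 a; rewrite [RHS]Pop_eq //; case: (ltgtP (dot t b) 0) c => // c _.
    rewrite Pop_lt // !frm_phi //.
    have -> : phi s (refl t b) = 2 * phi t b - phi s b.
      by rewrite (form0 phiP rt (s := s) (t := t)) ?rt2 ?dt ?dt1 //; klia.
    by rewrite rmorphB rmorphM /=; field.
  by rewrite Pop_eq // !frm_phi // (form_flat0 phiP rb ast).
Qed.

Lemma generic_sym s t b : adj s t -> generic s t b -> generic t s b.
Proof. by move=> ast [? ? ? ?]; split; rewrite // -refl_simple. Qed.

Lemma frm_sum s t : adj s t ->
  frm s (refl s (simple t)) = -1 /\ frm t (refl s (simple t)) = -1.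
Proof.
move=> ast; have ats : adj t s by rewrite adjC.
have nst := nadj_neq adjxx ast.
have E := (eqxx, negPf nst, eq_sym t s, ast, ats).
have gr : posroot (refl s (simple t)).
  by apply: posroot_up; [exact: posroot_simple | rewrite dot_simple // !E].
split; rewrite frm_gt //.
- exact/posroot_refl_neq/posroot_simple.
- by rewrite dE !dot_simple // !E.
- by rewrite refl_simple //; apply/posroot_refl_neq/posroot_simple.
- by rewrite dE !dot_simple // !E.
Qed.

Lemma Pop_frm_adj s t : adj s t -> Pop t (frm s) = Pop s (frm t).
Proof.
move=> ast; apply: funext => b.
case: (asboolP (posroot b)) => [rb|nb]; last by rewrite !Pop_out // !frm_out.
have ats : adj t s by rewrite adjC.
have nst := nadj_neq adjxx ast.
have nts : t != s by rewrite eq_sym.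
have E := (eqxx, negPf nst, eq_sym t s, ast, ats).
have [gs gt] := frm_sum ast.
case: (generic_cases s t rb) => [->|->|->|gb].
- by rewrite Pop_simple Pop_t_s // gs frm_simple eqxx /=; field.
- by rewrite Pop_simple Pop_s_t // gt frm_simple eqxx /=; field.
- by rewrite Pop_s_g // Pop_t_g // !frm_simple !eqxx.
have gb' := generic_sym ast gb.
have [a|a|a] := ltgtP (dot s b) 0; have [c|c|c] := ltgtP (dot t b) 0.
all: try (by apply: frm_adj_generic => //; rewrite ?a ?c; lia).
all: by apply/esym/frm_adj_generic => //; rewrite ?a ?c; lia.
Qed.

(** The rank-one term restores what [Pop] destroys: the value at the simple root of s is multiplied
    by x instead of being killed, which makes the operator invertible for nonzero x. *)
Definition psi (x : rat) (s : V) (h : vec -> rat) (b : vec) : rat :=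
  Pop s h b + (x * h (simple s)) * frm s b.

Lemma psi_comm x s t h : s != t -> ~~ adj s t -> psi x s (psi x t h) = psi x t (psi x s h).
Proof.
move=> nst ast.
have nts : t != s by rewrite eq_sym.
have ats : ~~ adj t s by rewrite adjC.
have E := (eqxx, negPf nst, eq_sym t s, negPf ast, negPf ats).
have Es u : psi x u = fun k => (fun b => Pop u k b + (x * k (simple u)) * frm u b) by [].
have e1 : Pop t h (simple s) = h (simple s).
  by rewrite Pop_eq // ?dot_simple // ?E //; exact: posroot_simple.
have e2 : Pop s h (simple t) = h (simple t).
  by rewrite Pop_eq // ?dot_simple // ?E //; exact: posroot_simple.
rewrite !Es !Pop_lin !Pop_frm_comm // Pop_comm //; apply: funext => b.
by rewrite e1 e2 !frm_simple !E /=; ring.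
Qed.

Lemma Pop_frm_quad s t : adj s t -> Pop s (Pop t (frm s)) = fun b => 2^-1 * frm t b + 2^-1 * Pop t (frm s) b.
Proof.
move=> ast; have ats : adj t s by rewrite adjC.
have nst := nadj_neq adjxx ast.
rewrite [X in Pop s X]Pop_frm_adj // (Pop_quad adjC adjxx); last by rewrite frm_simple eq_sym (negPf nst).
rewrite (Pop_frm_adj ast); apply: funext => b; case: asboolP => // nb.
by rewrite Pop_out // !frm_out //; ring.
Qed.

Lemma psi_braid x s t h : adj s t ->
  psi x s (psi x t (psi x s h)) = psi x t (psi x s (psi x t h)).
Proof.
move=> ast; have ats : adj t s by rewrite adjC.
have nst := nadj_neq adjxx ast.
have E := (eqxx, negPf nst, eq_sym t s).
have Es u : psi x u = fun k => (fun b => Pop u k b + (x * k (simple u)) * frm u b) by [].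
have F := Pop_frm_adj ats.
rewrite !Es !Pop_lin (Pop_braid adjC adjxx ast) (Pop_frm_quad ast) (Pop_frm_quad ats).
apply: funext => b.
rewrite !(Pop_t_s adjC adjxx ast) !(Pop_s_t adjxx ast) !(Pop_s_g adjxx ast) !(Pop_t_g adjC adjxx ast).
rewrite !Pop_simple !F !frm_simple !E /= !(proj1 (frm_sum ast)) !(proj2 (frm_sum ast)).
by field.
Qed.

(** The value at the simple root of s, divided by x, recovers the lost coordinate. Subtracting its
    contribution through the form leaves [Pop], which is inverted on each pair of roots exchanged by
    the reflection in s. *)
Definition psiV (x : rat) (s : V) (k : vec -> rat) (b : vec) : rat :=
  let k' c := k c - frm s c * k (simple s) in
  if `[< posroot b >] then
    if b == simple s then k b / x
    else if 0 < dot s b then 2 * k' (refl s b) - k' b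
    else if dot s b == 0 then k' b
    else k' (refl s b)
  else k b.

Lemma psiK x s h : x != 0 -> psiV x s (psi x s h) = h.
Proof.
move=> x0; apply: funext => b; rewrite /psiV; case: asboolP => [rb|nb]; last first.
  by rewrite /psi Pop_out // frm_out //; ring.
case: (altP (b =P simple s)) => [->|ns].
  by rewrite /psi Pop_simple frm_simple eqxx /=; field.
have rs := posroot_refl adjC adjxx rb ns; have rn := posroot_refl_neq adjxx s rb.
rewrite /psi Pop_simple frm_simple eqxx /=.
have [a|a|a] := ltgtP (dot s b) 0.
- by rewrite Pop_gt // ?reflK ?dot_refl1 //; [ring | lia].
- rewrite Pop_lt // ?reflK ?dot_refl1 //; last by lia.
  by rewrite (Pop_gt _ rb ns a); field.
- by rewrite Pop_eq //; ring.
Qed.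

Lemma psiVK x s k : x != 0 -> psi x s (psiV x s k) = k.
Proof.
move=> x0; apply: funext => b; case: (asboolP (posroot b)) => [rb|nb]; last first.
  by rewrite /psi Pop_out // frm_out // /psiV; case: asboolP => // _; ring.
have Vs : psiV x s k (simple s) = k (simple s) / x.
  by rewrite /psiV eqxx; case: asboolP => // -[]; exact: posroot_simple.
rewrite /psi Vs; have [->|ns] := eqVneq b (simple s).
  by rewrite Pop_simple frm_simple eqxx /=; field.
have rs := posroot_refl adjC adjxx rb ns; have rn := posroot_refl_neq adjxx s rb.
have Vb c : posroot c -> c != simple s -> psiV x s k c =
  let k' c := k c - frm s c * k (simple s) in
    if 0 < dot s c then 2 * k' (refl s c) - k' c
    else if dot s c == 0 then k' c else k' (refl s c).
  by move=> rc /negPf nc; rewrite /psiV nc; case: asboolP.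
have [a|a|a] := ltgtP (dot s b) 0.
- rewrite Pop_lt // !Vb // dot_refl1 // reflK // ltNge (ltW a) (lt_eqF a) oppr_gt0 a /=.
  by field.
- by rewrite Pop_gt // Vb // dot_refl1 // reflK // oppr_gt0 oppr_eq0 ltNge (ltW a) (gt_eqF a) /=; field.
- by rewrite Pop_eq // Vb // a /=; field.
Qed.

Lemma psi0 s : psi 0 s = Pop s.
Proof. by apply: funext => h; apply: funext => b; rewrite /psi !mul0r addr0. Qed.

End Operators.

(** * Words acting on functions, and the passage to the degenerate parameter *)

Section WordAction.
Local Open Scope ring_scope.

Section PolyFun.
Definition polyfun (F : rat -> rat) := exists p : {poly rat}, forall x, F x = p.[x].

Lemma polyfun_cst c : polyfun (fun=> c).
Proof. by exists c%:P => x; rewrite hornerC. Qed.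
Lemma polyfun_id : polyfun id.
Proof. by exists 'X => x; rewrite hornerX. Qed.
Lemma polyfunD F G : polyfun F -> polyfun G -> polyfun (fun x => F x + G x).
Proof. by move=> [p pE] [q qE]; exists (p + q) => x; rewrite hornerD pE qE. Qed.
Lemma polyfunM F G : polyfun F -> polyfun G -> polyfun (fun x => F x * G x).
Proof. by move=> [p pE] [q qE]; exists (p * q) => x; rewrite hornerM pE qE. Qed.

Lemma polyfun_eq0 F G : polyfun F -> polyfun G -> (forall x, x != 0 -> F x = G x) -> F 0 = G 0.
Proof.
move=> [p pE] [q qE] e; apply/eqP; rewrite pE qE -subr_eq0 -hornerN -hornerD.
suff -> : p - q = 0 by rewrite horner0.
apply/eqP; apply: contraT => nz.
(* A nonzero difference would vanish at 1, 2, ..., as many points as its size, which exceeds its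
   degree by one. *)
pose rs : seq rat := [seq n.+1%:R | n <- iota 0 (size (p - q))].
have /max_poly_roots : p - q != 0 by [].
move=> /(_ rs); rewrite size_map size_iota ltnn; apply.
  apply/allP => _ /mapP [n _ ->]; rewrite /root hornerD hornerN -pE -qE subr_eq0.
  by rewrite e // pnatr_eq0.
rewrite map_inj_uniq ?iota_uniq // => i j /eqP; rewrite eqr_nat eqSS.
by move/eqP.
Qed.
End PolyFun.

Opaque refl dot simple.
Section Action.
Variables (V : finType) (adj : rel V).
Hypothesis adjC : symmetric adj.
Hypothesis adjxx : irreflexive adj.
Hypothesis adj_tri : forall u v w, adj u v -> adj v w -> adj u w -> False.
Notation vec := {ffun V -> int}.

Definition graph_entry (u v : V) : option nat :=
  Some (if u == v then 1 else if adj u v then 3 else 2)%N.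
Lemma graph_entry_sym u v : graph_entry u v = graph_entry v u.
Proof. by rewrite /graph_entry eq_sym adjC. Qed.
Lemma graph_entry_diag u : graph_entry u u = Some 1%N.
Proof. by rewrite /graph_entry eqxx. Qed.
Lemma graph_entry_off u v k : u != v -> graph_entry u v = Some k -> (2 <= k)%N.
Proof. by rewrite /graph_entry => /negPf -> [<-]; case: ifP. Qed.
Definition graph_matrix : coxeter_matrix V :=
  CoxeterMatrix graph_entry_sym graph_entry_diag graph_entry_off.

Local Notation gcong := (pres_cong (braid_rel graph_matrix)).

Section Psi.
Variable phi : V -> vec -> int.
Hypothesis phiP : is_form adj phi.

Definition letter_act (x : rat) (l : V * bool) (h : vec -> rat) :=
  if l.2 then psiV adj phi x l.1 h else psi adj phi x l.1 h.
Definition act x (w : word V) h := foldl (fun h l => letter_act x l h) h w.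

Lemma act_cat x u v h : act x (u ++ v) h = act x v (act x u h).
Proof. exact: foldl_cat. Qed.

Lemma act_cong x u v : x != 0 -> gcong u v -> forall h, act x u h = act x v h.
Proof.
move=> x0; elim=> {u v}.
- move=> _ _ [s t k nst e]; have {e} : graph_entry s t = Some k := e; rewrite /graph_entry (negPf nst); case: ifP => ast [<-] h /=.
    by rewrite /act /= /letter_act /= psi_braid // adjC.
  by rewrite /act /= /letter_act /= psi_comm // 1?eq_sym // adjC ast.
- by move=> s [] h; rewrite /act /= /letter_act /= ?psiK ?psiVK.
- by [].
- by move=> u v _ IH h; rewrite IH.
- by move=> u v w _ IH1 _ IH2 h; rewrite IH1.
- by move=> u u' v v' _ IH1 _ IH2 h; rewrite !act_cat IH1 IH2.
Qed.

Lemma act_polyfun (w : seq V) (h : rat -> vec -> rat) :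
  (forall b, polyfun (h^~ b)) -> forall b, polyfun (fun x => act x (positive_word w) (h x) b).
Proof.
elim: w h => [|v w IH] h hP b //=; apply: (IH (fun x => psi adj phi x v (h x))) => {}b.
apply: polyfunD; last first.
  apply: polyfunM; last exact: polyfun_cst.
  by apply: polyfunM => //; exact: polyfun_id.
rewrite /Pop; case: `[< posroot adj b >] => //; case: (b == simple v); first exact: polyfun_cst.
case: (0 < dot adj v b) => //; case: (dot adj v b == 0) => //.
by apply: polyfunM; [exact: polyfunD | exact: polyfun_cst].
Qed.
End Psi.

(** The first letter acts first, so a root is followed through a word from left to right;
    [refl_word] reads words in the opposite direction. *)
Definition pact (w : seq V) (h : vec -> rat) := foldl (fun h v => Pop adj v h) h w.

Lemma pact_cat u v h : pact (u ++ v) h = pact v (pact u h).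
Proof. exact: foldl_cat. Qed.

Lemma act0 phi w h : act phi 0 (positive_word w) h = pact w h.
Proof. by elim: w h => //= v w IH h; rewrite /letter_act /= psi0. Qed.

(* For x <> 0 the operators psi x s are invertible and give a group action; on positive words its
   values are polynomials in x, so the equality persists at x = 0, where psi x s is P_s. *)
Lemma pact_cong u v h : gcong (positive_word u) (positive_word v) -> pact u h = pact v h.
Proof.
move=> uv; have [phi phiP] := exists_form adjC adjxx adj_tri.
apply: funext => b; rewrite -!(act0 phi).
apply: (polyfun_eq0 (F := fun x => act phi x (positive_word u) h b)
                    (G := fun x => act phi x (positive_word v) h b)).
- by apply: (@act_polyfun phi u (fun=> h)) => c; exact: polyfun_cst.
- by apply: (@act_polyfun phi v (fun=> h)) => c; exact: polyfun_cst.
by move=> x x0; rewrite (act_cong phiP x0 uv).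
Qed.

Definition refl_word (w : seq V) (b : vec) := foldr (refl adj) b w.

Lemma refl_word_cat u v b : refl_word (u ++ v) b = refl_word u (refl_word v b).
Proof. exact: foldr_cat. Qed.

Lemma refl_word_cong u v b : gcong (positive_word u) (positive_word v) ->
  refl_word u b = refl_word v b.
Proof.
have E (w : seq V) c : refl_word w c = foldr (fun l => refl adj l.1) c (positive_word w).
  by elim: w => //= s w ->.
rewrite !E; move: (positive_word u) (positive_word v) => {u v}.
move=> u v; suff H : gcong u v -> forall b, foldr (fun l => refl adj l.1) b u =
    foldr (fun l => refl adj l.1) b v by move/H.
elim=> {u v} //.
- move=> _ _ [s t k nst e]; have {e} : graph_entry s t = Some k := e; rewrite /graph_entry (negPf nst); case: ifP => ast [<-] c /=.
    exact: refl_braid.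
  by apply: refl_comm => //; rewrite ast.
- by move=> s e c /=; rewrite reflK.
- by move=> u v w _ IH1 _ IH2 c; rewrite IH1.
- by move=> u u' v v' _ IH1 _ IH2 c; rewrite !foldr_cat IH1 IH2.
Qed.
End Action.
End WordAction.

(** * The braid relation of type A *)

Section PathBraids.
Local Open Scope group_scope.

Section CommutingProducts.
Variables (G : groupType).
Implicit Types (I : eqType) (x y : G).

Lemma commute_prod (I : eqType) (s : seq I) (F : I -> G) y :
  (forall i, i \in s -> commute y (F i)) -> commute y (\prod_(i <- s) F i).
Proof.
elim: s => [|i s IH] h; first by rewrite big_nil; exact: commute1.
rewrite big_cons; apply: commuteM; first by apply: h; exact: mem_head.
by apply: IH => j js; apply: h; rewrite inE js orbT.
Qed.

Lemma prod_commute (I J : eqType) (s : seq I) (t : seq J) (F : I -> G) (E : J -> G) :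
  (forall i j, i \in s -> j \in t -> commute (F i) (E j)) ->
  commute (\prod_(i <- s) F i) (\prod_(j <- t) E j).
Proof.
move=> h; apply: commute_prod => j jt; apply: commute_sym; apply: commute_prod => i iS.
by apply: commute_sym; exact: h.
Qed.

Lemma prod_split (I : eqType) (s : seq I) (F E : I -> G) :
  uniq s -> {in s &, forall i j, i != j -> commute (F i) (E j)} ->
  \prod_(i <- s) (F i * E i) = (\prod_(i <- s) F i) * \prod_(i <- s) E i.
Proof.
elim: s => [|i s IH] /=; first by rewrite !big_nil mulg1.
move=> /andP[is_ us] h; rewrite !big_cons IH //; last first.
  by move=> j k js ks; apply: h; rewrite inE ?js ?ks orbT.
rewrite !mulgA; congr (_ * _); rewrite -!mulgA; congr (_ * _).
apply/esym; apply: commute_sym; apply: commute_prod => j js; apply: commute_sym.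
apply: h; rewrite ?inE ?eqxx ?js ?orbT //.
by apply: contraNneq is_ => <-.
Qed.

Lemma prod_perm (I : eqType) (s t : seq I) (F : I -> G) : perm_eq s t ->
  {in s &, forall i j, commute (F i) (F j)} -> \prod_(i <- s) F i = \prod_(i <- t) F i.
Proof.
elim: s t => [|i s IH] t st h.
  by have /eqP := perm_size st; rewrite eq_sym size_eq0 => /eqP ->.
have it : i \in t by rewrite -(perm_mem st) mem_head.
case/splitPr: it st => t1 t2 st.
have st' : perm_eq s (t1 ++ t2).
  by rewrite -(perm_cons i) (perm_trans st) // perm_catC /= perm_cons perm_catC.
rewrite big_cons (IH _ st'); last first.
  by move=> j k js ks; apply: h; rewrite inE ?js ?ks orbT.
rewrite !big_cat /= big_cons !mulgA; congr (_ * _).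
apply: commute_prod => j jt; apply: h; rewrite ?mem_head //.
by rewrite (perm_mem st) mem_cat jt.
Qed.
End CommutingProducts.

Section PathBraid.
Variables (G : groupType) (x : nat -> G).

Let P (s : seq nat) : G := \prod_(i <- s) x i.
Let Pcat s t : P (s ++ t) = P s * P t.
Proof. exact: big_cat. Qed.

(** The generators of one parity along a path of type A, which commute with each other. [rows]
    alternates the parities, as in a brick-wall braid diagram. *)
Definition row n (c : bool) : G := \prod_(i <- iota 0 n | odd i == c) x i.
Definition rows n c k : G := \prod_(j <- iota 0 k) row n (c (+) odd j).

Let rowE n c : row n c = P [seq i <- iota 0 n | odd i == c].
Proof. by rewrite /P big_filter. Qed.

Lemma rowsS n c k : rows n c k.+1 = rows n c k * row n (c (+) odd k).
Proof. by rewrite /rows -addn1 iotaD big_cat /= big_seq1. Qed.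

Lemma rowsSl n c k : rows n c k.+1 = row n c * rows n (~~ c) k.
Proof.
rewrite /rows /= big_cons addbF -add1n iotaDl big_map; congr (_ * _).
by apply: eq_bigr => j _; rewrite /= addNb addbN.
Qed.

Definition braided n := (forall i j, i < n -> j < n -> i.+1 < j -> commute (x i) (x j)) /\
  (forall i, i.+1 < n -> x i * x i.+1 * x i = x i.+1 * x i * x i.+1).

Let desc n d := P (rev (iota d (n.+1 - d))).

Let Pcomm n s t : braided n -> (forall i j, i \in s -> j \in t -> i.+1 < j < n) ->
  P s * P t = P t * P s.
Proof.
move=> [cm _] h; apply: prod_commute => i j iS jt.
by have /andP[h1 h2] := h i j iS jt; apply: cm => //; lia.
Qed.

Let desc_shift n d i : braided n.+1 -> d <= i -> i < n -> desc n d * x i.+1 = x i * desc n d.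
Proof.
move=> br di iN; have [cm bd] := br.
have E : iota d (n.+1 - d) = iota d (i - d) ++ [:: i; i.+1] ++ iota i.+2 (n.+1 - i.+2).
  have -> : n.+1 - d = (i - d) + (2 + (n.+1 - i.+2)) by lia.
  by rewrite iotaD; congr (_ ++ _); rewrite iotaD /= subnKC // addn2.
have D : desc n d = P (rev (iota i.+2 (n.+1 - i.+2))) * (x i.+1 * x i) * P (rev (iota d (i - d))).
  by rewrite /desc E !rev_cat !Pcat /= {2}/P !big_cons big_nil mulg1.
rewrite D.
have c1 : P (rev (iota d (i - d))) * x i.+1 = x i.+1 * P (rev (iota d (i - d))).
  have -> : x i.+1 = P [:: i.+1] by rewrite /P big_seq1.
  apply: (Pcomm br) => j k; rewrite mem_rev mem_iota inE => ? /eqP ->; lia.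
have c2 : x i * P (rev (iota i.+2 (n.+1 - i.+2))) = P (rev (iota i.+2 (n.+1 - i.+2))) * x i.
  have -> : x i = P [:: i] by rewrite /P big_seq1.
  apply: (Pcomm br) => j k; rewrite mem_rev mem_iota inE => /eqP ->; lia.
rewrite -!mulgA c1 !mulgA c2 -!mulgA; congr (_ * _).
by rewrite !mulgA bd //; lia.
Qed.

Let desc_shifts n d s : braided n.+1 -> (forall i, i \in s -> d <= i < n) ->
  desc n d * P (map S s) = P s * desc n d.
Proof.
move=> br; elim: s => [|i s IH] h; first by rewrite /P !big_nil mulg1 mul1g.
have /andP[h1 h2] := h i (mem_head _ _).
rewrite /P /= !big_cons mulgA (desc_shift br h1 h2) -!mulgA; congr (_ * _).
by apply: IH => j js; apply: h; rewrite inE js orbT.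
Qed.

Let split_row n c d : d <= n -> row n c = row d c * P [seq i <- iota d (n - d) | odd i == c].
Proof. by move=> dn; rewrite !rowE -Pcat -filter_cat -{1}(subnKC dn) iotaD. Qed.

Let shift_seq d n c : [seq i <- iota d.+1 n | odd i == ~~ c] = map S [seq i <- iota d n | odd i == c].
Proof.
rewrite -add1n iotaDl filter_map; congr map.
by apply: eq_filter => i /=; case: odd; case: c.
Qed.

(* The strand entering at the top index moves down one step in each row; pulling its crossings to
   the right turns [rows n.+1] into [rows n]. *)
Let rows_top n k : braided n.+1 -> k <= n ->
  rows n.+1 (odd n) k.+1 =
  rows n (odd n) k * row (n - k) (odd n (+) odd k) * desc n (n - k).
Proof.
move=> br; elim: k => [|k IH] kn.
  rewrite rowsS /rows !big_nil !mul1g addbF subn0 (split_row _ (leqnSn n)).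
  by rewrite subSnn /= eqxx /desc subSnn.
rewrite rowsS IH ?(ltnW kn) // -/(odd k.+1).
set d := n - k.+1; have dE : n - k = d.+1 by rewrite /d; lia.
have dn : d <= n.+1 by rewrite /d; lia.
have par : odd n (+) odd k.+1 = odd d by rewrite /d oddB.
have par' : odd n (+) odd k = ~~ odd d by rewrite -par /= addbN negbK.
rewrite dE par' par (split_row _ dn).
have -> : n.+1 - d = (n - d).+1 by rewrite /d; clear -kn; lia.
have sh := shift_seq d (n - d) (~~ odd d); rewrite negbK in sh.
rewrite /= eqxx sh.
set U := [seq i <- iota d (n - d) | _].
have Uin i : i \in U -> d < i < n.
  rewrite mem_filter mem_iota => /andP[h1 h2]; case: (ltngtP d i) => // h3; [clear -h2 h3; lia | clear -h2 h3; lia |].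
  by move: h1; rewrite h3; case: odd.
rewrite [P (d :: _)]/P big_cons -/(P _).
have c1 : desc n d.+1 * row d (odd d) = row d (odd d) * desc n d.+1.
  apply/esym; rewrite rowE; apply: (Pcomm br) => i j; rewrite mem_filter mem_iota mem_rev mem_iota.
  move=> /andP[/eqP h1 h2] h3.
  have h4 : i.+1 != d by apply/eqP => h4; move: h1; rewrite -h4 /=; case: odd.
  by clear -h2 h3 h4; lia.
have c2 : desc n d.+1 * x d = desc n d.
  rewrite /desc; have -> : n.+1 - d = (n.+1 - d.+1).+1 by rewrite /d; clear -kn; lia.
  by rewrite /= rev_cons -cats1 Pcat [P [:: d]]/P big_seq1.
have c3 : desc n d * P (map S U) = P U * desc n d.
  by apply: (desc_shifts br) => i /Uin; lia.
have c4 : row d (odd d) * P U = P U * row d (odd d).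
  rewrite rowE; apply: (Pcomm br) => i j; rewrite mem_filter mem_iota => /andP[_ h1] /Uin; clear -h1; lia.
have c5 : row n (~~ odd d) = row d.+1 (~~ odd d) * P U.
  have dn' : d.+1 <= n by rewrite /d; clear -kn; lia.
  rewrite (split_row _ dn'); congr (_ * P _); rewrite /U.
  have -> : n - d = (n - d.+1).+1 by clear -dn'; lia.
  by rewrite /=; case: odd.
rewrite rowsS par' c5 -!mulgA; congr (_ * (_ * _)).
by rewrite !mulgA c1 -c4 -!mulgA; congr (_ * _); rewrite !mulgA c2 c3.
Qed.

Let rows_desc n c : braided n.+1 -> rows n.+1 c n.+2 = rows n c n.+1 * desc n 0.
Proof.
move=> br; have top : rows n.+1 (odd n) n.+1 = rows n (odd n) n * desc n 0.
  by rewrite rows_top // subnn /row /= big_nil mulg1.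
have [->|nc] := eqVneq c (odd n).
  rewrite rowsS top rowsS /= addbN addbb /= -!mulgA; congr (_ * _).
  have -> : row n.+1 true = P (map S [seq i <- iota 0 n | odd i == false]).
    by rewrite -shift_seq rowE /= .
  by rewrite rowE; apply: (desc_shifts br) => i; rewrite mem_filter mem_iota => /andP[_]; lia.
have cE : ~~ c = odd n by move: nc; case: c; case: odd.
rewrite rowsSl cE top rowsSl cE !mulgA; congr (_ * _ * _).
rewrite (split_row _ (leqnSn n)) subSnn /= eq_sym (negPf nc).
by rewrite /P big_nil mulg1.
Qed.

(** The number n + 1 of rows is the Coxeter number of A_n, and both sides are the half twist. By
    [rows_desc] the same factor [desc n 0] splits off on the right for either starting parity, which
    gives the induction. *)
Lemma rows_braid n c : braided n -> rows n c n.+1 = rows n (~~ c) n.+1.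
Proof.
elim: n c => [|n IH] c br; first by rewrite /rows /= !big_seq1 /row /= !big_nil.
rewrite (rows_desc c br) (rows_desc (~~ c) br) IH //; case: br => cm bd.
split=> [i j iN jN|i iN]; [apply: cm; lia | apply: bd; lia].
Qed.
End PathBraid.
End PathBraids.

(** * Words in an Artin group *)

Section Words.
Local Open Scope group_scope.

Section Presented.
Variables (T : choiceType) (R : word T -> word T -> Prop) (H : groupType) (f : T -> H).

Definition word_eval (w : word T) : H := \prod_(l <- w) (if l.2 then (f l.1)^-1 else f l.1).

Lemma word_eval_cat u v : word_eval (u ++ v) = word_eval u * word_eval v.
Proof. exact: big_cat. Qed.

Lemma word_eval_positive w : word_eval (positive_word w) = \prod_(x <- w) f x.
Proof. by rewrite /word_eval big_map. Qed.

Lemma word_eval_cong u v : (forall u v, R u v -> word_eval u = word_eval v) ->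
  pres_cong R u v -> word_eval u = word_eval v.
Proof.
move=> hR; elim=> {u v} //.
- by move=> x [] /=; rewrite /word_eval !big_cons !big_nil !mulg1 /= ?mulgV ?mulVg.
- by move=> u v w _ -> _ ->.
- by move=> u u' v v' _ IH1 _ IH2; rewrite !word_eval_cat IH1 IH2.
Qed.
End Presented.

Section ArtinWords.
Variables (S : finType) (m : coxeter_matrix S).
Notation G := (artin_group m).
Implicit Types (u v w : seq S) (g h : G).

Definition ev w : G := \prod_(s <- w) artin_gen m s.

Lemma ev_nil : ev [::] = 1. Proof. exact: big_nil. Qed.
Lemma ev_cons s w : ev (s :: w) = artin_gen m s * ev w. Proof. exact: big_cons. Qed.
Lemma ev_cat u v : ev (u ++ v) = ev u * ev v. Proof. exact: big_cat. Qed.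
Lemma ev1 s : ev [:: s] = artin_gen m s. Proof. exact: big_seq1. Qed.
Lemma ev_rcons w s : ev (rcons w s) = ev w * artin_gen m s.
Proof. by rewrite -cats1 ev_cat ev1. Qed.

Lemma evE w : ev w = pres_class (braid_rel m) (positive_word w).
Proof.
elim: w => [|s w IH]; first by rewrite ev_nil.
by rewrite ev_cons IH [LHS]pres_mulE.
Qed.

Lemma ev_eq u v : ev u = ev v <-> pres_cong (braid_rel m) (positive_word u) (positive_word v).
Proof. by rewrite !evE; exact: pres_classP. Qed.

Lemma ev_alt s t k : s != t -> m s t = Some k -> ev (alternating s t k) = ev (alternating t s k).
Proof. by move=> st e; apply/ev_eq/pres_rel/BraidRel. Qed.

Lemma alternatingE (T : Type) (s t : T) k :
  alternating s t k = [seq (if odd i then t else s) | i <- iota 0 k].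
Proof.
elim: k s t => //= k IH s t; rewrite IH -(addn0 1%N) iotaDl -map_comp; congr (_ :: _).
by apply: eq_map => i /=; case: odd.
Qed.

Lemma alternating_rcons (T : Type) (s t : T) k :
  alternating s t k.+1 = rcons (alternating s t k) (if odd k then t else s).
Proof. by rewrite !alternatingE -addn1 iotaD map_cat cats1. Qed.

Lemma size_alternating (T : Type) (s t : T) k : size (alternating s t k) = k.
Proof. by rewrite alternatingE size_map size_iota. Qed.

Lemma alternating_take (T : Type) (s t : T) l j : l <= j -> alternating s t j = alternating s t l ++ drop l (alternating s t j).
Proof.
move=> lj; rewrite -[LHS](cat_take_drop l); congr (_ ++ _).
by rewrite !alternatingE -map_take take_iota (minn_idPl lj).
Qed.

Lemma mem_pair2 (T : eqType) (s t : T) : t \in [:: s; t].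
Proof. by rewrite !inE eqxx orbT. Qed.

Lemma rev_alternating (T : Type) (s t : T) (k : nat) :
  rev (alternating s t k) = if odd k then alternating s t k else alternating t s k.
Proof.
elim: k => // k IH; rewrite [in LHS]alternating_rcons rev_rcons IH /=.
by case: (odd k).
Qed.

Lemma ev_rev_alt s t k : s != t -> m s t = Some k -> ev (rev (alternating s t k)) = ev (alternating s t k).
Proof. by move=> st e; rewrite rev_alternating; case: ifP => // _; rewrite (ev_alt st e). Qed.

(** The exponent sum is constant under braid relations and cancellation, so positive words that are
    equal in the group have the same length. *)
Definition word_deg (w : word S) : int := (\sum_(l <- w) (if l.2 then -1 else 1))%R.

Lemma word_deg_cong (u v : word S) : pres_cong (braid_rel m) u v -> word_deg u = word_deg v.
Proof.
have cat a b : word_deg (a ++ b) = (word_deg a + word_deg b)%R by exact: big_cat.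
have pos w : word_deg (positive_word w) = Posz (size w).
  by elim: w => [|s w IH]; rewrite /word_deg ?big_nil // big_cons -/(word_deg _) IH /=; lia.
elim=> {u v} //.
- by move=> _ _ [s t k _ _]; rewrite !pos !size_alternating.
- by move=> x [] /=; rewrite /word_deg !big_cons !big_nil.
- by move=> u v w _ -> _ ->.
- by move=> u u' v v' _ IH1 _ IH2; rewrite !cat IH1 IH2.
Qed.

Lemma ev_size u v : ev u = ev v -> size u = size v.
Proof.
have pos w : word_deg (positive_word w) = Posz (size w).
  by elim: w => [|s w IH]; rewrite /word_deg ?big_nil // big_cons -/(word_deg _) IH /=; lia.
by move/ev_eq/word_deg_cong; rewrite !pos => -[].
Qed.

Lemma artin_monoidP (X : {set S}) g :
  artin_monoid m X g <-> exists2 w, {subset w <= X} & g = ev w.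
Proof.
split=> [|[w wX ->] M [[M1 MM] MX]].
  move=> /(_ [set a : G | exists2 w, {subset w <= X} & a = ev w]%classic) h; apply: h; split.
    split; first by exists [::]; rewrite ?ev_nil.
    move=> a b [u uX ->] [v vX ->]; exists (u ++ v); rewrite ?ev_cat //.
    by move=> x; rewrite mem_cat => /orP[/uX|/vX].
  move=> _ [x xX <-]; exists [:: x]; rewrite ?ev1 // => y; rewrite inE => /eqP ->.
  exact: xX.
elim: w wX => [|s w IH] wX; first by rewrite ev_nil.
rewrite ev_cons; apply: MM; first by apply: MX; exists s => //; apply: wX; exact: mem_head.
by apply: IH => x xw; apply: wX; rewrite inE xw orbT.
Qed.

Lemma pres_cong_rev (u v : word S) : pres_cong (braid_rel m) u v -> pres_cong (braid_rel m) (rev u) (rev v).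
Proof.
have mr (a : seq S) : rev (positive_word a) = positive_word (rev a) by rewrite /positive_word map_rev.
elim=> {u v}.
- move=> _ _ [s t k st e]; rewrite !mr !rev_alternating; case: ifP => _; first exact/pres_rel/BraidRel.
  exact/pres_sym/pres_rel/BraidRel.
- by move=> x b; rewrite -{1}(negbK b); exact: pres_cancel.
- by move=> u; exact: pres_refl.
- by move=> u v _; exact: pres_sym.
- by move=> u v w _ h1 _; exact: pres_trans.
- by move=> u u' v v' _ h1 _ h2; rewrite !rev_cat; exact: pres_cat.
Qed.

Lemma ev_rev u v : ev u = ev v -> ev (rev u) = ev (rev v).
Proof. by move/ev_eq/pres_cong_rev => h; apply/ev_eq; rewrite /positive_word !map_rev. Qed.

End ArtinWords.
End Words.

(** * Roots that survive a positive word *)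

Section Positivity.
Local Open Scope ring_scope.
Opaque refl dot simple.
Variables (V : finType) (adj : rel V).
Hypothesis adjC : symmetric adj.
Hypothesis adjxx : irreflexive adj.
Hypothesis adj_tri : forall u v w, adj u v -> adj v w -> adj u w -> False.
Notation vec := {ffun V -> int}.
Local Notation dot := (dot adj).
Local Notation refl := (refl adj).
Local Notation posroot := (posroot adj).
Local Notation Pop := (Pop adj).
Local Notation pact := (pact adj).
Local Notation gcong := (pres_cong (braid_rel (graph_matrix adjC))).

Definition nonneg (h : vec -> rat) := forall b, 0 <= h b.

Lemma Pop_mono s h k : (forall b, h b <= k b) -> forall b, Pop s h b <= Pop s k b.
Proof.
move=> hk b; rewrite /Pop; case: asboolP => // _.
case: ifP => // _; case: ifP => // _; case: ifP => // _.
by have := hk b; have := hk (refl s b); lra.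
Qed.

Lemma Pop0 s : Pop s (fun=> 0) = fun=> 0.
Proof.
apply: funext => b; rewrite /Pop; case: asboolP => // _.
by case: ifP => // _; case: ifP => // _; case: ifP => // _; lra.
Qed.

Lemma Pop_ge0 s h : nonneg h -> nonneg (Pop s h).
Proof. by move=> h0 b; have := Pop_mono s h0 b; rewrite Pop0. Qed.

Lemma Pop_scale s c h : Pop s (fun b => c * h b) = fun b => c * Pop s h b.
Proof.
have -> : (fun b => c * h b) = (fun b => 0 + c * h b) by apply: funext => b; rewrite add0r.
by rewrite (@Pop_lin _ _ s (fun=> 0)) Pop0; apply: funext => b; rewrite add0r.
Qed.

Lemma pact_mono w h k : (forall b, h b <= k b) -> forall b, pact w h b <= pact w k b.
Proof. by elim: w h k => //= s w IH h k hk; apply: IH; exact: Pop_mono. Qed.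
Lemma pact0 w : pact w (fun=> 0) = fun=> 0.
Proof. by elim: w => //= s w IH; rewrite Pop0. Qed.
Lemma pact_scale w c h : pact w (fun b => c * h b) = fun b => c * pact w h b.
Proof. by elim: w h => //= s w IH h; rewrite Pop_scale IH. Qed.
Lemma pact_ge0 w h : nonneg h -> nonneg (pact w h).
Proof. by elim: w h => //= s w IH h h0; apply: IH; exact: Pop_ge0. Qed.

(* [hits w b c]: the coefficient of e_b in the image of e_c under P_w is positive. *)
Definition hits (w : seq V) (b c : vec) := forall h, nonneg h -> 0 < h b -> 0 < pact w h c.
Definition live (w : seq V) (b : vec) := exists c, hits w b c.

Lemma hits_nil b : hits [::] b b. Proof. by []. Qed.
Lemma hits_cat u v b c d : hits u b c -> hits v c d -> hits (u ++ v) b d.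
Proof. by move=> bc cd h h0 hb; rewrite pact_cat; apply: cd; [exact: pact_ge0 | exact: bc]. Qed.
Lemma live_cat u v b c : hits u b c -> live v c -> live (u ++ v) b.
Proof. by move=> bc [d cd]; exists d; exact: hits_cat cd. Qed.
Lemma live_nil b : live [::] b. Proof. by exists b. Qed.

(** A nonnegative h dominates [h b] times the delta function at b, and the operators are monotone
    and linear. *)
Lemma hits_delta w b c : 0 < pact w (fun a => (a == b)%:R) c -> hits w b c.
Proof.
move=> w0 h h0 hb; apply: (@lt_le_trans _ _ (h b * pact w (fun a => (a == b)%:R) c)).
  by rewrite mulr_gt0.
have := @pact_mono w (fun a => h b * (a == b)%:R) h _ c.
rewrite pact_scale; apply=> a; case: eqP => [->|_]; first by rewrite mulr1.
by rewrite mulr0.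
Qed.

(** If u carried b nowhere, its operator would send the delta function at b to 0, and so would that
    of [u ++ v]. *)
Lemma live_catl u v b : live (u ++ v) b -> live u b.
Proof.
move=> [c bc]; apply: contrapT => nl.
have := bc (fun a => (a == b)%:R) (fun a => ler0n _ _); rewrite eqxx ltr01 => /(_ isT).
rewrite pact_cat; have -> : pact u (fun a => (a == b)%:R) = fun=> 0.
  apply: funext => d; apply/eqP; rewrite eq_le pact_ge0 ?andbT; last by move=> a; exact: ler0n.
  by rewrite leNgt; apply/negP => lt; apply: nl; exists d; exact: hits_delta.
by rewrite pact0 ltxx.
Qed.

Lemma live_cong u v b : gcong (positive_word u) (positive_word v) -> live u b -> live v b.
Proof.
by move=> uv [c bc]; exists c => h h0 hb; rewrite -(pact_cong adjxx adj_tri h uv); exact: bc.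
Qed.

Lemma posroot_neq_opp s b : posroot b -> refl s b != simple s.
Proof. exact: posroot_refl_neq. Qed.

Lemma not_live_simple s w : ~ live (s :: w) (simple s).
Proof.
move=> [c]; move=> /(_ (fun a => (a == simple s)%:R) (fun a => ler0n _ _)).
rewrite eqxx ltr01 /= => /(_ isT); have -> : Pop s (fun a => (a == simple s)%:R) = fun=> 0.
  apply: funext => b; rewrite /Pop; case: asboolP => [rb|nb]; last first.
    by case: eqP => // e; case: nb; rewrite e; exact: posroot_simple.
  case: (altP (b =P simple s)) => // /negPf nb; rewrite (negPf (posroot_neq_opp s rb)).
  by case: ifP => // _; case: ifP => // _; lra.
by rewrite pact0 ltxx.
Qed.

Definition orthogonal (L : seq V) := {in L &, forall u v, ~~ adj u v}.

Lemma orthogonal_cons v L : orthogonal (v :: L) -> orthogonal L.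
Proof. by move=> o x y xL yL; apply: o; rewrite inE ?xL ?yL orbT. Qed.

Lemma refl_word_orthogonal L b : uniq L -> orthogonal L ->
  refl_word adj L b = [ffun u => if u \in L then b u - dot u b else b u].
Proof.
elim: L => [|v L IH] /=; first by move=> _ _; apply/ffunP => u; rewrite ffunE.
move=> /andP[vL uL] oL.
have dv : dot v (refl_word adj L b) = dot v b.
  have : v \notin L by []. have : {in L, forall u, ~~ adj v u}.
    by move=> u uLL; apply: oL; rewrite inE ?eqxx ?uLL ?orbT.
  elim: (L) => //= u L' IH' h; rewrite inE negb_or => /andP[vu vL'].
  rewrite dot_reflN //; first by apply: IH' => // w w'; apply: h; rewrite inE w' orbT.
  by apply: h; rewrite inE eqxx.
apply/ffunP => u; rewrite reflE dv IH //; last exact: orthogonal_cons oL.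
rewrite !ffunE inE; case: (altP (u =P v)) => [->|_] /=; first by rewrite (negPf vL).
by rewrite subr0.
Qed.

Lemma hits_refl v b : posroot b -> b != simple v -> hits [:: v] b (refl v b).
Proof.
move=> rb nb h h0 hb; rewrite /=; have rr := posroot_refl adjC adjxx rb nb.
have nn := posroot_neq_opp v rb.
have [lt|lt|e] := ltgtP (dot v b) 0.
- by rewrite Pop_gt ?reflK // dot_refl1 // oppr_gt0.
- rewrite Pop_lt ?reflK //; last by rewrite dot_refl1 // oppr_lt0.
  by have := h0 (refl v b); lra.
- by rewrite refl_fix // Pop_eq.
Qed.

Lemma hits_stay v b : posroot b -> dot v b <= 0 -> hits [:: v] b b.
Proof.
move=> rb; rewrite le_eqVlt => /orP[/eqP e|lt] h h0 hb /=; first by rewrite Pop_eq.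
by rewrite Pop_lt //; have := h0 (refl v b); lra.
Qed.

Lemma hits_orthogonal L b (c : vec) : uniq L -> orthogonal L -> posroot b ->
  {in L, forall v, b != simple v} -> (forall v, v \notin L -> c v = b v) ->
  {in L, forall v, c v = b v - dot v b \/ c v = b v /\ dot v b <= 0} ->
  hits L b c /\ posroot c.
Proof.
elim: L b => [|v L IH] b /=.
  by move=> _ _ rb _ e _; have -> : c = b by [apply/ffunP => v; exact: e]; split.
move=> /andP[vL uL] oL rb ns e d.
have dist u : u \in L -> v != u by move=> uLL; apply: contraNneq vL => ->.
have nad u : u \in L -> ~~ adj v u by move=> uLL; apply: oL; rewrite inE ?eqxx ?uLL ?orbT.
have nv := ns v (mem_head _ _).
have step b' : posroot b' -> {in L, forall u, b' != simple u} -> hits [:: v] b b' -> c v = b' v ->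
    (forall u, u != v -> b' u = b u) -> {in L, forall u, dot u b' = dot u b} ->
    hits (v :: L) b c /\ posroot c.
  move=> rb' ns' h1 cv e' d'.
  have [] := IH b' uL (orthogonal_cons oL) rb' ns'.
  - move=> u uL'; have [->//|uv] := eqVneq u v; rewrite e' // e // inE negb_or uv //.
  - move=> u uLL; have uv : u != v by rewrite eq_sym dist.
    by rewrite d' // e' //; apply: d; rewrite inE uLL orbT.
  by move=> h2 rc; split => //; exact: (hits_cat h1 h2).
have reflvE u : refl v b u = if u == v then b v - dot v b else b u.
  rewrite -[refl v b]/(refl_word adj [:: v] b) refl_word_orthogonal //; last first.
    by move=> x y; rewrite !inE => /eqP-> /eqP->; rewrite adjxx.
  by rewrite ffunE inE; case: eqP => // ->.
case: (d v (mem_head _ _)) => [cv|[cv le]].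
- apply: (step (refl v b)).
  + exact: posroot_refl.
  + move=> u uLL; apply/eqP => eu; have := ns u; rewrite inE uLL orbT => /(_ isT) /eqP; apply.
    rewrite -(reflK adjxx v b) eu refl_fix // dot_simple //.
    by rewrite (negPf (dist u uLL)) (negPf (nad u uLL)).
  + exact: hits_refl.
  + by rewrite reflvE eqxx.
  + by move=> u /negPf uv; rewrite reflvE uv.
  + move=> u uLL; rewrite dot_reflN //; first by rewrite eq_sym dist.
    by rewrite adjC nad.
- apply: (step b) => //; last exact: hits_stay.
  by move=> u uLL; apply: ns; rewrite inE uLL orbT.
Qed.

End Positivity.

(** * Interval roots along a path of type A *)

Section Intervals.
Local Open Scope ring_scope.

Lemma odd_eqP a b : (odd a == odd b) = true -> a.+1 <> b /\ b.+1 <> a.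
Proof. by move=> /eqP h; split=> h2; move: h; rewrite -h2 /=; case: odd. Qed.
Lemma odd_neqP a b : (odd a == odd b) = false -> a <> b.
Proof. by move=> h e'; rewrite e' eqxx in h. Qed.

Section Paths.
Variables (V : finType) (adj : rel V).
Hypothesis adjC : symmetric adj.
Hypothesis adjxx : irreflexive adj.
Notation vec := {ffun V -> int}.

(** [I] gives two colour classes, and p is a path of M vertices whose colours alternate, beginning
    with colour e. In the application the classes are the fibers over two generators. *)
Variables (I : bool -> seq V) (p : nat -> V) (M : nat) (e : bool).
Hypothesis I_uniq : forall c, uniq (I c).
Hypothesis I_orth : forall c, orthogonal adj (I c).
Hypothesis I_disj : forall v, v \in I true -> v \in I false -> False.
Hypothesis p_I : forall z, (z < M)%N -> p z \in I (odd z (+) e).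
Hypothesis p_inj : forall z z', (z < M)%N -> (z' < M)%N -> p z = p z' -> z = z'.
Hypothesis p_adj : forall v c z, v \in I c -> (z < M)%N -> adj v (p z) ->
  exists z', [/\ (z' < M)%N, v = p z' & z' = z.+1 \/ z = z'.+1].
Hypothesis p_adjS : forall z, (z.+1 < M)%N -> adj (p z) (p z.+1).

Lemma dotD v b c : dot adj v (b + c) = dot adj v b + dot adj v c.
Proof. by rewrite /dot !ffunE; under eq_bigr do rewrite ffunE; rewrite big_split /=; ring. Qed.
Lemma dot0 v : dot adj v 0 = 0.
Proof. by rewrite /dot ffunE; under eq_bigr do rewrite ffunE; rewrite big1_eq. Qed.

(** The positive roots of a path of type A are the sums of consecutive simple roots; they are
    encoded by half-open intervals of positions. *)
Fixpoint itv_rec x n : vec := if n is n'.+1 then itv_rec x n' + simple (p (x + n')) else 0.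
Definition itv x y := itv_rec x (y - x).

Lemma itv1 x : itv x x.+1 = simple (p x).
Proof. by rewrite /itv subSnn /= addn0 add0r. Qed.

Lemma p_adjE w z : (w < M)%N -> (z < M)%N -> adj (p w) (p z) = (w == z.+1) || (z == w.+1).
Proof.
move=> wM zM; apply/idP/idP => [/(p_adj (p_I wM) zM) [z' [z'M /p_inj-> // h]]|].
  by case: h => [->|->]; rewrite eqxx ?orbT.
by case/orP => /eqP h; move: wM zM; rewrite h => wM zM; [rewrite adjC|]; exact: p_adjS.
Qed.

Lemma itvE x y w : (w < M)%N -> (y <= M)%N ->
  itv x y (p w) = (((x <= w) && (w < y))%N : nat)%:Z.
Proof.
move=> wM yM; have [xy|yx] := leqP x y; last first.
  rewrite /itv (eqP (ltnW yx : _ == _)) /= ffunE; clear -yx; lia.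
have : (x + (y - x) <= M)%N by rewrite subnKC.
have -> : (w < y)%N = (w < x + (y - x))%N by rewrite subnKC.
rewrite /itv; elim: (y - x)%N => [|n IH] le /=; first by rewrite ffunE; clear; lia.
rewrite ffunE IH; last by clear -le; lia.
rewrite ffunE; have -> : (p w == p (x + n)) = (w == x + n)%N.
  by apply/eqP/eqP => [/p_inj|->//]; apply => //; clear -le; lia.
by rewrite natz; clear -le; lia.
Qed.

Definition off_path v := forall z, (z < M)%N -> v != p z.

Lemma itv_out x y v : off_path v -> (y <= M)%N -> itv x y v = 0.
Proof.
move=> out yM; have [xy|yx] := leqP x y; last by rewrite /itv (eqP (ltnW yx : _ == _)) /= ffunE.
have : (x + (y - x) <= M)%N by rewrite subnKC.
rewrite /itv; elim: (y - x)%N => [|n IH] le /=; first by rewrite ffunE.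
rewrite ffunE IH ?ffunE; last by clear -le; lia.
by rewrite (negPf (out (x + n)%N _)) //; clear -le; lia.
Qed.

Lemma dot_itv x y w : (w < M)%N -> (x < y)%N -> (y <= M)%N ->
  dot adj (p w) (itv x y) =
  (w == x : nat)%:Z + (w.+1 == y : nat)%:Z - (w.+1 == x : nat)%:Z - (w == y : nat)%:Z.
Proof.
move=> wM xy yM; have : (x + (y - x) <= M)%N by rewrite subnKC // ltnW.
have : (0 < y - x)%N by rewrite subn_gt0.
have -> : (w.+1 == y) = (w.+1 == x + (y - x))%N by rewrite subnKC // ltnW.
have -> : (w == y) = (w == x + (y - x))%N by rewrite subnKC // ltnW.
rewrite /itv; case: (y - x)%N => // n _.
have D z : (z < M)%N -> dot adj (p w) (simple (p z)) =
    2 * (w == z : nat)%:Z - (w == z.+1 : nat)%:Z - (z == w.+1 : nat)%:Z.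
  move=> zM; rewrite dot_simple // p_adjE //.
  have -> : (p w == p z) = (w == z) by apply/eqP/eqP => [/p_inj|->//]; exact.
  by clear; case wz: (w == z); case a: (w == z.+1); case b: (z == w.+1) => /=; lia.
elim: n => [|n IH] le.
  rewrite /= dotD dot0 add0r D; last by clear -le; lia.
  by clear; lia.
rewrite [itv_rec _ _]/(itv_rec x n.+1 + simple (p (x + n.+1))) dotD IH ?D; by clear -le; lia.
Qed.

Lemma dot_itv_out x y v c : v \in I c -> off_path v -> (y <= M)%N -> dot adj v (itv x y) = 0.
Proof.
move=> vI out yM; have [xy|yx] := leqP x y; last by rewrite /itv (eqP (ltnW yx : _ == _)) /= dot0.
have : (x + (y - x) <= M)%N by rewrite subnKC.
rewrite /itv; elim: (y - x)%N => [|n IH] le /=; first by rewrite dot0.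
rewrite dotD IH; last by clear -le; lia.
have xnM : (x + n < M)%N by clear -le; lia.
rewrite dot_simple // (negPf (out _ xnM)) add0r ifF //.
by apply/negP => /(p_adj vI xnM) [z' [z'M vz _]]; move: (out _ z'M); rewrite vz eqxx.
Qed.

Lemma on_path v : off_path v \/ exists2 z, (z < M)%N & v = p z.
Proof.
case: (pselect (exists2 z, (z < M)%N & v = p z)) => [|h]; [by right | left].
by move=> z zM; apply/eqP => vz; apply: h; exists z.
Qed.

Lemma p_col z c : (z < M)%N -> (p z \in I c) = (c == odd z (+) e).
Proof.
move=> zM; have := p_I zM; case: c; case: (odd z (+) e) => h; rewrite ?h //.
  by apply/negP => /I_disj; exact.
by apply/negP => h2; exact: (I_disj h h2).
Qed.

(* The endpoints of an interval move by one step or stay: an endpoint that can shrink must shrink,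
   an endpoint that can grow may do so. *)
Definition left_step c x x' : Prop :=
  if odd x (+) e == c then x' = x.+1 else x' = x \/ (0 < x)%N /\ x' = x.-1.
Definition right_step c y y' : Prop :=
  if odd y.-1 (+) e == c then y' = y.-1 else y' = y \/ (y < M)%N /\ y' = y.+1.

(** The condition on [x.+1] excludes the intervals that consist of one vertex of colour c: these are
    simple roots killed by the step. *)
Lemma itv_step c x y x' y' : (x < y)%N -> (y <= M)%N -> left_step c x x' -> right_step c y y' ->
  (odd x (+) e == c -> x.+1 < y)%N ->
  posroot adj (itv x y) -> hits adj (I c) (itv x y) (itv x' y') /\ posroot adj (itv x' y').
Proof.
move=> xy yM lx ry ne rb.
have y'M : (y' <= M)%N by move: ry; rewrite /right_step; case: ifP => _; clear -yM xy; lia.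
have par w : (w < M)%N -> (p w \in I c) = (odd w (+) e == c) by move=> wM; rewrite p_col // eq_sym.
move: lx ry; rewrite /left_step /right_step => lx ry.
apply: hits_orthogonal => //.
- move=> v vI; apply/eqP => eb; have := dot_simple adjxx v v; rewrite eqxx -eb.
  case: (on_path v) => [out|[w wM vw]]; first by rewrite (dot_itv_out _ vI).
  move: vI; rewrite vw par // dot_itv //; clear -ne; move/eqP => cw.
  have [wx|] := eqVneq w x; last by lia.
  by have [wy|] := eqVneq w.+1 y; [move: ne; rewrite -wx cw eqxx -wy; lia | lia].
- move=> v vI; case: (on_path v) => [out|[w wM vw]]; first by rewrite !itv_out.
  move: vI; rewrite vw par // !itvE // => cw; congr (Posz (nat_of_bool _)).
  have pE n : (odd n (+) e == c) = (odd n != odd w).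
    by move: cw; clear; case: c; case: e; case: (odd n); case: (odd w).
  move: lx ry ne; rewrite !pE; clear -xy yM wM.
  case: ifP => hx; [move=> ->|case=> [->|[x0 ->]]];
    (case: ifP => hy; [move=> ->|case=> [->|[y0 ->]]]); move=> ne; lia.
- move=> v vI; case: (on_path v) => [out|[w wM vw]].
    by right; rewrite !itv_out // (dot_itv_out _ vI).
  move: vI; rewrite vw par // !itvE // dot_itv // => cw.
  have pE n : (odd n (+) e == c) = (odd n == odd w).
    by move: cw; clear => /eqP <-; case: e; case: (odd n); case: (odd w).
  move: lx ry ne; rewrite !pE; clear -xy yM wM => lx ry ne.
  have [h|h] := eqVneq ((x' <= w) && (w < y'))%N ((x <= w) && (w < y))%N; [right; split|left].
  + by rewrite h.
  + move: lx ry h ne.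
    case hx: (odd x == odd w); case hy: (odd y.-1 == odd w).
    * move: (odd_eqP hx) (odd_eqP hy); clear -xy yM wM; lia.
    * move: (odd_eqP hx) (odd_neqP hy); clear -xy yM wM; lia.
    * move: (odd_neqP hx) (odd_eqP hy); clear -xy yM wM; lia.
    * move: (odd_neqP hx) (odd_neqP hy); clear -xy yM wM; lia.
  + move: lx ry h ne.
    case hx: (odd x == odd w); case hy: (odd y.-1 == odd w).
    * move: (odd_eqP hx) (odd_eqP hy); clear -xy yM wM; lia.
    * move: (odd_eqP hx) (odd_neqP hy); clear -xy yM wM; lia.
    * move: (odd_neqP hx) (odd_eqP hy); clear -xy yM wM; lia.
    * move: (odd_neqP hx) (odd_neqP hy); clear -xy yM wM; lia.
Qed.

Definition alt_word c l := flatten [seq I (c (+) odd i) | i <- iota 0 l].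

Lemma alt_wordS c l : alt_word c l.+1 = alt_word c l ++ I (c (+) odd l).
Proof. by rewrite /alt_word -addn1 iotaD map_cat flatten_cat /= cats0. Qed.

Let par_c x0 c x l : c != odd x0 (+) e -> (odd x (+) e == c (+) odd l) = odd (x + x0 + l).
Proof. by rewrite !oddD; case: c; case: e; case: (odd x0); case: (odd x); case: (odd l). Qed.

(* In each step the endpoints of the interval first move outwards, [a] times on the left and [b]
   times on the right, then pause once and finally move inwards; they meet since a + b = k - 1. *)
Lemma block_hits x0 k c : (x0 < M)%N -> (0 < k <= M)%N -> c != odd x0 (+) e ->
  exists z, [/\ (z < M)%N, odd z (+) e != c (+) odd k.-1 &
    hits adj (alt_word c k) (simple (p x0)) (simple (p z))].
Proof.
(* The left endpoint moves out as far as there is room, at most k - 1 times; the remaining b steps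
   then fit on the right because k is at most M. *)
move=> x0M kM cx0; pose a := minn x0 k.-1; pose b := (k.-1 - a)%N.
have ab : [/\ a <= x0, a + b = k.-1 & x0 + b < M]%N by rewrite /b /a; clear -x0M kM; split; lia.
case: ab => ax0 abk bM; move: a b ax0 abk bM => a b ax0 abk bM.
(* At l = a + 1 the second branch still gives x0 - a: this is the pause, and likewise for [Y] at b +
   1. *)
pose X l := if (l <= a)%N then (x0 - l)%N else (x0 + l - 1 - 2 * a)%N.
pose Y l := if (l <= b)%N then (x0 + 1 + l)%N else (x0 + 2 + 2 * b - l)%N.
have xy l : (l <= k)%N -> (X l < Y l <= M)%N.
  by rewrite /X /Y; clear -x0M kM ax0 abk bM => lk; case: (leqP l a) => la; case: (leqP l b) => lb; try lia.
have P l : (l <= k)%N -> hits adj (alt_word c l) (itv x0 x0.+1) (itv (X l) (Y l)) /\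
    posroot adj (itv (X l) (Y l)).
  elim: l => [|l IH] lk.
    rewrite /X /Y /= subn0 addn0 addn1; split; last by rewrite itv1; exact: posroot_simple.
    by rewrite /alt_word /=; exact: hits_nil.
  have [h1 r1] := IH (ltnW lk); have /andP[h2 h3] := xy l (ltnW lk).
  have E1 := par_c (X l) l cx0; have E2 := par_c (Y l).-1 l cx0.
  have [|||h4 r2] := @itv_step (c (+) odd l) (X l) (Y l) (X l.+1) (Y l.+1) h2 h3 _ _ _ r1.
  - rewrite /left_step E1 /X; clear -ax0; case: (ltngtP l a) => la.
    + have -> : odd (x0 - l + x0 + l) = false by lia.
      right; lia.
    + have -> : odd (x0 + l - 1 - 2 * a + x0 + l) by lia.
      lia.
    + have -> : odd (x0 - l + x0 + l) = false by lia.
      left; lia.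
  - rewrite /right_step E2 /Y; clear -bM abk lk ax0; case: (ltngtP l b) => la.
    + have -> : odd ((x0 + 1 + l).-1 + x0 + l) = false by lia.
      right; lia.
    + have -> : odd ((x0 + 2 + 2 * b - l).-1 + x0 + l) by lia.
      lia.
    + have -> : odd ((x0 + 1 + l).-1 + x0 + l) = false by lia.
      left; lia.
  - rewrite E1 /X /Y; clear -ax0 abk lk; case: (leqP l a) => la; case: (leqP l b) => lb; lia.
  - by rewrite alt_wordS; split=> //; exact: hits_cat h4.
have [h _] := P k (leqnn k); have /andP[h2 h3] := xy k (leqnn k).
have XE : X k = (x0 + k - 1 - 2 * a)%N.
  by rewrite /X; clear -abk kM; case: leqP; lia.
have YE : Y k = (X k).+1.
  by rewrite XE /Y; clear -abk kM ax0; case: leqP; lia.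
exists (X k); split; first by lia.
  have := par_c (X k) k.-1 cx0; rewrite XE; move=> ->.
  by clear -ax0 kM abk; lia.
by move: h; rewrite YE !itv1.
Qed.

(** The truncated predecessor and [minn] express the walls: at position 0 or M an endpoint that
    would move out stands still. *)
Lemma itv_refl c x y : (x < y)%N -> (y <= M)%N -> (odd x (+) e == c -> x.+1 < y)%N ->
  refl_word adj (I c) (itv x y) =
  itv (if odd x (+) e == c then x.+1 else x.-1) (if odd y.-1 (+) e == c then y.-1 else minn y.+1 M).
Proof.
move=> xy yM ne; rewrite refl_word_orthogonal //; apply/ffunP => v; rewrite ffunE.
have y'M : ((if odd y.-1 (+) e == c then y.-1 else minn y.+1 M) <= M)%N.
  by clear -yM; case: ifP => _; lia.
case: (on_path v) => [out|[w wM ->]].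
  rewrite !itv_out //; case: ifP => // vI.
  by rewrite (dot_itv_out _ vI).
rewrite p_col // !itvE // dot_itv //.
have pE : forall n, (odd n (+) e == c) = ((odd n == odd w) == (odd w (+) e == c)).
  by clear => n; case: c; case: e; case: (odd n); case: (odd w).
move: ne; rewrite (pE x) (pE y.-1) [c == _]eq_sym; case: (odd w (+) e == c) => ne;
case hx: (odd x == odd w) ne; case hy: (odd y.-1 == odd w) => /= ne.
- move: (odd_eqP hx) (odd_eqP hy); clear -xy yM wM ne; lia.
- move: (odd_eqP hx) (odd_neqP hy); clear -xy yM wM ne; lia.
- move: (odd_neqP hx) (odd_eqP hy); clear -xy yM wM ne; lia.
- move: (odd_neqP hx) (odd_neqP hy); clear -xy yM wM ne; lia.
- move: (odd_eqP hx) (odd_eqP hy); clear -xy yM wM ne; lia.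
- move: (odd_eqP hx) (odd_neqP hy); clear -xy yM wM ne; lia.
- move: (odd_neqP hx) (odd_eqP hy); clear -xy yM wM ne; lia.
- move: (odd_neqP hx) (odd_neqP hy); clear -xy yM wM ne; lia.
Qed.

Lemma itv_ge0 x y v : 0 <= itv x y v.
Proof.
rewrite /itv; elim: (y - x)%N => [|n IH] /=; rewrite ffunE //.
by rewrite addr_ge0 // ffunE; case: eqP.
Qed.

Definition rev_alt_word c l := flatten [seq I (c (+) odd i) | i <- rev (iota 0 l)].

Lemma rev_alt_wordS c l : rev_alt_word c l.+1 = I (c (+) odd l) ++ rev_alt_word c l.
Proof. by rewrite /rev_alt_word -addn1 iotaD cats1 rev_rcons. Qed.

(** Both endpoints move one step per row, stand still once at the walls 0 and M, and turn back. They
    have not met after M rows, so the image is still an interval. *)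
Lemma block_refl x0 k c v : (x0 < M)%N -> (k <= M)%N -> c != odd x0 (+) e ->
  0 <= refl_word adj (rev_alt_word c k) (simple (p x0)) v.
Proof.
move=> x0M kM cx0.
pose X l := if (l <= x0)%N then (x0 - l)%N else (l - x0 - 1)%N.
pose Y l := if (l + x0 < M)%N then (x0 + 1 + l)%N else (2 * M - x0 - l)%N.
suff -> : refl_word adj (rev_alt_word c k) (simple (p x0)) = itv (X k) (Y k) by exact: itv_ge0.
elim: k kM => [|l IH] lM; first by rewrite /X /Y /= subn0 addn0 addn1 x0M itv1.
rewrite rev_alt_wordS refl_word_cat IH ?(ltnW lM) //.
have E1 := par_c (X l) l cx0; have E2 := par_c (Y l).-1 l cx0.
have h1 : (X l < Y l)%N.
  rewrite /X /Y; clear -x0M lM; case: (leqP l x0) => la; case: (ltnP (l + x0) M) => lb; lia.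
have h2 : (Y l <= M)%N.
  by rewrite /Y; clear -x0M lM; case: (ltnP (l + x0) M) => lb; lia.
have h3 : odd (X l) (+) e == c (+) odd l -> ((X l).+1 < Y l)%N.
  by rewrite E1 /X /Y; clear -x0M lM; case: (leqP l x0) => la; case: (ltnP (l + x0) M) => lb; lia.
rewrite (itv_refl h1 h2 h3) E1 E2; congr itv.
- rewrite /X; clear -lM; case: (ltngtP l x0) => la.
  + have -> : odd (x0 - l + x0 + l) = false by lia.
    by lia.
  + have -> : odd (l - x0 - 1 + x0 + l) by lia.
    by lia.
  + have -> : odd (x0 - l + x0 + l) = false by lia.
    by lia.
- rewrite /Y addSn; clear -x0M lM; case: (ltngtP (l + x0).+1 M) => lb.
  + have -> : odd ((x0 + 1 + l).-1 + x0 + l) = false by lia.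
    by lia.
  + have -> : odd ((2 * M - x0 - l).-1 + x0 + l) by lia.
    by lia.
  + have -> : odd ((x0 + 1 + l).-1 + x0 + l) = false by lia.
    by lia.
Qed.

End Paths.
End Intervals.

(** * Unfolding a Coxeter graph *)

Section Folding.
Variables (S : finType) (m : coxeter_matrix S) (k : nat).
Hypothesis k_gt1 : 1 < k.

Definition mk s t : nat := if m s t is Some j then j else k.
(** The number of vertices of the path of type A with Coxeter number [mk s t]. *)
Definition plen s t := (mk s t).-1.

Lemma mk_sym s t : mk s t = mk t s. Proof. by rewrite /mk cox_sym. Qed.
Lemma plen_sym s t : plen s t = plen t s. Proof. by rewrite /plen mk_sym. Qed.
Lemma mk_gt1 s t : s != t -> 1 < mk s t.
Proof. by rewrite /mk => st; case e: (m s t) => [j|] //; exact: cox_offdiag st e. Qed.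
Lemma plen_gt0 s t : s != t -> 0 < plen s t.
Proof. by move/mk_gt1; rewrite /plen; lia. Qed.

(** A common multiple of all path lengths, so that the range of each coordinate is cut into whole
    paths. *)
Definition modulus := \prod_(q : S * S) maxn 1 (plen q.1 q.2).

Lemma modulus_gt0 : 0 < modulus.
Proof. by apply: prodn_gt0 => q; rewrite leq_maxl. Qed.

Lemma plen_modulus s t : s != t -> plen s t %| modulus.
Proof.
move=> st; rewrite /modulus (bigD1 (s, t)) //=.
by have -> : maxn 1 (plen s t) = plen s t by [have := plen_gt0 st; lia]; exact: dvdn_mulr.
Qed.

Notation idx := {ffun S * S -> 'I_modulus.-1.+1}.
Definition vertex : finType := (S * idx)%type.

Lemma idx_lt (i : idx) q : i q < modulus.
Proof. by rewrite -[X in _ < X](prednK modulus_gt0); exact: ltn_ord. Qed.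

Definition upair (s t : S) : S * S := if enum_rank s <= enum_rank t then (s, t) else (t, s).

Lemma upair_sym s t : upair s t = upair t s.
Proof.
rewrite /upair; case: (ltngtP (enum_rank s) (enum_rank t)) => //.
by move=> /val_inj/enum_rank_inj ->.
Qed.

Lemma upairP s t s' t' : upair s t = upair s' t' -> (s = s' /\ t = t') \/ (s = t' /\ t = s').
Proof.
by rewrite /upair; case: ifP => _; case: ifP => _ [-> ->]; auto.
Qed.

(* Over a pair {s, t} the vertices above s and t are joined along the coordinate {s, t} only, into
   disjoint paths of [plen s t] vertices. *)
Definition fadj (u v : vertex) : bool :=
  let q := upair u.1 v.1 in let M := plen u.1 v.1 in
  [&& u.1 != v.1, [forall r, (r == q) || (u.2 r == v.2 r)]
    & ((u.2 q).+1 == v.2 q) && ~~ (M %| v.2 q) || ((v.2 q).+1 == u.2 q) && ~~ (M %| u.2 q)].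

Lemma fadjC : symmetric fadj.
Proof.
move=> u v; rewrite /fadj eq_sym upair_sym plen_sym orbC; congr [&& _, _ & _].
by apply: eq_forallb => r; rewrite eq_sym [u.2 r == _]eq_sym.
Qed.

Lemma fadjxx : irreflexive fadj.
Proof. by move=> u; rewrite /fadj eqxx. Qed.

Lemma fadj_neq u v : fadj u v -> u.1 != v.1.
Proof. by case/and3P. Qed.
Lemma fadj_off u v r : fadj u v -> r != upair u.1 v.1 -> u.2 r = v.2 r.
Proof. by case/and3P => _ /forallP/(_ r)/orP[->//|/eqP]. Qed.
Lemma fadj_on u v : fadj u v -> u.2 (upair u.1 v.1) <> v.2 (upair u.1 v.1).
Proof. by case/and3P => _ _ h e; move: h; rewrite e; lia. Qed.

(** The edge over one pair of generators changes the coordinate of that pair, while the other two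
    edges of a triangle would lie over different pairs and leave it unchanged. *)
Lemma fadj_tri u v w : fadj u v -> fadj v w -> fadj u w -> False.
Proof.
move=> uv vw uw; have nuv := fadj_neq uv; have nvw := fadj_neq vw; have nuw := fadj_neq uw.
apply: (fadj_on uv); rewrite (fadj_off uw) ?(fadj_off vw) //.
  apply/eqP => /upairP [[e1 e2]|[e1 e2]]; move: nuv nvw nuw; rewrite ?e1 ?e2 ?eqxx //.
apply/eqP => /upairP [[e1 e2]|[e1 e2]]; move: nuv nvw nuw; rewrite ?e1 ?e2 ?eqxx //.
Qed.

Definition fiber (s : S) : seq vertex := [seq (s, i) | i <- enum {: idx}].

Lemma mem_fiber s v : (v \in fiber s) = (v.1 == s).
Proof.
apply/mapP/eqP => [[i _ ->]//|<-]; exists v.2; rewrite ?mem_enum //.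
by case: v.
Qed.

Lemma fiber_uniq s : uniq (fiber s).
Proof. by rewrite map_inj_uniq ?enum_uniq // => i j []. Qed.

Lemma fiber_orth s : {in fiber s &, forall u v, ~~ fadj u v}.
Proof. by move=> u v; rewrite !mem_fiber /fadj => /eqP -> /eqP ->; rewrite eqxx. Qed.

Section Pair.
Variables (s t : S).
Hypothesis st : s != t.
Let q := upair s t.
Let M := plen s t.
Let M0 : 0 < M. Proof. exact: plen_gt0. Qed.

Definition sel (c : bool) := if c then t else s.

Lemma sel_pair c : upair (sel c) (sel (~~ c)) = q.
Proof. by case: c; rewrite /= /q // upair_sym. Qed.
Lemma sel_plen c : plen (sel c) (sel (~~ c)) = M.
Proof. by case: c; rewrite /= /M // plen_sym. Qed.
Lemma sel_inj : injective sel.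
Proof. by case=> -[] //= e; move: st; rewrite ?e eqxx. Qed.

Variables (i0 : idx) (e : bool).
(** The start of the block of M consecutive values that contains the coordinate of [i0]. *)
Let B := i0 q %/ M * M.

Definition shift_idx z : idx := [ffun r => if r == q then inord (B + z) else i0 r].
Definition path_vertex z : vertex := (sel (odd z (+) e), shift_idx z).

Let BM z : z < M -> B + z < modulus.
Proof.
move=> zM; apply: (@leq_trans (B + M)); first by rewrite ltn_add2l.
have h a : a < modulus -> (a %/ M).+1 * M <= modulus.
  have /dvdnP[n ->] := plen_modulus st.
  by rewrite -/M leq_pmul2r // ltnNge -leq_divRL // -ltnNge.
by rewrite /B addnC -mulSn; apply: h; exact: idx_lt.
Qed.

Lemma shift_idx_on z : z < M -> shift_idx z q = B + z :> nat.
Proof. by move=> zM; rewrite ffunE eqxx inordK // prednK ?modulus_gt0 // BM. Qed.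
Lemma shift_idx_off z r : r != q -> shift_idx z r = i0 r.
Proof. by move=> /negPf rq; rewrite ffunE rq. Qed.

Lemma shift_idx_self : shift_idx (i0 q %% M) = i0.
Proof.
apply/ffunP => r; case: (altP (r =P q)) => [->|/shift_idx_off //].
by apply: val_inj; rewrite /= shift_idx_on ?ltn_pmod // /B -divn_eq.
Qed.

Lemma path_in z : path_vertex z \in fiber (sel (odd z (+) e)).
Proof. by rewrite mem_fiber. Qed.

Lemma path_inj z z' : z < M -> z' < M -> path_vertex z = path_vertex z' -> z = z'.
Proof.
move=> zM z'M [_ h]; have := shift_idx_on zM; rewrite h shift_idx_on //.
by move/addnI.
Qed.

Let dvB z : (M %| B + z) = (M %| z). Proof. by rewrite dvdn_addr // dvdn_mull. Qed.

Lemma path_adjS z : z.+1 < M -> fadj (path_vertex z) (path_vertex z.+1).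
Proof.
move=> zM; have c : sel (odd z.+1 (+) e) = sel (~~ (odd z (+) e)) by rewrite /= addNb.
rewrite /fadj /= -/(odd z.+1) c sel_pair sel_plen; apply/and3P; split.
- by apply/eqP => /sel_inj; case: (_ (+) _).
- by apply/forallP => r; case: (altP (r =P q)) => // rq; rewrite !shift_idx_off ?eqxx.
apply/orP; left; rewrite !shift_idx_on // ?(ltnW zM) // addnS eqxx -addnS dvB.
by rewrite /dvdn modn_small.
Qed.

Lemma path_adj v c z : v \in fiber (sel c) -> z < M -> fadj v (path_vertex z) ->
  exists z', [/\ z' < M, v = path_vertex z' & z' = z.+1 \/ z = z'.+1].
Proof.
case: v => a j; rewrite mem_fiber => /eqP /= -> zM.
case: (altP (c =P odd z (+) e)) => [->|nc]; first by rewrite /fadj /= eqxx.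
have cE : odd z (+) e = ~~ c by move: nc; case: c; case: (_ (+) _).
rewrite /fadj /= cE sel_pair sel_plen shift_idx_on // => /and3P[_ /forallP off on].
have jE z' : z' < M -> j q = B + z' :> nat -> j = shift_idx z'.
  move=> z'M h; apply/ffunP => r; case: (altP (r =P q)) => [->|rq].
    by apply: val_inj; rewrite /= shift_idx_on.
  by have := off r; rewrite (negPf rq) /= => /eqP ->; rewrite !shift_idx_off.
case/orP: on => /andP[/eqP on dv].
  have z0 : 0 < z by rewrite lt0n; apply: contra dv => /eqP ->; rewrite dvB dvdn0.
  have z'M : z.-1 < M by rewrite (leq_ltn_trans (leq_pred z)).
  exists z.-1; split=> //; last by right; rewrite prednK.
  rewrite /path_vertex -(jE z.-1) //; last by apply: succn_inj; rewrite on -addnS prednK.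
  congr (sel _, _).
  by move: cE; rewrite -{1}(prednK z0) /= addNb; case: (odd z.-1 (+) e); case: (c).
have zM' : z.+1 < M.
  rewrite ltn_neqAle zM andbT; apply: contra dv => /eqP h.
  by rewrite -on -addnS dvB h.
exists z.+1; split=> //; last by left.
rewrite /path_vertex -(jE z.+1) //; last by rewrite -on addnS.
by congr (sel _, _); rewrite /= addNb cE negbK.
Qed.
End Pair.
End Folding.

(** * The homomorphism induced by unfolding *)

Section FoldBraid.
Local Open Scope group_scope.
Variables (S : finType) (m : coxeter_matrix S) (k : nat).
Hypothesis k_gt1 : (1 < k)%N.
Local Notation adj := (@fadj S m k).
Local Notation gm := (graph_matrix (@fadjC S m k)).
Notation H := (artin_group gm).
Notation V := (vertex m k).
Notation x := (artin_gen gm).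

Lemma gen_comm (u v : V) : ~~ adj u v -> commute (x u) (x v).
Proof.
move=> nuv; have [->|uv] := eqVneq u v; first exact: commute_refl.
have h : graph_entry adj u v = Some 2 by rewrite /graph_entry (negPf uv) (negPf nuv).
by have := ev_alt uv (h : gm u v = Some 2); rewrite /= !ev_cons !ev_nil !mulg1.
Qed.

Lemma gen_braid (u v : V) : adj u v -> x u * x v * x u = x v * x u * x v.
Proof.
move=> auv; have uv : u != v by apply: contraTneq auv => ->; rewrite fadjxx.
have h : graph_entry adj u v = Some 3 by rewrite /graph_entry (negPf uv) auv.
by have := ev_alt uv (h : gm u v = Some 3); rewrite /= !ev_cons !ev_nil !mulg1 !mulgA.
Qed.

Definition Psi (s : S) : H := \prod_(v <- fiber m k s) x v.

Section Pair.
Variables (s t : S).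
Hypothesis st : s != t.
Let q := upair s t.
Let M := plen m k s t.
Notation idx := {ffun S * S -> 'I_(modulus m k).-1.+1}.
Notation pv := (path_vertex (m := m) (k := k) s t).
Notation sel := (sel s t).

Definition base (i : idx) := M %| i q.

Lemma path_full_inj (i i' : idx) e e' z z' : base i -> base i' -> (z < M)%N -> (z' < M)%N ->
  pv i e z = pv i' e' z' -> [/\ i = i', e = e' & z = z'].
Proof.
move=> bi bi' zM z'M [h1 h2].
have E : (i q + z = i' q + z')%N.
  have := shift_idx_on k_gt1 st i zM; rewrite h2 (shift_idx_on k_gt1 st) //.
  by rewrite !divnK // => ->.
have zz : z = z'.
  have := congr1 (modn^~ M) E; rewrite /= -(modnDml (i q)) -(modnDml (i' q)) (eqP (bi : _ == _)) (eqP (bi' : _ == _)) !add0n.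
  by rewrite !modn_small.
move: h1 E; rewrite zz => /(sel_inj st)/addbI -> /addIn E; split=> //.
apply/ffunP => r; case: (altP (r =P q)) => [->|rq]; first exact: val_inj.
by have := congr1 (fun f : idx => f r) h2; rewrite !shift_idx_off.
Qed.

(** A path is determined by the index of its first vertex, whose coordinate is a multiple of M, and
    by the colour of that vertex. *)
Definition comps : seq (idx * bool) :=
  [seq (i, e) | i <- [seq i <- enum {: idx} | base i], e <- [:: false; true]].

Lemma comps_uniq : uniq comps.
Proof.
apply: allpairs_uniq => //; first by rewrite filter_uniq ?enum_uniq.
by move=> [? ?] [? ?] _ _ [-> ->].
Qed.

Lemma mem_comps c : (c \in comps) = base c.1.
Proof.
case: c => i e; apply/allpairsP/idP => [[[i' e'] /= [h _ [-> _]]]|/= bi].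
  by move: h; rewrite mem_filter => /andP[].
exists (i, e); rewrite /= mem_filter mem_enum bi; split=> //.
by case: e.
Qed.

Let xp (c : idx * bool) z : H := x (pv c.1 c.2 z).

Lemma Psi_comps b : Psi (sel b) = \prod_(c <- comps) row (xp c) M (c.2 (+) b).
Proof.
pose zs (c : idx * bool) := [seq z <- iota 0 M | odd z == c.2 (+) b].
have zsP c z : z \in zs c -> (z < M)%N by rewrite mem_filter mem_iota => /andP[_].
transitivity (\prod_(v <- [seq pv c.1 c.2 z | c <- comps, z <- zs c]) x v); last first.
  by rewrite big_allpairs_dep; apply: eq_bigr => c _; rewrite /row /zs big_filter.
apply: prod_perm; last by move=> u v uf vf; apply: gen_comm; exact: fiber_orth uf vf.
apply: uniq_perm; first exact: fiber_uniq.
  apply: allpairs_uniq_dep; first exact: comps_uniq.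
    by move=> c _; rewrite filter_uniq ?iota_uniq.
  move=> _ _ /allpairsPdep[c [z [cC zc ->]]] /allpairsPdep[c' [z' [c'C z'c ->]]] /= h.
  have bc : base c.1 by rewrite -mem_comps.
  have bc' : base c'.1 by rewrite -mem_comps.
  have [e1 e2 e3] := path_full_inj bc bc' (zsP _ _ zc) (zsP _ _ z'c) h.
  have e4 : c = c' by case: (c) (c') e1 e2 => [? ?] [? ?] /= -> ->.
  by move: zc; rewrite e4 e3.
move=> v; rewrite mem_fiber; apply/eqP/allpairsPdep => [vs|].
  case: v vs => a j /= ->.
  pose z := (j q %% M)%N; pose i := shift_idx s t j 0.
  have zM : (z < M)%N by rewrite ltn_pmod // plen_gt0.
  have M0 : (0 < M)%N by exact: plen_gt0.
  have iq : i q = (j q %/ M * M)%N :> nat by rewrite /i (shift_idx_on k_gt1 st) // addn0.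
  exists (i, odd z (+) b), z; split.
  - by rewrite mem_comps /base /= iq dvdn_mull.
  - by rewrite mem_filter mem_iota /= zM andbT -addbA addbb addbF.
  rewrite /path_vertex /= addbA addbb /=; congr (_, _).
  apply/ffunP => r; case: (altP (r =P q)) => [->|rq]; last by rewrite !shift_idx_off.
  by apply: val_inj; rewrite /= (shift_idx_on k_gt1 st) // -/q iq mulnK // -divn_eq.
case=> c [z [cC]]; rewrite mem_filter => /andP[/eqP zc _] -> /=.
by rewrite zc addbC addbA addbb.
Qed.

Lemma xp_commute c c' z z' : c \in comps -> c' \in comps -> c != c' -> (z < M)%N -> (z' < M)%N ->
  commute (xp c z) (xp c' z').
Proof.
rewrite !mem_comps => cC c'C cc zM z'M; apply: gen_comm; apply: contra cc => h.
have [z1 [z1M e1 _]] := path_adj k_gt1 st (path_in _ _ _ _ _) z'M h.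
have [e2 e3 _] := path_full_inj cC c'C zM z1M e1.
by case: (c) (c') e2 e3 => [? ?] [? ?] /= -> ->.
Qed.

Lemma row_commute c c' b : c \in comps -> c' \in comps -> c != c' -> forall n b',
  commute (row (xp c) M b) (rows (xp c') M b' n).
Proof.
move=> cC c'C cc n b'; apply: commute_prod => j _.
have rE (y : nat -> H) d : row y M d = \prod_(i <- [seq i <- iota 0 M | odd i == d]) y i.
  by rewrite big_filter.
rewrite !rE.
apply: prod_commute => z z'; rewrite !mem_filter !mem_iota => /andP[_ zM] /andP[_ z'M].
exact: xp_commute.
Qed.

Lemma Psi_alternating b n : \prod_(a <- alternating (sel b) (sel (~~ b)) n) Psi a =
  \prod_(c <- comps) rows (xp c) M (c.2 (+) b) n.
Proof.
elim: n b => [|n IH] b /=.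
  by rewrite big_nil big1_seq // => c _; rewrite /rows big_nil.
have := IH (~~ b); rewrite negbK => e; rewrite big_cons e Psi_comps -prod_split ?comps_uniq //.
  by apply: eq_bigr => c _; rewrite rowsSl addbN.
by move=> c c' cC c'C cc; exact: row_commute.
Qed.

(** Generators of different paths commute, so the claim splits over the paths. On a path of M
    vertices both sides are alternating products of M + 1 rows, to which [rows_braid] applies. *)
Lemma Psi_braid : \prod_(a <- alternating s t (mk m k s t)) Psi a =
  \prod_(a <- alternating t s (mk m k s t)) Psi a.
Proof.
have M0 : (0 < M)%N by exact: plen_gt0.
have mE : mk m k s t = M.+1 by rewrite /M /plen prednK // ltnW // mk_gt1.
rewrite -[s]/(sel false) -[t in LHS]/(sel (~~ false)) -[t in RHS]/(sel true).
rewrite -[sel false in RHS]/(sel (~~ true)) !Psi_alternating mE.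
rewrite !big_seq; apply: eq_bigr => c cC; rewrite addbF addbT; apply: rows_braid; split.
  move=> i j iM jM ij; apply: gen_comm; apply/negP => h.
  have [z1 [z1M e1 h1]] := path_adj k_gt1 st (path_in _ _ _ _ _) jM h.
  by have := path_inj k_gt1 st iM z1M e1; lia.
by move=> i iM; apply: gen_braid; exact: path_adjS.
Qed.
End Pair.

Definition expand (u : seq S) : seq V := flatten [seq fiber m k a | a <- u].

Lemma expand_cat u v : expand (u ++ v) = expand u ++ expand v.
Proof. by rewrite /expand map_cat flatten_cat. Qed.

Lemma ev_expand u : ev gm (expand u) = \prod_(a <- u) Psi a.
Proof.
elim: u => [|a u IH]; first by rewrite [LHS]ev_nil big_nil.
by rewrite big_cons -IH [expand _]/(_ ++ expand u) ev_cat.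
Qed.

(** Only relations with a finite label have to be respected, and for them [mk] is the label
    itself. *)
Lemma expand_cong u v : ev m u = ev m v ->
  pres_cong (braid_rel gm) (positive_word (expand u)) (positive_word (expand v)).
Proof.
move=> /ev_eq uv; apply/ev_eq; rewrite !ev_expand -!word_eval_positive.
apply: word_eval_cong uv => _ _ [s t j st e]; rewrite !word_eval_positive.
by have := Psi_braid st; rewrite /mk e.
Qed.
End FoldBraid.

(** * Common multiples of two generators *)

Section CommonMultiples.

Section Blocks.
Variables (S : finType) (m : coxeter_matrix S) (k : nat).
Hypothesis k_gt1 : 1 < k.
Local Notation adj := (@fadj S m k).
Notation V := (vertex m k).
Notation idx := {ffun S * S -> 'I_(modulus m k).-1.+1}.
Notation expand := (expand m k).
Notation root := (@simple V).

Section Pair.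
Variables (s t : S).
Hypothesis st : s != t.
Let I c := fiber m k (sel s t c).
Let M := plen m k s t.

Let I_disj v : v \in I true -> v \in I false -> False.
Proof. by rewrite !mem_fiber => /eqP -> /eqP /= e; move: st; rewrite e eqxx. Qed.

Let alt_wordE c l : alt_word I c l = expand (alternating (sel s t c) (sel s t (~~ c)) l).
Proof.
rewrite /alt_word /(expand _) alternatingE -map_comp; congr flatten.
by apply: eq_map => i /=; case: odd; rewrite /I ?addbT ?addbF.
Qed.

Let rev_alt_wordE c l : rev_alt_word I c l = expand (rev (alternating (sel s t c) (sel s t (~~ c)) l)).
Proof.
rewrite /rev_alt_word /(expand _) alternatingE -map_rev -map_comp; congr flatten.
by apply: eq_map => i /=; case: odd; rewrite /I ?addbT ?addbF.
Qed.

Let start (i : idx) : exists x0 e, [/\ x0 < M, odd x0 (+) e = true & path_vertex s t i e x0 = (t, i) :> V].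
Proof.
exists (i (upair s t) %% M), (~~ odd (i (upair s t) %% M)); split.
- by rewrite ltn_pmod // plen_gt0.
- by rewrite addbN addbb.
- by rewrite /path_vertex addbN addbb /= shift_idx_self.
Qed.

(** The root ends above the letter with which the word does not end; this is what allows blocks to
    be chained. *)
Lemma alternating_hits (i : idx) l : 0 < l < mk m k s t ->
  exists j, hits adj (expand (alternating s t l)) (root (t, i))
    (root ((if odd l.-1 then s else t), j)).
Proof.
move=> lM; have [x0 [e [x0M pe <-]]] := start i.
have [||z [zM zp h]] := @block_hits V adj (@fadjC S m k) (@fadjxx S m k) I
  (path_vertex s t i e) M e (fun c => fiber_uniq _ _ _) (fun c u v => @fiber_orth _ _ _ _ u v) I_disj
  (fun z _ => path_in _ _ _ _ z) (@path_inj _ _ _ k_gt1 _ _ st i e) (@path_adj _ _ _ k_gt1 _ _ st i e) (path_adjS k_gt1 st i e)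
  x0 l false x0M.
- by move: lM; rewrite /M /plen; lia.
- by rewrite pe.
exists (shift_idx s t i z); move: h; rewrite alt_wordE /=.
move: zp; rewrite /path_vertex addFb; case: (odd z (+) e); case: (odd l.-1) => //.
Qed.

Lemma alternating_refl_ge0 (i : idx) l v : l < mk m k s t ->
  Order.le 0%R (refl_word adj (expand (rev (alternating s t l))) (root (t, i)) v).
Proof.
move=> lM; have [x0 [e [x0M pe <-]]] := start i.
have := @block_refl V adj (@fadjC S m k) (@fadjxx S m k) I
  (path_vertex s t i e) M e (fun c => fiber_uniq _ _ _) (fun c u v => @fiber_orth _ _ _ _ u v) I_disj
  (fun z _ => path_in _ _ _ _ z) (@path_inj _ _ _ k_gt1 _ _ st i e) (@path_adj _ _ _ k_gt1 _ _ st i e) (path_adjS k_gt1 st i e)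
  x0 l false v x0M.
rewrite rev_alt_wordE /=; apply; last by rewrite pe.
by move: lM; rewrite /M /plen; lia.
Qed.
End Pair.

Lemma alternating_prefix (T : eqType) (r r' : T) (u : seq T) : {subset u <= [:: r; r']} ->
  exists l v, r :: u = alternating r r' l.+1 ++ v /\
    (v = [::] \/ exists v', v = (if odd l then r' else r) :: v').
Proof.
elim: u r r' => [|x u IH] r r' uS; first by exists 0, [::]; split => //; left.
have := uS x (mem_head _ _); rewrite !inE => /orP[/eqP ->|/eqP ex].
  by exists 0, (r :: u); split=> //; right; exists u.
have [|l [v [e h]]] := IH x r.
  by move=> y yu; have := uS y; rewrite !inE yu orbT => /(_ isT); rewrite ex orbC.
exists l.+1, v; rewrite e ex; split=> //; case: h => [->|[v' ->]]; [by left|right].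
by exists v'; rewrite /= ex; case: odd.
Qed.

Definition no_alternating (T : Type) (s t : T) n (u : seq T) :=
  forall a b, u <> a ++ alternating s t n ++ b /\ u <> a ++ alternating t s n ++ b.

Lemma no_alternating_catr (T : Type) (s t : T) n u v :
  no_alternating s t n (u ++ v) -> no_alternating s t n v.
Proof.
move=> h a b; have [h1 h2] := h (u ++ a) b.
by split=> e; [apply: h1 | apply: h2]; rewrite e -catA.
Qed.

Lemma no_alternating_sym (T : Type) (s t : T) n u : no_alternating s t n u -> no_alternating t s n u.
Proof. by move=> h a b; case: (h a b). Qed.

(** The word is cut at its first repeated letter. The alternating piece before it is shorter than
    [mk], and it moves the root above the letter with which the rest does not start, so the argument
    repeats. *)
Lemma dihedral_live r r' u w : r != r' -> {subset u <= [:: r; r']} ->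
  no_alternating r r' (mk m k r r') (r :: u) ->
  (forall i, live adj (expand w) (root (r, i))) -> (forall i, live adj (expand w) (root (r', i))) ->
  forall i, live adj (expand (r :: u ++ w)) (root (r', i)).
Proof.
have [n le] := ubnP (size u); elim: n => // n IHn in r r' u le *.
move=> rr uS na l1 l2 i.
have [l [v [e h]]] := alternating_prefix uS.
have lM : l.+1 < mk m k r r'.
  rewrite ltnNge; apply/negP => ge; have [/= na1 _] := na [::] (drop (mk m k r r') (r :: u)).
  apply: na1; rewrite -[LHS](cat_take_drop (mk m k r r')); congr (_ ++ _).
  by rewrite e (alternating_take _ _ ge) -catA take_size_cat // size_alternating.
have [j hj] := @alternating_hits _ _ rr i l.+1 lM.
rewrite -cat_cons e -catA expand_cat; apply: (live_cat hj) => /=.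
case: h => [->|[v' ve]]; first by case: odd.
have vS : {subset v <= [:: r; r']}.
  move=> y yv; have : y \in r :: u by rewrite e mem_cat yv orbT.
  by rewrite in_cons => /orP[/eqP ->|/uS //]; rewrite mem_head.
have sz : size v' < n.
  by have := congr1 size e; rewrite size_cat size_alternating ve /= => - [es]; move: le; rewrite es; lia.
have nav : no_alternating r r' (mk m k r r') v by apply: no_alternating_catr (alternating r r' l.+1) _ _; rewrite -e.
rewrite ve in vS nav *; case: odd vS nav => vS nav; apply: IHn => //.
- by rewrite eq_sym.
- by move=> y yv; have := vS y; rewrite !inE yv orbT orbC; exact.
- by rewrite mk_sym; exact: no_alternating_sym.
- by move=> y yv; apply: vS; rewrite inE yv orbT.
Qed.

(** The letters of a fiber commute, so the vertex whose simple root is concerned can be put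
    first. *)
Lemma not_live_fiber s i u : ~ live adj (expand (s :: u)) (root (s, i)).
Proof.
pose v : V := (s, i); have vs : v \in fiber m k s by rewrite mem_fiber.
rewrite -[expand (s :: u)]/(fiber m k s ++ expand u) => /live_catl lv.
apply: (@not_live_simple V adj (@fadjxx S m k) v (rem v (fiber m k s))).
move: lv; apply: (@live_cong V adj (@fadjC S m k) (@fadjxx S m k) (@fadj_tri S m k k_gt1)).
apply/ev_eq; apply: prod_perm; first exact: perm_to_rem.
by move=> x y xs ys; apply: gen_comm; exact: fiber_orth xs ys.
Qed.

Lemma live_ev u v b : ev m u = ev m v -> live adj (expand u) b -> live adj (expand v) b.
Proof.
move/(expand_cong k_gt1); exact: (@live_cong V adj (@fadjC S m k) (@fadjxx S m k) (@fadj_tri S m k k_gt1)).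
Qed.
End Blocks.

Section KeyLemma.
Variables (S : finType) (m : coxeter_matrix S).
Local Open Scope group_scope.
Notation ev := (ev m).
Implicit Types (s t : S) (u v w : seq S).

Lemma ev_catl u v v' : ev v = ev v' -> ev (u ++ v) = ev (u ++ v').
Proof. by rewrite !ev_cat => ->. Qed.
Lemma ev_catr u u' v : ev u = ev u' -> ev (u ++ v) = ev (u' ++ v).
Proof. by rewrite !ev_cat => ->. Qed.
Lemma ev_consI s u v : ev (s :: u) = ev (s :: v) -> ev u = ev v.
Proof. by rewrite !ev_cons => /mulgI. Qed.
Lemma ev_catI u v w : ev (u ++ v) = ev (u ++ w) -> ev v = ev w.
Proof. by rewrite !ev_cat => /mulgI. Qed.

Lemma maximal_prefix s t u : exists v w, [/\ ev u = ev (v ++ w), {subset v <= [:: s; t]} &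
  forall r w', r \in [:: s; t] -> ev w <> ev (r :: w')].
Proof.
suff H n v w : size w < n -> ev u = ev (v ++ w) -> {subset v <= [:: s; t]} ->
   exists v w, [/\ ev u = ev (v ++ w), {subset v <= [:: s; t]} &
  forall r w', r \in [:: s; t] -> ev w <> ev (r :: w')] by exact: (H _ [::] u).
elim: n v w => // n IH v w le e vS.
case: (pselect (exists2 r, r \in [:: s; t] & exists w', ev w = ev (r :: w'))) => [[r rS [w' ew]]|no].
  apply: (IH (rcons v r) w').
  - by have := ev_size ew; move=> /= h; move: le; rewrite h.
  - by rewrite cat_rcons e; exact: ev_catl.
  - by move=> y; rewrite mem_rcons inE => /orP[/eqP ->|/vS].
exists v, w; split=> // r w' rS ew; apply: no; exists r => //.
by exists w'.
Qed.

(** Conjugation by the full alternating word preserves {s, t}, so this word passes over any word in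
    s and t. *)
Lemma alternating_front s t j a : s != t -> m s t = Some j -> {subset a <= [:: s; t]} ->
  exists a', ev (a ++ alternating s t j) = ev (alternating s t j ++ a').
Proof.
move=> st e; elim: a => [|r a IH] aS; first by exists [::]; rewrite cats0.
have [a' IH'] := IH (fun y ya => aS y (mem_behead (ya : y \in behead (r :: a)))).
have [r' /andP[rr er]] : exists r', (r != r') && ((r == s) && (r' == t) || (r == t) && (r' == s)).
  have := aS r (mem_head _ _); rewrite !inE => /orP[/eqP ->|/eqP ->]; [exists t|exists s].
    by rewrite st !eqxx.
  by rewrite eq_sym st !eqxx orbT.
have sym : ev (alternating s t j) = ev (alternating r r' j).
  by case/orP: er => /andP[/eqP -> /eqP ->] //; exact: ev_alt.
have sym' : ev (alternating r r' j) = ev (alternating r' r j).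
  apply: ev_alt => //; case/orP: er => /andP[/eqP -> /eqP ->] //.
  by rewrite cox_sym.
exists ((if odd j then r' else r) :: a').
rewrite /= ev_cons IH' -ev_cons -cat_cons -cat_rcons.
rewrite [in LHS]ev_cat [in RHS]ev_cat; congr (_ * _).
rewrite ev_rcons sym -ev_rcons -alternating_rcons /= !ev_cons; congr (_ * _).
by rewrite sym sym'.
Qed.

(** A factor of length [mk] inside a word shorter than k forces the label to be finite. This keeps
    the substitute k for infinity invisible. *)
Lemma alternating_factor s t k u : s != t -> {subset u <= [:: s; t]} -> size u < k ->
  ~ no_alternating s t (mk m k s t) u -> exists j a, m s t = Some j /\ ev u = ev (alternating s t j ++ a).
Proof.
move=> st uS uk nna; have [a [b [x [y [xy e]]]]] : exists a b x y,
   ((x, y) = (s, t) \/ (x, y) = (t, s)) /\ u = a ++ alternating x y (mk m k s t) ++ b.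
  apply: contrapT => no; apply: nna => a b; split=> e; apply: no.
    by exists a, b, s, t; split=> //; left.
  by exists a, b, t, s; split=> //; right.
have sz : mk m k s t <= size u by rewrite e !size_cat size_alternating; lia.
have mE : exists j, m s t = Some j.
  by move: sz; rewrite /mk; case: (m s t) => [j _|]; [exists j | rewrite leqNgt uk].
case: mE => j mj; have kj : mk m k s t = j by rewrite /mk mj.
have aS : {subset a <= [:: s; t]} by move=> z za; apply: uS; rewrite e mem_cat za.
have [a' h] := alternating_front st mj aS.
exists j, (a' ++ b); split=> //.
rewrite e kj catA catA; apply: ev_catr; rewrite -h; apply: ev_catl.
by case: xy => -[-> ->] //; apply/esym; exact: ev_alt.
Qed.

(* Split off the maximal prefix of u in s and the first letter t: inside a dihedral block the root of
   a letter survives unless the block contains the whole alternating word of s and t. *)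
Lemma detect k n u : (1 < k)%N -> (size u < n)%N -> (size u < k)%N ->
  forall s, (forall u', ev u <> ev (s :: u')) -> forall i, live (@fadj S m k) (expand m k u) (simple (s, i)).
Proof.
move=> k1; elim: n u => // n IHn u le uk s ns i.
case: u => [|t u] in le uk ns *; first exact: live_nil.
have st : s != t by apply/eqP => e; apply: (ns u); rewrite e.
have [v [w [e vS wm]]] := maximal_prefix s t (t :: u).
case: v => [|r v] in e vS; first by case: (wm t u); rewrite ?inE ?eqxx ?orbT.
have rt : r = t.
  have := vS r (mem_head _ _); rewrite !inE => /orP[/eqP es|/eqP //].
  by case: (ns (v ++ w)); rewrite e es.
rewrite {}rt in e vS.
have sz := ev_size e; rewrite /= size_cat in sz.
have live_w x : x \in [:: s; t] -> forall j, live (@fadj S m k) (expand m k w) (simple (x, j)).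
  by move=> xS; apply: IHn => //=; [move: le; rewrite /= sz; lia | move: uk; rewrite /= sz; lia | move=> u'; exact: wm].
apply: (live_ev k1 (esym e)); apply: dihedral_live => //.
- by rewrite eq_sym.
- by move=> y yv; have := vS y; rewrite !inE yv orbT orbC; exact.
(* A full alternating factor of the block could be moved to its front and rewritten so as to start
   with s. *)
- apply: contrapT => /(alternating_factor _ _ _)[|||j [a [mj ea]]].
  + by rewrite eq_sym.
  + by move=> y /vS; rewrite !inE orbC.
  + by move: uk; rewrite /= sz; lia.
  have j2 := cox_offdiag _ mj; rewrite eq_sym in j2; have {}j2 := j2 st.
  apply: (ns (behead (alternating s t j) ++ a ++ w)).
  rewrite e (ev_catr w ea) -catA -cat_cons; apply: ev_catr.
  rewrite (ev_alt _ mj) 1?eq_sym //.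
  by case: (j) j2.
- by apply: live_w; rewrite !inE eqxx orbT.
- by apply: live_w; rewrite !inE eqxx.
Qed.

(* Otherwise the maximal prefix in s and t has no full alternating factor, and it keeps alive a root
   that the first letter of s u1 or of t u2 kills. *)
Lemma left_lcm s t u1 u2 : s != t -> ev (s :: u1) = ev (t :: u2) ->
  exists j w, m s t = Some j /\ ev (s :: u1) = ev (alternating s t j ++ w).
Proof.
(* This k exceeds the length of [s :: u1], hence of all words with the same value. *)
move=> st e; pose k := (size u1).+3; have k1 : (1 < k)%N by [].
have [v [w [ev1 vS wm]]] := maximal_prefix s t (s :: u1).
have sz := ev_size ev1; rewrite /= size_cat in sz.
have wk : (size w < k)%N by rewrite /k; lia.
have lw x : x \in [:: s; t] -> forall j, live (@fadj S m k) (expand m k w) (simple (x, j)).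
  by move=> xS; apply: (@detect k k) => // u'; exact: wm.
case: (pselect (no_alternating s t (mk m k s t) v)) => [na|/(alternating_factor st vS)[|j [a [mj ea]]]]; last 2 first.
- by rewrite /k; lia.
- by exists j, (a ++ w); split=> //; rewrite ev1 (ev_catr w ea) catA.
exfalso; case: v => [|r v] in ev1 vS na sz.
  by apply: (wm s u1); rewrite ?inE ?eqxx.
pose i : {ffun S * S -> 'I_(modulus m k).-1.+1} := [ffun=> ord0].
have vS' : {subset v <= [:: s; t]} by move=> y yv; apply: vS; rewrite inE yv orbT.
have := vS r (mem_head _ _); rewrite !inE => /orP[/eqP er|/eqP er]; rewrite er in ev1 na.
  apply: (@not_live_fiber S m k k1 t i u2); apply: (live_ev k1 (etrans (esym ev1) e)).
  by apply: dihedral_live => //; apply: lw; rewrite !inE eqxx ?orbT.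
apply: (@not_live_fiber S m k k1 s i u1); apply: (live_ev k1 (esym ev1)).
apply: dihedral_live => //.
- by rewrite eq_sym.
- by move=> y /vS'; rewrite !inE orbC.
- by rewrite mk_sym; exact: no_alternating_sym.
- by apply: lw; rewrite !inE eqxx orbT.
- by apply: lw; rewrite !inE eqxx.
Qed.

Lemma right_lcm s t u1 u2 : s != t -> ev (rcons u1 s) = ev (rcons u2 t) ->
  exists j w, m s t = Some j /\ ev (rcons u1 s) = ev (w ++ alternating s t j).
Proof.
move=> st /ev_rev; rewrite !rev_rcons => /(left_lcm st) [j [w [mj e]]].
exists j, (rev w); split=> //; have := ev_rev e.
rewrite rev_cons revK rev_cat => ->; apply: ev_catl.
exact: ev_rev_alt.
Qed.
End KeyLemma.
End CommonMultiples.

(** * Least common multiples *)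

Section Divisibility.
Local Open Scope group_scope.
Variables (S : finType) (m : coxeter_matrix S).
Notation G := (artin_group m).
Notation ev := (ev m).
Implicit Types (s t : S) (a b c d u v w x y z : seq S) (g : G) (Z : {set S}).

Lemma alternating_sub s t j : {subset alternating s t j <= [:: s; t]}.
Proof. by move=> r; rewrite alternatingE => /mapP[i _ ->]; rewrite !inE; case: odd; rewrite eqxx ?orbT. Qed.

(** Words with the same value and different first letters both agree with a word that starts with an
    alternating word, by [left_lcm]. Cancelling the first letters gives equalities between shorter
    words. So equalities in the group come down to braid relations on positive words. *)
Lemma ev_mem u v : ev u = ev v -> u =i v.
Proof.
have [n le] := ubnP (size u); elim: n u v le => // n IH u v le e.
case: u v => [|s u] [|t v] in le e *; try by have := ev_size e.
have [st|st] := eqVneq s t.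
  by move=> r; rewrite !inE st (IH u v) //; move: e; rewrite st => /ev_consI.
have [j [w [mj e1]]] := left_lcm st e.
have sz := ev_size e; have j2 := cox_offdiag st mj.
have e2 : ev (t :: v) = ev (alternating t s j ++ w) by rewrite -e e1 !ev_cat (ev_alt st mj).
case: j => [|[|j]] // in mj j2 e1 e2 *.
have h1 := IH _ _ (le : (size u < n)%N) (ev_consI e1).
have h2 := IH v _ _ (ev_consI e2).
move=> r; rewrite !inE h1 h2 /=; last by case: sz => <-.
rewrite !inE !mem_cat; have := @alternating_sub s t j r; have := @alternating_sub t s j r.
by rewrite !inE; do 2!case: (r \in alternating _ _ _); do 2!case: (r == _) => //=; 
   try (move=> /(_ isT)); try (move=> _ /(_ isT)).
Qed.

Lemma artin_gen_inj : injective (artin_gen m).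
Proof.
move=> s t e; have /ev_mem : ev [:: s] = ev [:: t] by rewrite !ev1.
by move=> /(_ s); rewrite !inE eqxx => /esym/eqP.
Qed.

(** Positivity is required of the quotient only; this makes divisibility invariant under right
    multiplication by any element of the group. *)
Definition rdiv (a b : G) := exists w, b = ev w * a.

Lemma rdiv_refl (a : G) : rdiv a a. Proof. by exists [::]; rewrite ev_nil mul1g. Qed.
Lemma rdiv_mull w (a : G) : rdiv a (ev w * a). Proof. by exists w. Qed.
Lemma rdiv_trans (b a c : G) : rdiv a b -> rdiv b c -> rdiv a c.
Proof. by move=> [u ->] [v ->]; exists (v ++ u); rewrite ev_cat mulgA. Qed.
Lemma rdiv_mul2r (c a b : G) : rdiv (a * c) (b * c) <-> rdiv a b.
Proof.
split=> [[w]|[w ->]]; last by exists w; rewrite mulgA.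
by rewrite mulgA => /mulIg ->; exists w.
Qed.
Lemma rdiv1 w : rdiv (ev [::]) (ev w). Proof. by exists w; rewrite ev_nil mulg1. Qed.
Lemma rdivE u w : rdiv (ev u) (ev w) <-> exists v, ev w = ev (v ++ u).
Proof. by split=> -[v h]; exists v; move: h; rewrite ev_cat. Qed.
Lemma rdiv_gen s w : rdiv (artin_gen m s) (ev w) <-> exists v, ev w = ev (rcons v s).
Proof. by split=> -[v h]; exists v; move: h; rewrite ev_rcons. Qed.

Lemma rdiv_size u w : rdiv (ev u) (ev w) -> size u <= size w.
Proof. by move/rdivE => [v /ev_size ->]; rewrite size_cat leq_addl. Qed.
Lemma rdiv_anti u w : rdiv (ev u) (ev w) -> rdiv (ev w) (ev u) -> ev u = ev w.
Proof.
move=> h /rdiv_size sz; case/rdivE: h => v e; move: (ev_size e) sz; rewrite e size_cat.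
by case: v e => //= r v _ -> /ltac:(lia).
Qed.

Lemma rdiv_gens_pos s t e : s != t -> rdiv (artin_gen m s) e -> rdiv (artin_gen m t) e ->
  exists j, m s t = Some j /\ rdiv (ev (alternating s t j)) e.
Proof.
move=> st [u ->]; rewrite -ev_rcons => /rdiv_gen[v] /(right_lcm st)[j [w [mj e1]]].
by exists j; split=> //; rewrite e1; exists w; rewrite ev_cat.
Qed.

Lemma alternating_last s t j r : s != t -> m s t = Some j -> r \in [:: s; t] ->
  exists2 a, {subset a <= [:: s; t]} /\ (size a).+1 = j & ev (alternating s t j) = ev (rcons a r).
Proof.
move=> st mj; have := cox_offdiag st mj; case: j mj => [|j] // mj _ rS.
have [e|e] := eqVneq r (if odd j then t else s).
  exists (alternating s t j); last by rewrite alternating_rcons e.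
  by split; [exact: alternating_sub | rewrite size_alternating].
exists (alternating t s j).
  split; last by rewrite size_alternating.
  by move=> y /alternating_sub; rewrite !inE orbC.
rewrite (ev_alt st mj) alternating_rcons; congr (ev (rcons _ _)).
by move: rS e; rewrite !inE; case: odd => /orP[]/eqP ->; rewrite ?eqxx.
Qed.

(** For words u s and v t, the alternating word of s and t is written as a s = b t. The lcm of u and
    a has the form p1 a, that of v and b the form p2 b; an lcm of p1 and p2 times the alternating
    word is the required lcm. *)
Lemma lcm_exists u v x y : ev (x ++ u) = ev (y ++ v) ->
  exists l, [/\ rdiv (ev u) (ev l), rdiv (ev v) (ev l) &
    forall e, rdiv (ev u) e -> rdiv (ev v) e -> rdiv (ev l) e].
Proof.
have [n le] := ubnP (size (x ++ u)); elim: n u v x y le => // n IH u v x y le e.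
case/lastP: u => [|u s] in le e *.
  by exists v; split; [exact: rdiv1 | exact: rdiv_refl | ].
case/lastP: v => [|v t] in e *.
  by exists (rcons u s); split; [exact: rdiv_refl | exact: rdiv1 | ].
move: e le; rewrite -!rcons_cat size_rcons => e le.
have [es|st] := eqVneq s t.
  rewrite -{}es in e *; move: e; rewrite !ev_rcons => /mulIg e.
  have [l [l1 l2 l3]] := IH _ _ _ _ le e.
  exists (rcons l s); rewrite !ev_rcons; split; try exact/rdiv_mul2r.
  move=> f [w ->]; rewrite mulgA rdiv_mul2r => h; apply/rdiv_mul2r; apply: l3 h.
  exact: rdiv_mull.
have [j [w [mj e1]]] := right_lcm st e.
have [a [aS sa] ea] := alternating_last (r := s) st mj (mem_head _ _).
have [b [bS sb] eb] := alternating_last st mj (mem_pair2 s t).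
have xu : ev (x ++ u) = ev (w ++ a).
  by move: e1; rewrite ev_cat ea -ev_cat -rcons_cat !ev_rcons => /mulIg.
have yv : ev (y ++ v) = ev (w ++ b).
  by move: e1; rewrite e ev_cat eb -ev_cat -rcons_cat !ev_rcons => /mulIg.
have sz := ev_size e1; rewrite size_rcons [size (w ++ _)]size_cat size_alternating in sz.
have j2 := cox_offdiag st mj.
have [l1 [l1u l1a l1m]] := IH _ _ _ _ le xu.
have [l2 [l2v l2b l2m]] : exists l, [/\ rdiv (ev v) (ev l), rdiv (ev b) (ev l) &
    forall e, rdiv (ev v) e -> rdiv (ev b) e -> rdiv (ev l) e].
  by apply: (IH _ _ y w) => //; have := ev_size e; rewrite !size_rcons => -[<-].
case/rdivE: l1a => p1 ep1; case/rdivE: l2b => p2 ep2.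
have [q1 ew1] : rdiv (ev p1) (ev w).
  apply/(rdiv_mul2r (ev a)); rewrite -!ev_cat -ep1; apply: l1m; apply/rdivE.
    by exists x.
  by exists w.
have [q2 ew2] : rdiv (ev p2) (ev w).
  apply/(rdiv_mul2r (ev b)); rewrite -!ev_cat -ep2; apply: l2m; apply/rdivE.
    by exists y.
  by exists w.
have [l [lp1 lp2 lm]] : exists l, [/\ rdiv (ev p1) (ev l), rdiv (ev p2) (ev l) &
    forall e, rdiv (ev p1) e -> rdiv (ev p2) e -> rdiv (ev l) e].
  apply: (IH p1 p2 q1 q2); last by rewrite !ev_cat -ew1 -ew2.
  by move: ew1; rewrite -ev_cat => /ev_size <-; move: le; rewrite sz; lia.
have Ea : ev (l ++ alternating s t j) = ev l * ev a * artin_gen m s by rewrite ev_cat ea ev_rcons mulgA.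
have Eb : ev (l ++ alternating s t j) = ev l * ev b * artin_gen m t by rewrite ev_cat eb ev_rcons mulgA.
exists (l ++ alternating s t j); split.
- rewrite Ea ev_rcons rdiv_mul2r; apply: rdiv_trans l1u _; rewrite ep1 ev_cat.
  exact/rdiv_mul2r.
- rewrite Eb ev_rcons rdiv_mul2r; apply: rdiv_trans l2v _; rewrite ep2 ev_cat.
  exact/rdiv_mul2r.
move=> f fu fv.
have fs : rdiv (artin_gen m s) f by apply: rdiv_trans fu; rewrite ev_rcons; exact: rdiv_mull.
have ft : rdiv (artin_gen m t) f by apply: rdiv_trans fv; rewrite ev_rcons; exact: rdiv_mull.
have [j' [mj' [w' ef]]] := rdiv_gens_pos st fs ft.
have {mj'} ej : j' = j by move: mj'; rewrite mj => -[].
rewrite {}ef {}ej in fu fv *; rewrite ev_cat rdiv_mul2r; apply: lm.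
  apply/(rdiv_mul2r (ev a)); rewrite -ev_cat -ep1; apply: l1m; last exact: rdiv_mull.
  by move: fu; rewrite ea !ev_rcons mulgA rdiv_mul2r.
apply/(rdiv_mul2r (ev b)); rewrite -ev_cat -ep2; apply: l2m; last exact: rdiv_mull.
by move: fv; rewrite eb !ev_rcons mulgA rdiv_mul2r.
Qed.

Lemma lcm_gens_exists (X : seq S) w : {in X, forall s, rdiv (artin_gen m s) (ev w)} ->
  exists l, {in X, forall s, rdiv (artin_gen m s) (ev l)} /\
    forall e, {in X, forall s, rdiv (artin_gen m s) e} -> (exists w, e = ev w) -> rdiv (ev l) e.
Proof.
elim: X => [|s X IH] wX.
  by exists [::]; split=> // e _ [w' ->]; exact: rdiv1.
have wX' : {in X, forall s, rdiv (artin_gen m s) (ev w)} by move=> r rX; apply: wX; rewrite inE rX orbT.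
have [l [lX lm]] := IH wX'.
case: (lm _ wX') => [|x ex]; first by exists w.
have [y ey] := wX s (mem_head _ _).
have [|l' [l1 l2 l3]] := @lcm_exists l [:: s] x y; first by rewrite !ev_cat -ex ey ev1.
exists l'; rewrite ev1 in l2 l3; split.
  by move=> r; rewrite inE => /orP[/eqP -> //|/lX h]; exact: rdiv_trans h l1.
move=> e eX ep; apply: l3; last by apply: eX; rewrite inE eqxx.
by apply: lm => // r rX; apply: eX; rewrite inE rX orbT.
Qed.

Lemma tail_exists Z w : exists u v, [/\ ev w = ev (u ++ v), {subset v <= Z} &
  {in Z, forall s, ~ rdiv (artin_gen m s) (ev u)}].
Proof.
have [n le] := ubnP (size w); elim: n w le => // n IH w le.
case: (pselect (exists2 s, s \in Z & rdiv (artin_gen m s) (ev w))) => [[s sZ /rdiv_gen[w' e]]|no].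
  have [|u [v [e' vZ h]]] := IH w'; first by have := ev_size e; rewrite size_rcons => sz; rewrite sz in le.
  exists u, (rcons v s); split=> //; first by rewrite e ev_rcons e' -ev_rcons rcons_cat.
  by move=> r; rewrite mem_rcons inE => /orP[/eqP ->|/vZ].
exists w, [::]; rewrite cats0; split=> // s sZ h; apply: no; by exists s.
Qed.

(** This makes v the greatest right divisor over Z. If a and v end differently, the alternating word
    of their last letters right divides the whole word; by induction it right divides v already,
    which can then be rewritten to end like a. *)
Lemma tail_rdiv Z u v a : {in Z, forall s, ~ rdiv (artin_gen m s) (ev u)} ->
  {subset v <= Z} -> {subset a <= Z} -> rdiv (ev a) (ev (u ++ v)) -> rdiv (ev a) (ev v).
Proof.
move=> uZ; have [n le] := ubnP (size v); elim: n v a le => // n IHv v a le vZ.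
case/lastP: a => [|a t] aZ; first by move=> _; exact: rdiv1.
have tZ : t \in Z by apply: aZ; rewrite mem_rcons mem_head.
have {}aZ : {subset a <= Z} by move=> r ra; apply: aZ; rewrite mem_rcons inE ra orbT.
move=> [x ex]; have et : rdiv (artin_gen m t) (ev (u ++ v)).
  by rewrite ex ev_rcons mulgA -ev_cat; exact: rdiv_mull.
case/lastP: v => [|v s] in le vZ ex et *; first by case: (uZ t tZ); move: et; rewrite cats0.
have sZ : s \in Z by apply: vZ; rewrite mem_rcons mem_head.
have {}vZ : {subset v <= Z} by move=> r rv; apply: vZ; rewrite mem_rcons inE rv orbT.
rewrite size_rcons in le.
have [es|st] := eqVneq s t.
  rewrite !ev_rcons es; apply/rdiv_mul2r; apply: IHv => //; exists x.
  by move: ex; rewrite es -rcons_cat !ev_rcons mulgA => /mulIg.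
have [j [mj [w ew]]] : exists j, m s t = Some j /\ rdiv (ev (alternating s t j)) (ev (u ++ rcons v s)).
  by apply: rdiv_gens_pos => //; rewrite -rcons_cat ev_rcons; exact: rdiv_mull.
have pairZ : {subset [:: s; t] <= Z} by move=> r; rewrite !inE => /orP[]/eqP ->.
have [b [bS sb] eb] := alternating_last (r := s) st mj (mem_head _ _).
have [c [cS sc] ec] := alternating_last st mj (mem_pair2 s t).
have [z ez] : rdiv (ev b) (ev v).
  apply: IHv => //; first by move=> r /bS/pairZ.
  by exists w; move: ew; rewrite eb -rcons_cat !ev_rcons mulgA => /mulIg.
have evs : ev (rcons v s) = ev (rcons (z ++ c) t).
  by rewrite rcons_cat ev_cat -ec eb !ev_rcons ez mulgA.
have sz : size (z ++ c) = size v by move: (ev_size evs); rewrite !size_rcons => -[].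
rewrite evs !ev_rcons; apply/rdiv_mul2r; apply: IHv => //.
- by rewrite sz.
- move=> r; rewrite mem_cat => /orP[rz|/cS/pairZ //].
  by apply: vZ; move: ez; rewrite -ev_cat => /ev_mem ->; rewrite mem_cat rz.
- exists x; move: ex; rewrite ev_cat evs -ev_cat -rcons_cat !ev_rcons mulgA.
  by move=> /mulIg.
Qed.
End Divisibility.

(** * The Garside element of a set of generators *)

Section Garside.
Local Open Scope group_scope.
Variables (S : finType) (m : coxeter_matrix S).
Notation G := (artin_group m).
Notation ev := (ev m).
Notation gen := (artin_gen m).
Notation rdiv := (@rdiv S m).
Implicit Types (s t : S) (a b c d u v w x y z : seq S) (g : G) (X : {set S}).

Definition common_multiple X g := {in X, forall s, rdiv (gen s) g}.

Lemma finset_bij_in X (f : S -> S) : {in X, forall s, f s \in X} -> {in X &, injective f} ->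
  {in X, forall s', exists2 s, s \in X & f s = s'}.
Proof.
move=> fX fi s' s'X; have /eqP e : finset.imset f (mem X) == X.
  rewrite eqEcard card_in_imset // leqnn andbT; apply/fintype.subsetP => _ /imsetP[s sX ->].
  exact: fX.
by move: s'X; rewrite -{1}e => /imsetP[s sX ->]; exists s.
Qed.

Lemma alternating_conj s t j : s != t -> m s t = Some j ->
  exists r, ev (alternating s t j) * gen s = gen r * ev (alternating s t j).
Proof.
move=> st mj; have e := ev_alt st mj; case oj : (odd j).
  exists t; rewrite -[RHS]ev_cons -[t :: _]/(alternating t s j.+1) alternating_rcons oj.
  by rewrite ev_rcons e.
exists s; rewrite -ev_rcons [in RHS]e -ev_cons -[s :: _]/(alternating s t j.+1).
by rewrite alternating_rcons oj.
Qed.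

(** The lcm agrees with its own tail over X, hence is a word over X. Multiplying it on the right by
    s in X gives another common multiple, so by minimality and length the factor s passes to the
    left as a single generator. *)
Lemma garside_element X w : common_multiple X (ev w) ->
  exists d, [/\ {subset d <= X}, common_multiple X (ev d),
    forall e, common_multiple X (ev e) -> rdiv (ev d) (ev e),
    {in X, forall s, exists2 s', s' \in X & ev d * gen s = gen s' * ev d} &
    {in X, forall s', exists2 s, s \in X & ev d * gen s = gen s' * ev d}].
Proof.
move=> cw; have [|l [lX lm]] := @lcm_gens_exists _ m (enum X) w.
  by move=> s; rewrite mem_enum; exact: cw.
have {}lX : common_multiple X (ev l) by move=> s sX; apply: lX; rewrite mem_enum.
have {}lm e : common_multiple X (ev e) -> rdiv (ev l) (ev e).
  by move=> h; apply: lm; [move=> s; rewrite mem_enum; exact: h | exists e].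
have [u [v [elv vX uX]]] := tail_exists m X l.
have cv : common_multiple X (ev v).
  move=> s sX; rewrite -ev1; apply: (tail_rdiv uX vX); last by rewrite ev1 -elv; exact: lX.
  by move=> r; rewrite inE => /eqP ->.
have elv' : ev l = ev v by apply: rdiv_anti; [exact: lm | rewrite elv ev_cat; exact: rdiv_mull].
have vm e : common_multiple X (ev e) -> rdiv (ev v) (ev e) by rewrite -elv'; exact: lm.
have fP s : exists s', s \in X -> s' \in X /\ ev v * gen s = gen s' * ev v.
  case: (boolP (s \in X)) => [sX|_]; last by exists s.
  have /vm : common_multiple X (ev (rcons v s)).
    move=> t tX; have [<-|st] := eqVneq s t; first by apply/rdiv_gen; exists v.
    have [j [mj [z ez]]] := rdiv_gens_pos st (cv s sX) (cv t tX).
    have [b [bS sb] eb] := alternating_last st mj (mem_pair2 s t).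
    have [r er] := alternating_conj st mj.
    rewrite ev_rcons ez -mulgA er eb ev_rcons !mulgA -ev_rcons -ev_cat.
    exact: rdiv_mull.
  move=> [z ez]; have := ev_size (etrans ez (esym (ev_cat _ _ _))); rewrite size_rcons size_cat => sz.
  case: z ez sz => [|s' [|]] //=; try lia.
  rewrite ev1 ev_rcons => ez _; exists s' => _; split=> //.
  have : ev (rcons v s) = ev (s' :: v) by rewrite ev_rcons ev_cons.
  move/ev_mem/(_ s'); rewrite inE eqxx mem_rcons inE => /orP[/eqP -> //|/vX //].
have [f fE] := choice fP.
exists v; split=> //; first by move=> s sX; have [] := fE s sX; exists (f s).
move=> s' /(finset_bij_in (f := f))[|s1 s2 s1X s2X e|s sX <-].
- by move=> s /fE[].
- have [_ e1] := fE _ s1X; have [_ e2] := fE _ s2X.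
  by apply: (@artin_gen_inj S m); apply: (@mulgI _ (ev v)); rewrite e1 e2 e.
by exists s => //; have [] := fE s sX.
Qed.

Lemma left_garside X d : {subset d <= X} -> common_multiple X (ev d) ->
    {in X, forall s', exists2 s, s \in X & ev d * gen s = gen s' * ev d} ->
  {in X, forall s, exists2 v, {subset v <= X} & ev d = gen s * ev v}.
Proof.
move=> dX dm dc s' s'X; have [s sX e] := dc _ s'X; have [v ev_d] := dm s sX.
have e1 : ev d = gen s' * ev v.
  by apply: (@mulIg _ (gen s)); rewrite e {1}ev_d mulgA.
exists v => // r rv; apply: dX; move: e1; rewrite -ev_cons => /ev_mem ->.
by rewrite inE rv orbT.
Qed.

(** The left lcm property comes from reversal: the reversed word is again a common multiple of X of
    the same length, hence equal to the lcm. Uniqueness of the lcm then determines the value of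
    [xget]. *)
Lemma DeltaE X w : common_multiple X (ev w) ->
  exists d, [/\ Delta m X = ev d, {subset d <= X}, common_multiple X (ev d),
    forall e, common_multiple X (ev e) -> rdiv (ev d) (ev e) &
    {in X, forall s, exists2 s', s' \in X & ev d * gen s = gen s' * ev d}/\
    {in X, forall s', exists2 s, s \in X & ev d * gen s = gen s' * ev d}].
Proof.
move=> cw; have [d [dX dcm dmin d1 d2]] := garside_element cw.
exists d; split=> //.
have ld := left_garside dX dcm d2.
have MP v : {subset v <= X} -> artin_monoid m X (ev v) by move=> h; apply/artin_monoidP; exists v.
have rl : is_lcm (artin_monoid m X) (right_divides (artin_monoid m X)) (gen @` [set` X])%classic (ev d).
  split; first exact: MP.
  - move=> _ [s /= sX <-]; have [v e] := dcm _ sX; exists (ev v) => //.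
    apply: MP => r rv; apply: dX; move: e; rewrite -ev_rcons => /ev_mem ->.
    by rewrite mem_rcons inE rv orbT.
  - move=> e /artin_monoidP[u uX ->] h; have [|v ve] := dmin u.
      by move=> s sX; have [c /artin_monoidP[c' _ ->] ->] := h _ (ex_intro2 _ _ s sX erefl); exists c'.
    exists (ev v) => //; apply: MP => r rv; apply: uX; move: ve; rewrite -ev_cat => /ev_mem ->.
    by rewrite mem_cat rv.
have ll : is_lcm (artin_monoid m X) (left_divides (artin_monoid m X)) (gen @` [set` X])%classic (ev d).
  split; first exact: MP.
  - by move=> _ [s /= sX <-]; have [v vX e] := ld _ sX; exists (ev v) => //; exact: MP.
  - move=> e /artin_monoidP[u uX ->] h.
    have cr : common_multiple X (ev (rev u)).
      move=> s sX; have [c /artin_monoidP[c' _ ->]] := h _ (ex_intro2 _ _ s sX erefl).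
      by rewrite -ev_cons => /ev_rev; rewrite rev_cons ev_rcons => ->; exact: rdiv_mull.
    have [v] := dmin _ cr; rewrite -ev_cat => /ev_rev; rewrite revK rev_cat => e1.
    have cr' : common_multiple X (ev (rev d)).
      by move=> s sX; have [c _] := ld _ sX; rewrite -ev_cons => /ev_rev; rewrite rev_cons ev_rcons => ->; exact: rdiv_mull.
    have e2 : ev (rev d) = ev d.
      apply/esym; apply: rdiv_anti; first exact: dmin.
      have [z] := dmin _ cr'; rewrite -ev_cat => e3; have := ev_size e3; rewrite size_cat size_rev.
      by case: z e3 => [|? ?] /= e3; [move=> _; rewrite e3; exact: rdiv_refl | lia].
    exists (ev (rev v)); last by rewrite e1 ev_cat e2.
    by apply: MP => r rv; apply: uX; rewrite (ev_mem e1) mem_cat rv orbT.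
rewrite /Delta; apply: xget_unique => //= y [_ [/artin_monoidP[v _ ->] yl ym]].
apply: rdiv_anti.
  have [_ h _] := rl; have [c /artin_monoidP[c' _ ->] ->] := ym _ (MP _ dX) h.
  exact: rdiv_mull.
by apply: dmin => s sX; have [c /artin_monoidP[c' _ ->] ->] := yl _ (ex_intro2 _ _ s sX erefl); exact: rdiv_mull.
Qed.
End Garside.

(** * Square-free elements *)

Section SquareFree.
Local Open Scope group_scope.
Variables (S : finType) (m : coxeter_matrix S).
Notation G := (artin_group m).
Notation ev := (ev m).
Notation gen := (artin_gen m).
Notation rdiv := (@rdiv S m).
Implicit Types (s t : S) (a b c d u v w x y z : seq S) (g : G) (X : {set S}).

(** The counterpart in the Artin group of reduced words of the Coxeter group. *)
Definition sqfree u := forall x r y, ev u <> ev (x ++ r :: r :: y).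

Lemma sqfree_nil : sqfree [::].
Proof. by move=> x r y /ev_size; rewrite size_cat /= => /eqP; rewrite addnS. Qed.
Lemma sqfree_ev u v : ev u = ev v -> sqfree u -> sqfree v.
Proof. by move=> e h x r y; rewrite -e; exact: h. Qed.
Lemma sqfree_catl u v : sqfree (u ++ v) -> sqfree u.
Proof. by move=> h x r y e; apply: (h x r (y ++ v)); rewrite (ev_catr v e) -catA. Qed.
Lemma sqfree_catr u v : sqfree (u ++ v) -> sqfree v.
Proof. by move=> h x r y e; apply: (h (u ++ x) r y); rewrite (ev_catl u e) -catA. Qed.
Lemma sqfree_not_rdiv u s : sqfree (rcons u s) -> ~ rdiv (gen s) (ev u).
Proof. by move=> h /rdiv_gen[v e]; apply: (h v s [::]); rewrite ev_rcons e -ev_rcons -!cats1 -catA. Qed.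

Lemma sqfree_pair s t v : s != t -> {subset v <= [:: s; t]} -> sqfree v -> ~ rdiv (gen s) (ev v) ->
  exists l, v = rev (alternating t s l) /\ forall j, m s t = Some j -> l < j.
Proof.
move=> st vS sv nd.
have [l e] : exists l, v = rev (alternating t s l).
  case/lastP: v => [|v r] in vS sv nd *; first by exists 0.
  have rt : r = t.
    have := vS r; rewrite mem_rcons mem_head !inE => /(_ isT)/orP[/eqP e|/eqP //].
    by case: nd; apply/rdiv_gen; exists v; rewrite e.
  rewrite {}rt in vS sv nd *; have [|l [v' [e h]]] := @alternating_prefix _ t s (rev v).
    by move=> y; rewrite mem_rev => yv; have := vS y; rewrite mem_rcons !inE yv orbT orbC; exact.
  exists l.+1; rewrite -[LHS]revK rev_rcons e; case: h => [->|[v2 ev2]]; first by rewrite cats0.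
  exfalso; apply: (sv (rev v2) (if odd l then s else t) (rev (alternating t s l))).
  rewrite -[rcons v t]revK rev_rcons e ev2 alternating_rcons rev_cat rev_rcons rev_cons.
  by rewrite cat_rcons.
exists l; split=> // j mj; rewrite ltnNge; apply/negP => jl; apply: nd.
have -> : v = rev (drop j (alternating t s l)) ++ rev (alternating t s j).
  by rewrite e -rev_cat -alternating_take.
have mj' : m t s = Some j by rewrite cox_sym.
have st' : t != s by rewrite eq_sym.
rewrite ev_cat (ev_rev_alt st' mj') (ev_alt st' mj').
have [b _ ->] := alternating_last (r := s) st mj (mem_head _ _).
by rewrite -ev_cat; apply/rdiv_gen; exists (rev (drop j (alternating t s l)) ++ b); rewrite rcons_cat.
Qed.

(** The cut on which the inductions below run: u is shorter than the word because the block v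
    contains at least the last letter. *)
Lemma sqfree_last_block s t a : sqfree (rcons a t) -> ~ rdiv (gen s) (ev (rcons a t)) ->
  exists u v l, [/\ s != t, v = rev (alternating t s l), 0 < l, forall j, m s t = Some j -> l < j &
    ev (rcons a t) = ev (u ++ v) /\ sqfree u /\ {in [:: s; t], forall r, ~ rdiv (gen r) (ev u)}].
Proof.
move=> sa nd; have st : s != t by apply/eqP => e; apply: nd; apply/rdiv_gen; exists a; rewrite e.
have [u [v [e vS uS]]] := tail_exists m [set s; t] (rcons a t).
have vS' : {subset v <= [:: s; t]} by move=> y /vS; rewrite !inE.
have uS' : {in [:: s; t], forall r, ~ rdiv (gen r) (ev u)}.
  by move=> r rS; apply: uS; move: rS; rewrite !inE.
have suv := sqfree_ev e sa; have [|l [vE lj]] := sqfree_pair st vS' (sqfree_catr suv).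
  by move=> h; apply: nd; rewrite e ev_cat; apply: rdiv_trans h _; exact: rdiv_mull.
exists u, v, l; split=> //; last by split=> //; split=> //; exact: sqfree_catl suv.
case: l vE {lj} => // vE; case: (uS' t (mem_pair2 _ _)); apply/rdiv_gen; exists a.
by rewrite e vE cats0.
Qed.

(** Otherwise the full alternating word would be a right divisor, and cancelling its last i letters
    would leave p or q as a right divisor of w. *)
Lemma next_not_rdiv w p q i j : p != q -> m p q = Some j -> i < j ->
  ~ rdiv (gen p) (ev w) -> ~ rdiv (gen q) (ev w) ->
  ~ rdiv (gen (if odd i then q else p)) (ev (w ++ alternating p q i)).
Proof.
move=> pq mj ij np nq; case: i => [|i] in ij *; first by rewrite cats0.
pose r := if odd i then q else p; pose n := if odd i.+1 then q else p.
have rn : r != n by rewrite /r /n /=; case: odd => //; rewrite eq_sym.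
have mrn : m r n = Some j by rewrite /r /n /=; case: odd => //; rewrite cox_sym.
have altE : alternating p q i.+1 = rev (alternating r n i.+1).
  by rewrite rev_alternating /r /n /=; case: odd.
move=> nd; have rd : rdiv (gen r) (ev (w ++ alternating p q i.+1)).
  by apply/rdiv_gen; exists (w ++ alternating p q i); rewrite alternating_rcons rcons_cat.
have [j' [mj' [z ez]]] := rdiv_gens_pos rn rd nd.
have {mj'} ej : j' = j by move: mj'; rewrite mrn => -[].
rewrite {}ej -(ev_rev_alt rn mrn) in ez.
have dE := alternating_take r n (ltnW ij).
have sd : size (drop i.+1 (alternating r n j)) = j - i.+1 by rewrite size_drop size_alternating.
have mem (c : S) : c \in drop i.+1 (alternating r n j) -> c \in [:: r; n].
  by move=> /mem_drop; exact: alternating_sub.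
case: (drop _ _) dE sd mem => [|c d] dE sd mem; first by move: sd ij => /=; lia.
move: ez; rewrite altE dE rev_cat rev_cons !ev_cat mulgA => /mulIg ez.
have cw : rdiv (gen c) (ev w) by rewrite ez ev_rcons mulgA -ev_cat; exact: rdiv_mull.
have := mem c (mem_head _ _); rewrite /r /n /= !inE.
by case: odd => /orP[]/eqP e; rewrite e in cw.
Qed.

(** A form of the exchange condition. If a word for [rcons a s] contains a square and ends in
    another letter q, then a and the word without q are a common w followed by the two alternating
    words. The induction builds the second one letter by letter without creating a square. *)
Lemma sqfree_rcons a s : sqfree a -> ~ rdiv (gen s) (ev a) -> sqfree (rcons a s).
Proof.
have [n le] := ubnP (size a); elim: n a s le => // n IH a s le sa nd x r y e.
(* Here q is the last letter of the word with a square: either the square is at the end and q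
   divides [e0], or it lies inside [e0]. *)
have [e0 [q [eq e0P]]] : exists e0 q, ev (rcons a s) = ev (rcons e0 q) /\
    (rdiv (gen q) (ev e0) \/ ~ sqfree e0).
  case/lastP: y => [|y q] in e *.
    exists (rcons x r), r; split; first by rewrite e -!cats1 -catA.
    by left; apply/rdiv_gen; exists x.
  exists (x ++ r :: r :: y), q; split; first by rewrite e rcons_cat.
  by right; move=> h; apply: (h x r y).
have [es|sq] := eqVneq s q.
  move: eq; rewrite -es !ev_rcons => /mulIg ea; case: e0P => [|h]; first by rewrite -es -ea.
  by apply: h; exact: sqfree_ev sa.
have [j [w [mj ew]]] := right_lcm sq eq.
have j2 := cox_offdiag sq mj.
case: j => [|j] // in mj ew j2 *.
pose p := if odd j then s else q; pose p' := if odd j then q else s.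
have pp : p != p' by rewrite /p /p'; case: odd => //; rewrite eq_sym.
have mp : m p p' = Some j.+1 by rewrite /p /p'; case: odd => //; rewrite cox_sym.
have ep : ev (alternating s q j.+1) = ev (alternating p p' j.+1).
  by rewrite /p /p'; case: odd => //; exact: ev_alt.
have Eb : alternating p p' j.+1 = rcons (alternating p p' j) q.
  by rewrite alternating_rcons /p /p'; case: odd.
have Ea : alternating p' p j.+1 = rcons (alternating p' p j) s.
  by rewrite alternating_rcons /p /p'; case: odd.
have ea : ev a = ev (w ++ alternating p' p j).
  by move: ew; rewrite ev_cat ep (ev_alt pp mp) Ea -ev_cat -rcons_cat !ev_rcons => /mulIg.
have ee : ev e0 = ev (w ++ alternating p p' j).
  by move: ew; rewrite eq ev_cat ep Eb -ev_cat -rcons_cat !ev_rcons => /mulIg.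
(* If w ended in p, a full alternating word would appear at the end of a and could be rewritten to
   end in s. *)
have np : ~ rdiv (gen p) (ev w).
  case/rdiv_gen => w' ew'; apply: nd; apply/rdiv_gen.
  exists (w' ++ alternating p' p j); rewrite ea ev_cat ew' -ev_cat cat_rcons.
  by rewrite -/(alternating p p' j.+1) ev_cat (ev_alt pp mp) Ea -ev_cat rcons_cat.
have np' : ~ rdiv (gen p') (ev w).
  case/rdiv_gen => w' ew'; have j0 : 0 < j by [].
  apply: (sa w' p' (alternating p p' j.-1)).
  by rewrite ea -[in LHS](prednK j0) ev_cat ew' -ev_cat cat_rcons.
have sz : size a = (size w + j)%N by rewrite (ev_size ea) size_cat size_alternating.
have sw : sqfree w by apply: sqfree_catl; exact: sqfree_ev ea sa.
have chain i : i <= j -> sqfree (w ++ alternating p p' i).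
  elim: i => [|i IHi] ij; first by rewrite cats0.
  rewrite alternating_rcons -rcons_cat; apply: (IH _ _ _ (IHi (ltnW ij))).
    by rewrite size_cat size_alternating; move: le; rewrite sz; clear -ij; lia.
  by apply: (next_not_rdiv pp mp) => //; exact: ltnW.
case: e0P => [|h]; last by apply: h; exact: (sqfree_ev (esym ee) (chain j (leqnn _))).
have := @next_not_rdiv w p p' j j.+1 pp mp (leqnn _) np np'.
by rewrite ee /p /p'; case: odd.
Qed.
End SquareFree.

(** * Finiteness of the parabolic Coxeter group *)

Section Spherical.
Local Open Scope group_scope.
Variables (S : finType) (m : coxeter_matrix S).
Notation ev := (ev m).
Notation gen := (artin_gen m).
Notation rdiv := (@rdiv S m).
Notation cgen := (coxeter_gen m).
Implicit Types (s t : S) (a b c d u v w x y z : seq S) (X : {set S}).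

Definition cox w : coxeter_group m := \prod_(s <- w) cgen s.

Lemma coxE w : cox w = pres_class (coxeter_rel m) (positive_word w).
Proof.
elim: w => [|s w IH]; first exact: big_nil.
by rewrite /cox big_cons -/(cox w) IH [LHS]pres_mulE.
Qed.

Lemma cox_rcons w s : cox (rcons w s) = cox w * cgen s.
Proof. by rewrite /cox -cats1 big_cat big_seq1. Qed.

Lemma cgen_sq s : cgen s * cgen s = 1.
Proof.
transitivity (cox [:: s; s]); first by rewrite /cox big_cons big_seq1.
by rewrite coxE; apply/pres_classP/pres_rel/CoxeterSquare.
Qed.

Lemma cox_ev u v : ev u = ev v -> cox u = cox v.
Proof.
move=> /ev_eq uv; rewrite /cox -!word_eval_positive; apply: word_eval_cong uv.
move=> _ _ [s t k st e]; rewrite !word_eval_positive -!/(cox _) !coxE.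
by apply/pres_classP/pres_rel/CoxeterBraid/BraidRel.
Qed.

(** Let a = u v with v its final block in s and t. By induction u s and u t left divide d, hence so
    does u followed by the full alternating word; the block is shorter than the label, so v s is the
    start of that word. *)
Lemma prefix_rcons X d a s :
  {in X, forall s, exists2 v, {subset v <= X} & ev d = gen s * ev v} ->
  {subset a <= X} -> sqfree m a -> (exists c, ev d = ev (a ++ c)) -> s \in X ->
  ~ rdiv (gen s) (ev a) -> exists c, ev d = ev (rcons a s ++ c).
Proof.
move=> dX; have [n le] := ubnP (size a); elim: n a s le => // n IH a s le aX sa [c0 ec] sX nd.
case/lastP: a => [|a t] in le aX sa ec nd *.
  by have [v _ e] := dX s sX; exists v; rewrite e -ev_cons.
have tX : t \in X by apply: aX; rewrite mem_rcons mem_head.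
have [u [v [l [st vE l0 lj [e [squ uS]]]]]] := sqfree_last_block sa nd.
have su : size u < n.
  have := ev_size e; rewrite vE size_rcons size_cat size_rev size_alternating => sz.
  by move: le; rewrite size_rcons sz -{1}(prednK l0) addnS ltnS; apply: leq_trans; rewrite ltnS leq_addr.
have uX : {subset u <= X} by move=> y yu; apply: aX; rewrite (ev_mem e) mem_cat yu.
have pu : exists c, ev d = ev (u ++ c) by exists (v ++ c0); rewrite ec catA; exact: ev_catr.
have [c1 e1] := IH u s su uX squ pu sX (uS s (mem_head _ _)).
have [c2 e2] := IH u t su uX squ pu tX (uS t (mem_pair2 _ _)).
have /ev_catI/(left_lcm st)[j [w [mj ew]]] : ev (u ++ s :: c1) = ev (u ++ t :: c2).
  by rewrite -!cat_rcons -e1.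
have ed : ev d = ev (u ++ alternating s t j ++ w) by rewrite e1 cat_rcons; exact: ev_catl.
have := lj j mj => ljj.
have [w' ew'] : exists w', ev (alternating s t j ++ w) = ev (rcons v s ++ w').
  have -> : rcons v s = rev (alternating s t l.+1) by rewrite vE /= rev_cons.
  rewrite rev_alternating; case: ifP => _.
    by rewrite (alternating_take s t ljj) -catA; exists (drop l.+1 (alternating s t j) ++ w).
  exists (drop l.+1 (alternating t s j) ++ w); rewrite catA -alternating_take //.
  by apply: ev_catr; exact: ev_alt.
exists w'; rewrite ed (ev_catl u ew') catA -rcons_cat; apply: ev_catr.
by rewrite ev_rcons -e -ev_rcons.
Qed.

Lemma spherical_common_multiple X w : common_multiple X (ev w) -> spherical m X.
Proof.
move=> /garside_element[d [dX dcm _ _ dc]].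
have ld := left_garside dX dcm dc.
pose P (a : seq S) := [/\ {subset a <= X}, sqfree m a & exists c, ev d = ev (a ++ c)].
pose D : set (coxeter_group m) := [set h | exists2 a, P a & h = cox a]%classic.
have D1 : D 1.
  by exists [::]; rewrite ?[cox _]big_nil //; split=> //; [exact: sqfree_nil | exists d].
have Ds h s : D h -> s \in X -> D (h * cgen s).
  move=> [a [aX sa [c ec]] ->] sX.
  (* If a ends in s, multiplication by the involution s removes that letter; otherwise it extends a
     inside d. *)
  case: (pselect (rdiv (gen s) (ev a))) => [/rdiv_gen[b eb]|nd].
    exists b; last by rewrite (cox_ev eb) cox_rcons -mulgA cgen_sq mulg1.
    split.
    - by move=> y yb; apply: aX; rewrite (ev_mem eb) mem_rcons inE yb orbT.
    - by apply: (@sqfree_catl _ _ b [:: s]); rewrite cats1; exact: sqfree_ev sa.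
    - by exists (s :: c); rewrite ec -cat_rcons; exact: ev_catr.
  exists (rcons a s); last by rewrite cox_rcons.
  split.
  - by move=> y; rewrite mem_rcons inE => /orP[/eqP ->|/aX].
  - exact: sqfree_rcons.
  - by apply: (prefix_rcons ld) => //; exists c.
have Dfin : finite_set D.
  apply: (@sub_finite_set _ _ ((fun a : (size d).-bseq S => cox a) @` setT)%classic).
    move=> _ [a [aX sa [c ec]] ->].
    have sz : size a <= size d by rewrite (ev_size ec) size_cat leq_addr.
    by exists (Bseq sz).
  exact: finite_image.
apply: sub_finite_set Dfin => h.
(* The elements that preserve D under right multiplication together with their inverses form a group
   containing the generators from X; applied to 1 in D, this puts the whole subgroup into D. *)
move=> /(_ [set h | (forall k, D k -> D (k * h)) /\ (forall k, D k -> D (k * h^-1))]%classic) H.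
rewrite -[h]mul1g; apply: (proj1 (H _)) => //; split=> [|_ [s sX <-]]; last first.
  have e : (cgen s)^-1 = cgen s by apply: (@mulgI _ (cgen s)); rewrite mulgV cgen_sq.
  by split=> k kD; rewrite ?e; exact: Ds.
split; last by move=> a [a1 a2]; split=> k kD; rewrite ?invgK; auto.
split=> [|a b [a1 a2] [b1 b2]]; first by rewrite /= invg1; split=> k; rewrite mulg1.
by split=> k kD; rewrite ?invgM mulgA; auto.
Qed.
End Spherical.

(** * A bound on square-free words *)

Section Reduced.
Local Open Scope ring_scope.

Section LinearReflections.
Variables (V : finType) (adj : rel V).
Hypothesis (adjC : symmetric adj) (adjxx : irreflexive adj).
Notation vec := {ffun V -> int}.
Notation refl_word := (refl_word adj).

Lemma refl_word_coord w (b : vec) x :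
  refl_word w b x = \sum_v b v * refl_word w (simple v) x.
Proof.
have base (c : vec) y : c y = \sum_v c v * simple v y.
  rewrite (bigD1 y) //= ffunE eqxx mulr1 big1 ?addr0 // => v vy.
  by rewrite ffunE eq_sym (negPf vy) mulr0.
elim: w x => [|s w IH] x; first exact: base.
rewrite /= reflE IH.
have d : dot adj s (refl_word w b) = \sum_v b v * dot adj s (refl_word w (simple v)).
  rewrite /dot IH; under [X in _ - X]eq_bigr do rewrite IH.
  rewrite exchange_big /= -sumrMnl -sumrB; apply: eq_bigr => v _.
  by rewrite -mulrnAr mulrBr mulr_sumr.
case: (altP (x =P s)) => [->|xs].
  rewrite d -sumrB; apply: eq_bigr => v _.
  by rewrite reflE eqxx [RHS]mulrBr.
by rewrite subr0; apply: eq_bigr => v _; rewrite reflE (negPf xs) subr0.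
Qed.

Lemma refl_wordB w (b c : vec) : refl_word w (b - c) = refl_word w b - refl_word w c.
Proof.
apply/ffunP => x; rewrite !ffunE !(refl_word_coord w _ x) -sumrB.
by apply: eq_bigr => v _; rewrite !ffunE mulrBl.
Qed.

Lemma refl_wordN w (b : vec) : refl_word w (- b) = - refl_word w b.
Proof.
apply/ffunP => x; rewrite !ffunE !(refl_word_coord w _ x) -sumrN.
by apply: eq_bigr => v _; rewrite !ffunE mulNr.
Qed.

Lemma refl_word_inj w : injective (refl_word w).
Proof. by elim: w => // s w IH b c /= /(refl_inj adjxx)/IH. Qed.

Lemma refl_word_notin w (b : vec) x : x \notin w -> refl_word w b x = b x.
Proof.
elim: w => //= s w IH; rewrite inE negb_or reflE => /andP[/negPf -> /IH ->].
by rewrite subr0.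
Qed.

Lemma refl_word_ge0 w (b : vec) x :
  (forall v, 0 <= b v) -> (forall v, b v != 0 -> forall y, 0 <= refl_word w (simple v) y) -> 0 <= refl_word w b x.
Proof.
move=> b0 h; rewrite refl_word_coord; apply: sumr_ge0 => v _.
by case: (eqVneq (b v) 0) => [->|/h nb]; rewrite ?mul0r // mulr_ge0.
Qed.

(* The candidates for the positive roots killed by P_w. *)
Fixpoint inversions (w : seq V) : seq vec :=
  if w is s :: w' then simple s :: [seq refl adj s b | b <- inversions w'] else [::].

Lemma size_inversions w : size (inversions w) = size w.
Proof. by elim: w => //= s w IH; rewrite size_map IH. Qed.

Lemma not_live_inversions w (b : vec) : posroot adj b -> ~ live adj w b -> b \in inversions w.
Proof.
elim: w b => [|s w IH] b rb nl; first by case: nl; exact: live_nil.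
rewrite inE; case: (altP (b =P simple s)) => //= nb; apply/mapP.
exists (refl adj s b); last by rewrite reflK.
apply: IH; first exact: posroot_refl.
by move=> l; apply: nl; apply: (@live_cat _ _ [:: s] w b (refl adj s b)) => //; exact: hits_refl.
Qed.
End LinearReflections.

Section ReducedWords.
Variables (S : finType) (m : coxeter_matrix S) (k : nat).
Hypothesis k_gt1 : (1 < k)%N.
Local Notation adj := (@fadj S m k).
Local Notation V := (vertex m k).
Notation expand := (expand m k).

Lemma mem_expand (u : seq S) (v : V) : (v \in expand u) = (v.1 \in u).
Proof. by elim: u => //= a u IH; rewrite -[expand _]/(fiber m k a ++ expand u) mem_cat mem_fiber IH inE. Qed.

Lemma refl_word_fiber s (b : {ffun V -> int}) :
  refl_word adj (fiber m k s) b = [ffun v => if v.1 == s then b v - dot adj v b else b v].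
Proof.
rewrite (refl_word_orthogonal (@fadjxx S m k)) ?fiber_uniq //; last exact: fiber_orth.
by apply/ffunP => v; rewrite !ffunE mem_fiber.
Qed.

Lemma refl_word_ev u v (b : {ffun V -> int}) : ev m u = ev m v ->
  refl_word adj (expand u) b = refl_word adj (expand v) b.
Proof. by move/(expand_cong k_gt1); exact: (@refl_word_cong V adj (@fadjC S m k) (@fadjxx S m k)). Qed.

(** The counterpart of the fact that w sends the simple root of s to a positive root when w s is
    longer than w. The final dihedral block yields a nonnegative combination of simple roots above s
    and t, and the induction applies to the prefix before it. *)
Lemma reduced_refl_ge0 (a : seq S) s i (x : V) : (size a < k)%N -> sqfree m a ->
  ~ rdiv (artin_gen m s) (ev m a) -> 0 <= refl_word adj (expand a) (simple ((s, i) : V)) x.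
Proof.
have [n le] := ubnP (size a); elim: n a s i x le => // n IH a s i x le ak sa nd.
case/lastP: a => [|a t] in le ak sa nd *; first by rewrite ffunE; case: eqP.
have [u [v [l [st vE l0 lj [e [squ uS]]]]]] := sqfree_last_block sa nd.
have sz := ev_size e; rewrite size_cat in sz.
have lv : size v = l by rewrite vE size_rev size_alternating.
have ts : t != s by rewrite eq_sym.
have lM : (l < mk m k t s)%N.
  by rewrite mk_sym /mk; case mj : (m s t) => [j|]; [exact: lj | move: ak; rewrite sz -lv; lia].
rewrite (refl_word_ev _ e) expand_cat refl_word_cat; apply: refl_word_ge0.
  by move=> y; rewrite vE; apply: alternating_refl_ge0.
move=> y ny z; have yst : y.1 \in [:: s; t].
  rewrite !inE; apply: contraNT ny; rewrite negb_or => /andP[ys yt].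
  rewrite refl_word_notin; first by rewrite ffunE; apply/eqP; case: eqP => // ye; rewrite ye eqxx in ys.
  by rewrite mem_expand vE mem_rev; apply/negP => /alternating_sub; rewrite !inE (negPf ys) (negPf yt).
case: y yst {ny} => y j /= yst; apply: IH.
- by move: le; rewrite sz lv; lia.
- by move: ak; rewrite sz lv; lia.
- exact: squ.
- exact: uS.
Qed.
End ReducedWords.
End Reduced.

(** * Small orbits and the length of square-free words *)

Section Orbits.
Local Open Scope ring_scope.
Variables (S : finType) (m : coxeter_matrix S) (k : nat).
Hypothesis k_gt2 : (2 < k)%N.
Let k_gt1 : (1 < k)%N := ltnW k_gt2.
Local Notation adj := (@fadj S m k).
Local Notation V := (vertex m k).
Notation idx := {ffun S * S -> 'I_(modulus m k).-1.+1}.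
Notation vec := {ffun V -> int}.
Notation expand := (expand m k).
Notation fiber := (fiber m k).
Notation refl_word := (refl_word adj).
Variable X : {set S}.

(* b lies in a set of at most n vectors that is stable under the parabolic subgroup W_X. *)
Definition small_orbit n (b : vec) := exists L : seq vec,
  [/\ (size L <= n)%N, b \in L & {in X, forall s, {in L, forall c, refl_word (fiber s) c \in L}}].

Lemma small_orbit_sub n (b : vec) s : small_orbit n b -> s \in X ->
  small_orbit (n * n) (refl_word (fiber s) b - b).
Proof.
move=> [L [sL bL cL]] sX; exists [seq c - d | c <- L, d <- L]; split.
- by rewrite size_allpairs leq_mul.
- by apply: allpairs_f => //; exact: cL.
- move=> r rX _ /allpairsP[[c d] /= [cLL dL ->]]; rewrite refl_wordB.
  by apply: allpairs_f; exact: cL.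
Qed.

Definition above s (b : vec) :=
  [/\ forall v, 0 <= b v, forall v, v.1 != s -> b v = 0 & exists i, b (s, i) != 0].

(** A label other than 2 gives paths with at least two vertices, so each vertex has a neighbour on
    its path; for an infinite label this is where 2 < k enters. *)
Lemma fiber_neighbor s u i : s != u -> m s u <> Some 2 ->
  exists j, adj ((u, j) : V) (s, i).
Proof.
move=> su m2; pose q := upair s u; pose M := plen m k s u.
have M1 : (1 < M)%N.
  rewrite /M /plen /mk; case e : (m s u) => [[|[|[|j]]]|] //=; last by move: k_gt2; lia.
  - by have := cox_offdiag su e.
  - by have := cox_offdiag su e.
pose x0 := (i q %% M)%N; have x0M : (x0 < M)%N by rewrite ltn_pmod // ltnW.
have pE e : odd x0 (+) e = false -> path_vertex s u i e x0 = (s, i) :> V.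
  by move=> pe; rewrite /path_vertex pe /= /x0 shift_idx_self.
have nE e z : odd z (+) e = true -> exists j, path_vertex s u i e z = (u, j) :> V.
  by move=> pe; rewrite /path_vertex pe; eexists.
have pe : odd x0 (+) odd x0 = false by rewrite addbb.
case: (leqP x0.+2 M) => [lt|ge].
  have [|j ej] := nE (odd x0) x0.+1; first by rewrite /= addNb addbb.
  by exists j; rewrite -ej -(pE _ pe) fadjC; exact: path_adjS.
have x1 : (0 < x0)%N by lia.
have [|j ej] := nE (odd x0) x0.-1; first by rewrite -{2}(prednK x1) /= addbN addbb.
exists j; rewrite -ej -(pE _ pe); have := @path_adjS S m k k_gt1 s u su i (odd x0) x0.-1.
by rewrite (prednK x1) => /(_ x0M).
Qed.

(** Since b vanishes above u, the reflections above u add there the sums over the neighbours, so the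
    difference with b lies above u. Differences of vectors from a stable set of size n form a stable
    set of size at most n * n. *)
Lemma above_step n (b : vec) s u : small_orbit n b -> above s b -> u \in X -> s != u ->
  m s u <> Some 2 -> exists c, small_orbit (n * n) c /\ above u c.
Proof.
move=> ob [b0 bs [i bi]] uX su m2; exists (refl_word (fiber u) b - b).
split; first exact: small_orbit_sub.
have E v : (refl_word (fiber u) b - b) v = if v.1 == u then \sum_(w | adj v w) b w else 0.
  rewrite !ffunE refl_word_fiber ffunE; case: ifP => [/eqP vu|_]; last by rewrite subrr.
  have bv : b v = 0 by apply: bs; rewrite vu eq_sym.
  by rewrite /dot bv mul0rn !sub0r opprK subr0.
split.
- by move=> v; rewrite E; case: ifP => // _; apply: sumr_ge0.
- by move=> v /negPf vu; rewrite E vu.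
have [j aj] := fiber_neighbor i su m2; exists j; rewrite E eqxx.
rewrite (bigD1 ((s, i) : V)) //=; apply: lt0r_neq0.
apply: ltr_wpDr; first exact: sumr_ge0.
by rewrite lt0r bi b0.
Qed.

Definition bonded s u := [&& u \in X, s != u & m s u != Some 2].

Lemma above_path n (b : vec) s p : small_orbit n b -> above s b -> path bonded s p ->
  exists c, small_orbit (iter (size p) (fun x => x * x)%N n) c /\ above (last s p) c.
Proof.
elim: p n b s => [|u p IH] n b s ob ab; first by exists b.
move=> /= /andP[/and3P[uX su /eqP m2] pp].
have [c [oc ac]] := above_step ob ab uX su m2.
by have := IH _ _ _ oc ac pp; rewrite -iterSr.
Qed.

Lemma iter_sq_leq i j n : (0 < n)%N -> (i <= j)%N ->
  (iter i (fun x => x * x)%N n <= iter j (fun x => x * x)%N n)%N.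
Proof.
move=> n0 /subnK <-; elim: (j - i)%N => // d IH; apply: leq_trans IH _.
rewrite addSn /=; case: (iter _ _ _) => // a; exact: leq_pmulr.
Qed.

Lemma above_connect n (b : vec) s u : (0 < n)%N -> small_orbit n b -> above s b ->
  connect bonded s u -> exists c, small_orbit (iter #|S| (fun x => x * x)%N n) c /\ above u c.
Proof.
(* A path without repetition has fewer steps than there are generators, which makes the number of
   squarings uniform. *)
move=> n0 ob ab /connectP[p0 pp0 ->]; case/shortenP: pp0 => p pp up _.
have [c [[L [sL cL hL]] ac]] := above_path ob ab pp; exists c; split=> //.
exists L; split=> //; apply: leq_trans sL _; apply: iter_sq_leq => //.
have := card_uniqP up; rewrite /= => e; apply: leq_trans (leqnSn _) _.
by rewrite -e; exact: max_card.
Qed.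

(* The vectors of the stable set attached to the letter s, pulled back along the prefixes of a
   square-free word, are pairwise different: this bounds the length of the word. *)
Lemma sqfree_size n (K : {set S}) (a : seq S) : K \subset X ->
  {in K, forall u, exists c, small_orbit n c /\ above u c} ->
  sqfree m a -> {subset a <= K} -> (size a < k)%N -> (size a <= #|S| * n)%N.
Proof.
move=> KX KO sa aK ak.
pose P u (p : vec * seq vec) := u \in K ->
   [/\ (size p.2 <= n)%N, p.1 \in p.2,
     {in X, forall s, {in p.2, forall c, refl_word (fiber s) c \in p.2}} & above u p.1].
have [f fP] : {f : S -> vec * seq vec & forall u, P u (f u)}.
  apply: choice => u; case: (boolP (u \in K)) => [uK|nuK].
    by have [c [[L [h1 h2 h3]] ac]] := KO u uK; exists (c, L).
  by exists (0, [::]) => uK; rewrite uK in nuK.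
have closed u w c : u \in K -> {subset w <= X} -> c \in (f u).2 -> refl_word (expand w) c \in (f u).2.
  move=> uK; have [_ _ h _] := fP u uK; elim: w => // s w IH wX cL.
  rewrite -[expand _]/(fiber s ++ expand w) refl_word_cat; apply: h; first exact: wX (mem_head _ _).
  by apply: IH => // y yw; apply: wX; rewrite inE yw orbT.
case: (posnP (size a)) => [->//|a0].
have [s0 _] : exists s0 : S, true by case: (a) a0 => // s0 *; exists s0.
pose g i := (nth s0 a i, refl_word (expand (take i a)) (f (nth s0 a i)).1).
pose T := [seq (u, c) | u <- enum K, c <- (f u).2].
have nK i : (i < size a)%N -> nth s0 a i \in K by move=> ia; apply/aK/mem_nth.
have gT i : (i < size a)%N -> g i \in T.
  move=> ia; apply/allpairsPdep; exists (nth s0 a i), (g i).2; split=> //.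
    by rewrite mem_enum nK.
  apply: closed; first exact: nK.
    by move=> y /mem_take /aK; exact: (fintype.subsetP KX).
  by have [] := fP _ (nK i ia).
have ginj i j : (i < j)%N -> (j < size a)%N -> g i <> g j.
  move=> ij ja [e1]; rewrite -e1; set u := nth s0 a i; set c := (f u).1 => e2.
  have ia := ltn_trans ij ja; have [_ _ _ [c0 cs [q cq]]] := fP u (nK i ia).
  pose mid := drop i.+1 (take j a).
  have tj : take j a = take i a ++ u :: mid.
    rewrite -[LHS](cat_take_drop i) take_takel ?(ltnW ij) //; congr (_ ++ _).
    rewrite (drop_nth s0) ?size_take ?ja // nth_take //.
  have aj : a = take i a ++ rcons (u :: mid) u ++ drop j.+1 a.
    by rewrite catA -rcons_cat -tj /u e1 -take_nth // cat_take_drop.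
  have smu : sqfree m (rcons mid u).
    move: sa; rewrite {1}aj => /sqfree_catr; rewrite rcons_cons -cat1s -catA => /sqfree_catr/sqfree_catl.
    exact.
  have smk : (size mid < k)%N.
    by apply: leq_ltn_trans ak; rewrite size_drop size_take ja; lia.
  have sqm : sqfree m mid by apply: (@sqfree_catl _ _ _ [:: u]); rewrite cats1.
  (* The word [rcons mid u] is square-free, so [mid] has no right divisor u and keeps the simple
     roots above u nonnegative. *)
  have ge0 : 0 <= refl_word (expand mid) c ((u, q) : V).
    apply: refl_word_ge0 => // y ny z; have yu : y.1 = u by apply/eqP; apply: contraNT ny => /cs ->.
    by case: y yu {ny} => y j' /= ->; apply: reduced_refl_ge0 => //; exact: sqfree_not_rdiv.
  (* The vertices above u are pairwise not adjacent and c is supported on them, so the fiber of u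
     negates c. Cancelling the common prefix in the equality of the two vectors leaves this
     identity. *)
  have : refl_word (expand mid) c = - c.
    apply: (@refl_word_inj V adj (@fadjxx S m k) (fiber u)); rewrite refl_wordN.
    have -> : refl_word (fiber u) c = - c.
      apply/ffunP => v; rewrite refl_word_fiber !ffunE; case: ifP => [/eqP vu|/negbT/cs ->]; last by rewrite oppr0.
      rewrite /dot big1 ?subr0; last by move=> w vw; apply: cs; have := fadj_neq vw; rewrite vu eq_sym.
      by rewrite mulr2n opprD addrA subrr sub0r.
    rewrite opprK; apply: (@refl_word_inj V adj (@fadjxx S m k) (expand (take i a))).
    rewrite [RHS]e2 tj expand_cat refl_word_cat.
    by rewrite -[expand (u :: mid)]/(fiber u ++ expand mid) refl_word_cat.
  move=> h; move: ge0; rewrite h ffunE oppr_ge0 => le0; move: cq.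
  by rewrite -/u -/c eq_le le0 c0.
have uq : uniq [seq g i | i <- iota 0 (size a)].
  rewrite map_inj_in_uniq ?iota_uniq // => i j; rewrite !mem_iota /= !add0n => ia ja e.
  by case: (ltngtP i j) => // lt; [case: (ginj i j lt ja) | case: (ginj j i lt ia)].
have : (size [seq g i | i <- iota 0 (size a)] <= size T)%N.
  by apply: uniq_leq_size => // x /mapP[i + ->]; rewrite mem_iota => /andP[_ ia]; exact: gT.
rewrite size_map size_iota => /leq_trans; apply; rewrite size_allpairs_dep.
apply: (@leq_trans (sumn [seq n | _ <- enum K])).
  have : {subset enum K <= K} by move=> y; rewrite mem_enum.
  elim: (enum K) => //= u r IH h; apply: leq_add.
    by have [] := fP u (h u (mem_head _ _)).
  by apply: IH => y yr; apply: h; rewrite inE yr orbT.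
have -> : sumn [seq n | _ <- enum K] = (#|K| * n)%N.
  by rewrite cardE; elim: (enum K) => //= _ r ->; rewrite mulSn.
by rewrite leq_mul2r max_card orbT.
Qed.

(* Every simple root above t is killed by P_r, and so is its orbit under W_X; as r kills at most one
   root per letter, some root above t has an orbit of size at most the length of r. *)
Lemma small_orbit_exists (r : seq S) t : t \notin X ->
  {in X, forall x, exists y, ev m (x :: r) = ev m (rcons r y)} ->
  (exists r', ev m r = ev m (t :: r')) -> exists b, small_orbit (size r) b /\ above t b.
Proof.
move=> tX Xr [r' er].
pose P j (b : vec) := [/\ posroot adj b, ~ live adj (expand r) b & forall i, b (t, i) = (i == j)%:R].
pose NB := undup (inversions adj (expand r)).
pose N (j : idx) := [seq b <- NB | `[< P j b >]].
have memN j b : b \in N j <-> P j b.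
  split; first by rewrite mem_filter => /andP[/asboolP].
  move=> Pb; rewrite mem_filter; apply/andP; split; first exact/asboolP.
  by case: Pb => rb nl _; rewrite mem_undup; exact: (not_live_inversions (@fadjC S m k) (@fadjxx S m k)).
(* The classes [N j] are pairwise disjoint and lie in a list of at most [#|{: idx}| * size r] roots.
   There are [#|{: idx}|] of them, so this factor, which depends on k, cancels. *)
have [j sj] : exists j, (size (N j) <= size r)%N.
  apply: contrapT => no.
  have h j : (size r < size (N j))%N by rewrite ltnNge; apply/negP => le; apply: no; exists j.
  have sNB : (size NB <= #|{: idx}| * size r)%N.
    apply: leq_trans (size_undup _) _; rewrite size_inversions.
    have -> : size (expand r) = (#|{: idx}| * size r)%N; last by [].
    elim: (r) => [|s w IH]; first by rewrite muln0.
    by rewrite -[expand _]/(fiber s ++ expand w) size_cat IH size_map -cardE mulnS.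
  have : (\sum_(j : idx) size (N j) <= size NB)%N.
    rewrite -[X in (_ <= X)%N]sum1_size.
    have sN j : size (N j) = (\sum_(b <- NB) (if `[< P j b >] then 1 else 0))%N.
      by rewrite size_filter -sum1_count big_mkcond.
    rewrite (eq_bigr _ (fun j _ => sN j)).
    rewrite exchange_big /=; apply: leq_sum => b _.
    case: (pselect (exists j, P j b)) => [[j Pj]|nj].
      rewrite (bigD1 j) //= big1; first by case: ifP.
      move=> j' jj'; case: asboolP => // -[_ _ /(_ j)]; case: Pj => _ _ /(_ j) ->.
      by rewrite eqxx eq_sym (negPf jj').
    by rewrite big1 // => j _; case: asboolP => // Pj; case: nj; exists j.
  have : (\sum_(j : idx) (size r).+1 <= \sum_(j : idx) size (N j))%N by apply: leq_sum.
  rewrite sum_nat_const mulnS => h1 h2; have := leq_trans h1 (leq_trans h2 sNB).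
  rewrite -[X in (_ <= X)%N]add0n leq_add2r leqn0 => /eqP/card0_eq/(_ [ffun=> ord0]).
  by rewrite inE.
exists (simple ((t, j) : V)); split.
  exists (N j); split=> //.
    apply/memN; split; first exact: posroot_simple.
      by move=> /(live_ev k_gt1 er); exact: not_live_fiber.
    by move=> i; rewrite ffunE xpair_eqE eqxx.
  move=> s sX b /memN[rb nl bt]; have st : s != t by apply: contraNneq tX => <-.
  have tf i : ((t, i) : V) \notin fiber s by rewrite mem_fiber /= eq_sym.
  have [hb rb'] : hits adj (fiber s) b (refl_word (fiber s) b) /\ posroot adj (refl_word (fiber s) b).
    apply: (hits_orthogonal (@fadjC S m k) (@fadjxx S m k)) => //; first exact: fiber_uniq.
    - exact: fiber_orth.
    - move=> v vs; apply/eqP => e; have := bt j; rewrite e ffunE eqxx.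
      by case: eqP => // tv; move: (tf j); rewrite tv vs.
    - by move=> v vs; rewrite refl_word_notin.
    - by move=> v; rewrite mem_fiber => vs; left; rewrite refl_word_fiber ffunE vs.
  apply/memN; split=> // [l|i]; last by rewrite refl_word_notin.
  (* If the reflected root survived r, then b would survive s r = r y, hence r. *)
  have [y e] := Xr s sX; apply: nl.
  have : live adj (expand (s :: r)) b.
    by rewrite -[expand _]/(fiber s ++ expand r); exact: live_cat hb l.
  by move=> /(live_ev k_gt1 e); rewrite -cats1 expand_cat => /live_catl.
split.
- by move=> v; rewrite ffunE; case: eqP.
- by move=> v vt; rewrite ffunE; case: eqP => // e; rewrite e eqxx in vt.
- by exists j; rewrite ffunE eqxx.
Qed.
End Orbits.

(** * From bounded square-free words to a common multiple *)

Section CommonMultiple.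
Variables (S : finType) (m : coxeter_matrix S).

(** A longest square-free word over K is divisible by every s in K, since [sqfree_rcons] would
    otherwise extend it. *)
Lemma bounded_sqfree_common_multiple (K : {set S}) n :
  (forall a, sqfree m a -> {subset a <= K} -> size a <= n) -> exists w, common_multiple K (ev m w).
Proof.
move=> bd; pose P l := `[< exists a, [/\ sqfree m a, {subset a <= K} & size a = l] >].
have P0 : exists l, P l by exists 0; apply/asboolP; exists [::]; split=> //; exact: sqfree_nil.
have Pn l : P l -> l <= n by move=> /asboolP[a [sa aK <-]]; exact: bd.
case: (ex_maxnP P0 Pn) => l /asboolP[a [sa aK <-]] mx; exists a => s sK.
apply: contrapT => nd; have := mx (size a).+1; rewrite ltnn => h.
have /h // : P (size a).+1; apply/asboolP; exists (rcons a s); split.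
- exact: sqfree_rcons.
- by move=> y; rewrite mem_rcons inE => /orP[/eqP ->|/aK].
- by rewrite size_rcons.
Qed.

(* The bound on square-free words does not depend on the label k that replaces infinity, which can
   therefore be chosen larger than the bound. *)
Lemma ribbon_common_multiple (X K : {set S}) t r : t \notin X -> K \subset X ->
  {in X, forall x, exists y, ev m (x :: r) = ev m (rcons r y)} ->
  (exists r', ev m r = ev m (t :: r')) ->
  {in K, forall u, connect (bonded m X) t u} -> exists w, common_multiple K (ev m w).
Proof.
move=> tX KX Xr tr tK.
(* The bound B is free of k, so k can be chosen above B + 1 to make the bound applicable to words of
   length B + 1; the choice also gives 2 < k. *)
pose n := iter #|S| (fun x => x * x) (size r); pose B := #|S| * n; pose k := B.+3.
have k2 : 2 < k by [].
have r0 : 0 < size r by case: tr => r' /ev_size ->.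
have [b [ob ab]] := @small_orbit_exists S m k k2 X r t tX Xr tr.
have KO : {in K, forall u, exists c, @small_orbit S m k X n c /\ above u c}.
  by move=> u uK; exact: (above_connect k2 r0 ob ab (tK u uK)).
have bd a : sqfree m a -> {subset a <= K} -> size a < k -> size a <= B.
  by move=> sa aK ak; exact: (sqfree_size k2 KX KO).
apply: (@bounded_sqfree_common_multiple K B) => a sa aK.
rewrite leqNgt; apply/negP => lt.
have sz : size (take B.+1 a) = B.+1 by rewrite size_takel.
have : size (take B.+1 a) <= B.
  apply: bd; last by rewrite sz.
  - by apply: (@sqfree_catl _ _ _ (drop B.+1 a)); rewrite cat_take_drop.
  - by move=> y /mem_take; exact: aK.
by rewrite sz ltnn.
Qed.
End CommonMultiple.

(** * Ribbons *)

Section DihedralWords.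
Local Open Scope group_scope.
Variables (S : finType) (m : coxeter_matrix S).
Notation ev := (ev m).
Notation gen := (artin_gen m).
Notation rdiv := (@rdiv S m).
Implicit Types (s t p q : S) (a b c d u v w x y z : seq S).

Definition braid_free s t u := forall j, m s t = Some j -> no_alternating s t j u.

(** At the first letter where two such words differ, [left_lcm] would produce a full alternating
    word; by induction it would occur literally in u. *)
Lemma braid_free_uniq s t u v : s != t -> {subset u <= [:: s; t]} -> {subset v <= [:: s; t]} ->
  braid_free s t u -> ev u = ev v -> u = v.
Proof.
move=> st; elim: u v => [|p u IH] [|q v] uS vS nu e; try by have := ev_size e.
have nu' : braid_free s t u.
  by move=> j mj; apply: (@no_alternating_catr _ _ _ _ [:: p]); exact: nu.
have uS' : {subset u <= [:: s; t]} by move=> y yu; apply: uS; rewrite inE yu orbT.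
have vS' : {subset v <= [:: s; t]} by move=> y yv; apply: vS; rewrite inE yv orbT.
have [pq|pq] := eqVneq p q.
  by rewrite -{}pq in e *; rewrite (IH v) //; exact: ev_consI e.
have [j [w [mj ew]]] := left_lcm pq e.
have pst : (p, q) = (s, t) \/ (p, q) = (t, s).
  have := uS p (mem_head _ _); have := vS q (mem_head _ _); rewrite !inE => /orP[]/eqP eq /orP[]/eqP ep;
    move: pq; rewrite eq ep ?eqxx //; by [left|right].
have mst : m s t = Some j by case: pst => -[<- <-] //; rewrite cox_sym.
have j2 := cox_offdiag pq mj; case: j => [|j] // in mj mst ew j2 *.
have wS : {subset w <= [:: s; t]}.
  by move=> y yw; apply: uS; rewrite (ev_mem ew) mem_cat yw orbT.
have uE : u = alternating q p j ++ w.
  apply: IH => //; last exact: ev_consI ew.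
  move=> y; rewrite mem_cat => /orP[/alternating_sub|/wS //].
  by case: pst => -[-> ->]; rewrite !inE // orbC.
have [h1 h2] := nu _ mst [::] w; exfalso.
by case: pst uE h1 h2 => -[-> ->] -> h1 h2; [case: h1 | case: h2].
Qed.

Lemma alternating_back s t j b : s != t -> m s t = Some j -> {subset b <= [:: s; t]} ->
  exists b', ev (alternating s t j ++ b) = ev (b' ++ alternating s t j).
Proof.
move=> st mj bS; have [|a e] := alternating_front st mj (a := rev b).
  by move=> y; rewrite mem_rev; exact: bS.
exists (rev a); rewrite -[X in ev X = _]revK rev_cat.
have -> : ev (rev (rev b ++ rev (alternating s t j))) = ev (rev (rev b ++ alternating s t j)).
  by apply: ev_rev; apply: ev_catl; exact: ev_rev_alt.
by rewrite (ev_rev e) rev_cat; apply: ev_catl; exact: ev_rev_alt.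
Qed.

(** A full alternating factor could be moved to the end of the word and rewritten to end in r. *)
Lemma braid_free_not_rdiv s t r v : s != t -> r \in [:: s; t] -> {subset v <= [:: s; t]} ->
  ~ rdiv (gen r) (ev v) -> braid_free s t v.
Proof.
move=> st rS vS nd j mj.
have h p q a b : ev (alternating p q j) = ev (alternating s t j) -> v <> a ++ alternating p q j ++ b.
  move=> epq e; have bS : {subset b <= [:: s; t]} by move=> y yb; apply: vS; rewrite e !mem_cat yb !orbT.
  apply: nd; have [b' eb] := alternating_back st mj bS; have [c _ ec] := alternating_last st mj rS.
  apply/rdiv_gen; exists (a ++ b' ++ c); rewrite e.
  by rewrite (ev_catl a (ev_catr b epq)) (ev_catl a eb) !rcons_cat !ev_cat ec.
by move=> a b; split; apply: h => //; rewrite (ev_alt st mj).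
Qed.

Lemma mem_alternating s t j : (1 < j)%N -> (s \in alternating s t j) && (t \in alternating s t j).
Proof. by case: j => [|[|j]] //= _; rewrite !inE !eqxx orbT. Qed.

Lemma rcons_cons_nseq (T : eqType) (c k : T) h : rcons h c = k :: h -> h = nseq (size h) c.
Proof.
elim: h k => // y h IH k; rewrite rcons_cons => -[_ e].
have hE := IH _ e; rewrite [size _]/= [nseq _ _]/= -hE; congr (_ :: _).
by move: e; rewrite hE; case: (size h) => [|n] /= [].
Qed.

Lemma factor_rcons (T : Type) (h a f b : seq T) (x : T) : rcons h x = a ++ f ++ b ->
  (exists b' : seq T, h = a ++ f ++ b') \/ rcons h x = a ++ f.
Proof.
case/lastP: b => [|b y]; first by rewrite cats0; right.
by rewrite -!rcons_cat => /rcons_inj[-> _]; left; exists b.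
Qed.

(** If x did not divide h, then h, h c and h x would each be the only word of its element. Then h c
    = k h makes h a power of c, and h x = z h has last letters x and c. The label being at least 3
    keeps h x free of full alternating factors. *)
Lemma dihedral_conj (x c : S) (h : seq S) : x != c -> m x c <> Some 2 -> {subset h <= [:: x; c]} ->
  {in [:: x; c], forall z : S, exists2 z' : S, z' \in [:: x; c] & ev (rcons h z) = ev (z' :: h)} ->
  rdiv (gen c) (ev h) -> rdiv (gen x) (ev h).
Proof.
move=> xc m2 hS hc cd; apply: contrapT => nx.
have xS : x \in [:: x; c] by rewrite mem_head.
have cS : c \in [:: x; c] by rewrite !inE eqxx orbT.
have rS (h' : seq S) (z : S) : {subset h' <= [:: x; c]} -> z \in [:: x; c] -> {subset rcons h' z <= [:: x; c]}.
  by move=> h'S zS y; rewrite mem_rcons inE => /orP[/eqP ->|/h'S].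
have cnS (z : S) (h' : seq S) : {subset h' <= [:: x; c]} -> z \in [:: x; c] -> {subset z :: h' <= [:: x; c]}.
  by move=> h'S zS y; rewrite inE => /orP[/eqP ->|/h'S].
have nh := braid_free_not_rdiv xc xS hS nx.
have [h1 e1] : exists h1 : seq S, h = rcons h1 c.
  case/rdiv_gen: cd => h1 e; exists h1; apply: (braid_free_uniq xc) (e) => //.
  by move=> y yh; apply: hS; rewrite (ev_mem e).
have nhc : braid_free x c (rcons h c).
  move=> j mj; have j2 := cox_offdiag xc mj.
  have sq p q a : p != q -> rcons h c <> a ++ alternating p q j.
    move=> pq; case: j j2 {mj} => [|[|j]] // _; rewrite e1 !alternating_rcons -!rcons_cat.
    by move=> /rcons_inj[/rcons_inj[_ ->]] /=; case: odd => e; move: pq; rewrite e eqxx.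
  move=> a b; have [n1 n2] := nh _ mj a b.
  split=> e; case: (factor_rcons e) => [[b' e']|].
  - by have [n3 _] := nh _ mj a b'.
  - exact: sq.
  - by have [_ n3] := nh _ mj a b'.
  - by apply: sq; rewrite eq_sym.
have [k kS ek] := hc c cS.
have hE := rcons_cons_nseq (braid_free_uniq xc (rS _ _ hS cS) (cnS _ _ hS kS) nhc ek).
have xh : x \notin h by rewrite hE mem_nseq (negPf xc) andbF.
have nhx : braid_free x c (rcons h x).
  move=> j mj; have j2 := cox_offdiag xc mj; have j3 : (2 < j)%N.
    by move: m2; rewrite mj; case: (j) j2 => [|[|[|j']]].
  have mem p q i : (p, q) = (x, c) \/ (p, q) = (c, x) -> (1 < i)%N -> x \in alternating p q i.
    by move=> pq i1; have /andP[hp hq] := mem_alternating p q i1; case: pq hp hq => -[-> ->].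
  have no p q a b : (p, q) = (x, c) \/ (p, q) = (c, x) -> rcons h x <> a ++ alternating p q j ++ b.
    move=> pq e; case: (factor_rcons e) => [[b' e']|].
      by move/negP: xh; apply; rewrite e' !mem_cat mem ?orbT.
    case: (j) j3 => // j' j3'; rewrite alternating_rcons -rcons_cat => /rcons_inj[e' _].
    by move/negP: xh; apply; rewrite e' mem_cat mem ?orbT.
  by move=> a b; split; apply: no; [left|right].
have [z zS ez] := hc x xS.
have := braid_free_uniq xc (rS _ _ hS xS) (cnS _ _ hS zS) nhx ez.
move/(congr1 (last z)); rewrite last_rcons /= e1 last_rcons => e.
by move: xc; rewrite e eqxx.
Qed.

(* Both sides of g z = y g have the same tail with respect to {x, c}. *)
Lemma conj_rdiv_step (x c : S) w : x != c -> m x c <> Some 2 ->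
  {in [:: x; c], forall z : S, exists y : S, ev w * gen z = gen y * ev w} ->
  rdiv (gen c) (ev w) -> rdiv (gen x) (ev w).
Proof.
move=> xc m2 wc cd; have [u [h [e hS uS]]] := tail_exists m [set x; c] w.
have memE : [set x; c] =i [:: x; c] by move=> y; rewrite !inE.
have hS' : {subset h <= [:: x; c]} by move=> y /hS; rewrite memE.
have ch : rdiv (gen c) (ev h).
  rewrite -ev1; apply: (tail_rdiv uS hS); last by rewrite -e ev1.
  by move=> y; rewrite !inE => /eqP ->; rewrite eqxx orbT.
suff xh : rdiv (gen x) (ev h) by apply: rdiv_trans xh _; rewrite e ev_cat; exact: rdiv_mull.
apply: (@dihedral_conj x c) => // z zS; have [y ey] := wc z zS.
have ezy : ev (u ++ rcons h z) = ev (y :: u ++ h).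
  by rewrite -rcons_cat ev_rcons -e ey ev_cons e.
have [u' [v' [e' vS uS']]] := tail_exists m [set x; c] (y :: u).
have hzS : {subset rcons h z <= [set x; c]}.
  by move=> r; rewrite mem_rcons inE => /orP[/eqP ->|/hS //]; rewrite memE.
have vhS : {subset v' ++ h <= [set x; c]} by move=> r; rewrite mem_cat => /orP[/vS|/hS].
have ezv : ev (u ++ rcons h z) = ev (u' ++ v' ++ h).
  by rewrite ezy -cat_cons (ev_catr h e') catA.
have ehz : ev (rcons h z) = ev (v' ++ h).
  apply: rdiv_anti.
    by apply: (tail_rdiv uS') => //; rewrite -ezv ev_cat; exact: rdiv_mull.
  by apply: (tail_rdiv uS) => //; rewrite ezv; apply/rdivE; exists u'.
have := ev_size ehz; rewrite size_rcons size_cat; case: v' vS vhS ehz {e' ezv} => [|z' [|? ?]] //= vS vhS ehz.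
- by lia.
- by exists z' => //; rewrite -memE; apply: vS; rewrite mem_head.
- by rewrite !addSn => -[]; clear; lia.
Qed.
End DihedralWords.

(** * Indecomposable components *)

Section Components.
Local Open Scope group_scope.
Variables (S : finType) (m : coxeter_matrix S).
Implicit Types (T C U : {set S}) (s t u c : S).

Lemma component_sub T C : indec_component m T C -> C \subset T.
Proof. by move=> /maxsetp/andP[]. Qed.
Lemma component_indec T C : indec_component m T C -> ~~ decomposable m C.
Proof. by move=> /maxsetp/andP[]. Qed.

Lemma decomposableP T : decomposable m T <-> exists T1 T2 : {set S},
  [/\ T1 != finset.set0, T2 != finset.set0, T1 :&: T2 = finset.set0, T = T1 :|: T2
    & {in T1 & T2, forall s t, m s t = Some 2}].
Proof.
split=> [/existsP[T1 /existsP[T2 /and5P[h1 h2 /eqP h3 /eqP h4 /forallP h5]]]|[T1 [T2 [h1 h2 h3 h4 h5]]]].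
  exists T1, T2; split=> // s t sT tT; have /implyP/(_ sT)/forallP/(_ t)/implyP/(_ tT)/eqP := h5 s.
  by [].
apply/existsP; exists T1; apply/existsP; exists T2; apply/and5P; split=> //; try exact/eqP.
by apply/forallP => s; apply/implyP => sT; apply/forallP => t; apply/implyP => tT; rewrite h5.
Qed.

Lemma component_exists T t : t \in T -> exists2 C, indec_component m T C & t \in C.
Proof.
move=> tT; have [|C CT tC] := @maxset_exists S [pred U : {set S} | (U \subset T) && ~~ decomposable m U] [set t].
  rewrite inE finset.sub1set tT /=; apply/negP => /decomposableP[T1 [T2 [/finset.set0Pn[a a1] /finset.set0Pn[b b2] h3 h4 _]]].
  have /set1P at1 : a \in [set t] by rewrite h4 !inE a1.
  have /set1P bt : b \in [set t] by rewrite h4 !inE b2 orbT.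
  have : a \in T1 :&: T2 by rewrite !inE a1 at1 -bt b2.
  by rewrite h3 inE.
by exists C => //; rewrite -finset.sub1set.
Qed.

(** Otherwise adding u to C would leave it indecomposable, against maximality: a decomposition of
    the larger set either restricts to C or separates u from all of C. *)
Lemma component_commute T C u c : indec_component m T C -> u \in T -> u \notin C -> c \in C ->
  m u c = Some 2.
Proof.
move=> hC uT uC cC; apply: contrapT => ne.
have CT := component_sub hC.
suff nd : ~~ decomposable m (u |: C)%SET.
  have [_ mx] := maxsetP hC; have e := mx (u |: C)%SET; move/negP: uC; apply.
  rewrite -e; first by rewrite !inE eqxx.
    by rewrite inE nd andbT finset.subUset finset.sub1set uT.
  by apply/fintype.subsetP => y yC; rewrite !inE yC orbT.
apply/negP => /decomposableP[T1 [T2 [n1 n2 h3 h4 h5]]].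
have dis y : y \in T1 -> y \in T2 -> False by move=> y1 y2; have : y \in T1 :&: T2; [rewrite inE y1 | rewrite h3 inE].
have CE : C = (C :&: T1) :|: (C :&: T2).
  apply/setP => y; rewrite !inE -andb_orr; case: (boolP (y \in C)) => //= yC.
  by apply/esym; have : y \in u |: C by [rewrite !inE yC orbT]; rewrite h4 inE.
have key (A B : {set S}) : A != finset.set0 -> (u |: C = A :|: B)%SET -> (forall y, y \in A -> y \in B -> False) ->
    {in A & B, forall s t, m s t = Some 2} -> C :&: A = finset.set0 -> False.
  move=> nA e dAB cAB CA; case/finset.set0Pn: nA => a aA.
  have uA : u \in A.
    have : a \in u |: C by rewrite e inE aA.
    rewrite !inE => /orP[/eqP <- //|aC]; have : a \in C :&: A by rewrite inE aC.
    by rewrite CA inE.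
  apply: ne; apply: cAB => //; have : c \in u |: C by rewrite !inE cC orbT.
  rewrite e inE => /orP[cA|//]; have : c \in C :&: A by rewrite inE cC.
  by rewrite CA inE.
have [e1|m1] := eqVneq (C :&: T1) finset.set0; first exact: (key T1 T2).
have [e2|m2] := eqVneq (C :&: T2) finset.set0.
  apply: (key T2 T1) => //; first by rewrite h4 finset.setUC.
    by move=> y y2 y1; exact: dis y1 y2.
  by move=> s t s2 t1; rewrite cox_sym h5.
move/negP: (component_indec hC); apply; apply/decomposableP; exists (C :&: T1), (C :&: T2).
split=> //; last by move=> s t; rewrite !inE => /andP[_ s1] /andP[_ t2]; exact: h5.
by apply/setP => y; rewrite !inE; apply/negP => /andP[/andP[_ y1] /andP[_ y2]]; exact: dis y1 y2.
Qed.

Lemma indec_connect C t : ~~ decomposable m C -> t \in C -> {in C, forall u, connect (bonded m C) t u}.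
Proof.
move=> nd tC u uC; apply: contraNT nd => nc; apply/decomposableP.
exists [set y in C | connect (bonded m C) t y], [set y in C | ~~ connect (bonded m C) t y].
split.
- by apply/finset.set0Pn; exists t; rewrite inE tC connect0.
- by apply/finset.set0Pn; exists u; rewrite inE uC.
- by apply/setP => y; rewrite !inE; case: connect; rewrite !andbF ?andbT.
- by apply/setP => y; rewrite !inE; case: connect; rewrite !andbF ?andbT ?orbF.
move=> s y; rewrite !inE => /andP[sC ts] /andP[yC ny]; apply/eqP.
apply: contraNT (ny) => ne; apply: connect_trans (ts) _; apply: connect1.
by rewrite /bonded yC ne andbT; apply: contraNneq ny => <-.
Qed.

(** A path from t without repetition does not return to t. *)
Lemma bonded_remove C t u : ~~ decomposable m C -> t \in C -> u \in C :\ t ->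
  connect (bonded m (C :\ t)) t u.
Proof.
move=> nd tC; rewrite !inE => /andP[ut uC]; have /connectP[p0 p0P ->] := indec_connect nd tC uC.
case/shortenP: p0P => p pP /= /andP[tp _] _; apply/connectP; exists p => //.
have H x : path (bonded m C) x p -> path (bonded m (C :\ t)) x p; last exact: H.
elim: p tp x {pP} => //= y p IH; rewrite inE negb_or => /andP[ty tp] x /andP[xy pP].
by rewrite IH // andbT; move: xy; rewrite /bonded !inE (eq_sym y t) ty.
Qed.
End Components.

(** * Splitting off elementary ribbons *)

Section Ribbons.
Local Open Scope group_scope.
Variables (S : finType) (m : coxeter_matrix S).
Notation ev := (ev m).
Notation gen := (artin_gen m).
Notation rdiv := (@rdiv S m).
Implicit Types (X Y Z K C : {set S}) (s t x y c : S) (u v w d e : seq S) (g h : artin_group m).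

Lemma conj_setsP X Y g : conj_sets X Y g <->
  {in X, forall x, exists2 y, y \in Y & g * gen x = gen y * g} /\
  {in Y, forall y, exists2 x, x \in X & g * gen x = gen y * g}.
Proof.
split=> [e|[h1 h2]].
  split=> [x xX|y yY].
    have : [set g * gen x | x in [set` X]]%classic (g * gen x) by exists x.
    by rewrite e => -[y yY e']; exists y.
  have : [set gen y * g | y in [set` Y]]%classic (gen y * g) by exists y.
  by rewrite -e => -[x xX e']; exists x.
apply/seteqP; split=> _ [z zZ <-].
  by have [y yY ->] := h1 z zZ; exists y.
by have [x xX <-] := h2 z zZ; exists x.
Qed.

Lemma conj_sets1 X Y : conj_sets X Y (1 : artin_group m) <-> X = Y.
Proof.
split=> [/conj_setsP[h1 h2]|<-]; last first.
  by apply/conj_setsP; split=> x xX; exists x => //; rewrite mul1g mulg1.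
apply/setP => x; apply/idP/idP => [/h1[y yY]|/h2[y yY]].
  by rewrite mul1g mulg1 => /(@artin_gen_inj S m) ->.
by rewrite mul1g mulg1 => /(@artin_gen_inj S m) <-.
Qed.

Lemma conj_sets_mul X Y Z g h : conj_sets X Y g -> conj_sets Y Z h -> conj_sets X Z (h * g).
Proof.
move=> /conj_setsP[g1 g2] /conj_setsP[h1 h2]; apply/conj_setsP; split=> [x xX|z zZ].
  have [y yY e] := g1 x xX; have [z zZ e'] := h1 y yY; exists z => //.
  by rewrite -mulgA e !mulgA e'.
have [y yY e] := h2 z zZ; have [x xX e'] := g2 y yY; exists x => //.
by rewrite -mulgA e' !mulgA e.
Qed.

Lemma conj_sets_divr X Y Z g h : conj_sets X Y g -> conj_sets X Z (h * g) -> conj_sets Y Z h.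
Proof.
move=> /conj_setsP[g1 g2] /conj_setsP[h1 h2]; apply/conj_setsP; split=> [y yY|z zZ].
  have [x xX e] := g2 y yY; have [z zZ e'] := h1 x xX; exists z => //.
  by apply: (@mulIg _ g); rewrite -!mulgA -e !mulgA e' mulgA.
have [x xX e] := h2 z zZ; have [y yY e'] := g1 x xX; exists y => //.
by apply: (@mulIg _ g); rewrite -!mulgA -e' [LHS]mulgA e mulgA.
Qed.

Lemma gen_commute x c : m x c = Some 2 -> gen x * gen c = gen c * gen x.
Proof.
move=> e; have xc : x != c by apply/eqP => xc; move: e; rewrite xc cox_diag.
by have := ev_alt xc e; rewrite /= !ev_cons ev_nil !mulg1.
Qed.

Lemma ev_commute x d : {in d, forall c, m x c = Some 2} -> ev d * gen x = gen x * ev d.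
Proof.
elim: d => [|c d IH] h; first by rewrite ev_nil mul1g mulg1.
rewrite ev_cons -mulgA IH; last by move=> y yd; apply: h; rewrite inE yd orbT.
by rewrite !mulgA (gen_commute (h c (mem_head _ _))).
Qed.

Lemma conj_sets_word X Y w d : conj_sets X Y (ev w) -> {subset d <= X} ->
  exists e, ev w * ev d = ev e * ev w.
Proof.
move=> /conj_setsP[h _]; elim: d => [|x d IH] dX; first by exists [::]; rewrite ev_nil mul1g mulg1.
have [y _ ey] := h x (dX x (mem_head _ _)).
have [|e ee] := IH; first by move=> z zd; apply: dX; rewrite inE zd orbT.
by exists (y :: e); rewrite !ev_cons mulgA ey -mulgA ee mulgA.
Qed.

Lemma common_multipleS X Y g : X \subset Y -> common_multiple Y g -> common_multiple X g.
Proof. by move=> /fintype.subsetP XY h x /XY /h. Qed.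

Lemma ribbon_factor X Y w t : conj_sets X Y (ev (rcons w t)) ->
  exists X' (d : artin_group m) v, [/\ elementary_ribbon X' X d, ev (rcons w t) = ev v * d,
    (size v <= size w)%N & conj_sets X' Y (ev v)].
Proof.
move=> cg; have /conj_setsP[cg1 cg2] := cg.
have td : rdiv (gen t) (ev (rcons w t)) by apply/rdiv_gen; exists w.
have [C hC tC] := component_exists m (setU11 t X).
have nC := component_indec hC; have CT := fintype.subsetP (component_sub hC).
have CX x : x \in X -> x \notin C -> {in C, forall c, m x c = Some 2}.
  by move=> xX xC c; apply: component_commute hC _ xC; rewrite !inE xX orbT.
case: (boolP (t \in X)) => tX.
  have TX : (t |: X)%SET = X by apply/finset.setUidPr; rewrite finset.sub1set.
  have {}CT : {in C, forall c, c \in X} by move=> c /CT; rewrite TX.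
  (* Divisibility spreads from t along the bonds of C by [conj_rdiv_step], as all of C lies in X. *)
  have cm : common_multiple C (ev (rcons w t)).
    move=> c cC; have /connectP[p pP ->] := indec_connect nC tC cC.
    have H s : s \in C -> rdiv (gen s) (ev (rcons w t)) -> path (bonded m C) s p ->
      rdiv (gen (last s p)) (ev (rcons w t)); last exact: H.
    elim: p s {pP} => //= u p IH s sC sd /andP[/and3P[uC su /eqP msu] pP].
    apply: IH => //; apply: conj_rdiv_step sd; first by rewrite eq_sym.
      by rewrite cox_sym.
    move=> z; rewrite !inE => zz; have /cg1[y _ ey] : z \in X by case/orP: zz => /eqP ->; exact: CT.
    by exists y.
  have [d [eD dC dcm dmin [d1 d2]]] := DeltaE cm.
  have [v ewd] := dmin _ cm.
  have cd : conj_sets X X (ev d).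
    apply/conj_setsP; split=> x xX; case: (boolP (x \in C)) => xC.
    - by have [y yC e] := d1 x xC; exists y => //; exact: CT.
    - by exists x => //; apply: ev_commute => c /dC; exact: CX.
    - by have [y yC e] := d2 x xC; exists y => //; exact: CT.
    - by exists x => //; apply: ev_commute => c /dC; exact: CX.
  exists X, (ev d), v; split=> //.
  - exists t, C; split=> //; first exact: spherical_common_multiple cm.
      by rewrite /ribbon_elt tX eD.
    by rewrite TX.
  - have [z ez] := dcm t tC; move: ez; rewrite -ev_rcons => /ev_size; rewrite size_rcons => sd.
    by move: ewd; rewrite -ev_cat => /ev_size; rewrite size_rcons size_cat sd addnS => -[->]; exact: leq_addr.
  - by apply: conj_sets_divr cd _; rewrite -ewd.
pose K := (C :\ t)%SET.
have KX : K \subset X.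
  apply/fintype.subsetP => y; rewrite !inE => /andP[yt /CT]; rewrite !inE (negPf yt).
  by [].
have KC : K \subset C by exact: finset.subD1set.
have [w0 cw0] : exists w0, common_multiple K (ev w0).
  (* After reversal the right divisor t is the first letter, and g x = y g reads x r = r y. *)
  apply: (@ribbon_common_multiple _ m X K t (rev (rcons w t))) => //.
  - move=> x xX; have [y _ e] := cg1 x xX; exists y.
    by rewrite -rev_rcons -rev_cons; apply: ev_rev; rewrite ev_rcons e ev_cons.
  - by exists (rev w); rewrite rev_rcons.
  - move=> u uK; apply: connect_sub (bonded_remove nC tC uK) => a b /and3P[bK ab mab].
    by apply: connect1; rewrite /bonded (fintype.subsetP KX b bK) ab mab.
have [d0 [eD0 d0K d0cm d0min [d01 d02]]] := DeltaE cw0.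
have d0X : {subset d0 <= X} by move=> y /d0K; exact: (fintype.subsetP KX).
have cm : common_multiple C (ev (rcons w t ++ d0)).
  move=> c cC; rewrite ev_cat; have [->|ct] := eqVneq c t.
    (* The element Delta_K passes through g to the left and leaves g at the end, with its right
       divisor t. *)
    by have [y ->] := conj_sets_word cg d0X; apply: rdiv_trans td _; exact: rdiv_mull.
  by apply: rdiv_trans (d0cm c _) _; [rewrite !inE ct | exact: rdiv_mull].
have [d1 [eD1 d1C d1cm d1min [d11 d12]]] := DeltaE cm.
have [v ev1] := d1min _ cm.
have [e ee] := d0min _ (common_multipleS KC d1cm).
have wE : ev (rcons w t) = ev v * ev e.
  by apply: (@mulIg _ (ev d0)); rewrite -[LHS]ev_cat ev1 ee mulgA.
have dE : Delta m C * (Delta m K)^-1 = ev e by rewrite eD1 eD0 ee mulgK.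
(* With an empty e, Delta_C would be a word over C - {t}, although t divides it. This makes the
   remaining factor v shorter. *)
have e0 : (0 < size e)%N.
  case: e ee {wE dE} => // ee; have [z] := d1cm t tC; rewrite -ev_rcons ee ev_nil mul1g.
  move=> /ev_mem/(_ t); rewrite mem_rcons mem_head => /d0K.
  by rewrite !inE eqxx.
(* One inclusion holds by this definition of the target; the content is that each x in X has its
   image in X + {t}. Outside C it commutes with both Garside elements, inside C it is moved by
   Delta_K and then by Delta_C. *)
pose X' := [set y in (t |: X)%SET | `[< exists2 x, x \in X & ev e * gen x = gen y * ev e >]].
have cd : conj_sets X X' (ev e).
  apply/conj_setsP; split=> [x xX|y]; last by rewrite inE => /andP[_ /asboolP].
  suff [y yT ey] : exists2 y, y \in (t |: X)%SET & ev e * gen x = gen y * ev e.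
    by exists y => //; rewrite inE yT; apply/asboolP; exists x.
  case: (boolP (x \in C)) => xC; last first.
    exists x; first by rewrite !inE xX orbT.
    have c1 : ev d1 * gen x = gen x * ev d1 by apply: ev_commute => c /d1C; exact: CX.
    have c0 : ev d0 * gen x = gen x * ev d0.
      by apply: ev_commute => c /d0K/(fintype.subsetP KC); exact: CX.
    by apply: (@mulIg _ (ev d0)); rewrite -!mulgA -c0 -ee -c1 ee mulgA.
  have xK : x \in K by rewrite !inE xC andbT; apply: contraNneq tX => <-.
  have [s sK es] := d02 x xK; have [y yC ey] := d11 s (fintype.subsetP KC s sK).
  exists y; first exact: CT.
  by apply: (@mulIg _ (ev d0)); rewrite -!mulgA -es -ee -ey ee mulgA.
exists X', (ev e), v; split=> //.
- exists t, C; split=> //; first exact: spherical_common_multiple cm.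
    by rewrite /ribbon_elt (negPf tX).
  by split=> //; apply/fintype.subsetP => y; rewrite inE => /andP[].
- move: wE; rewrite -ev_cat => /ev_size; rewrite size_rcons size_cat => sz.
  by rewrite -ltnS sz -[X in (X < _)%N]addn0 ltn_add2l.
- by apply: conj_sets_divr cd _; rewrite -wE.
Qed.

Lemma ribbon_chain_conj n (Xs : nat -> {set S}) (gs : nat -> artin_group m) :
  (forall i, 1 <= i <= n -> elementary_ribbon (Xs i) (Xs i.-1) (gs i)) ->
  conj_sets (Xs 0) (Xs n) (\prod_(i <- rev (index_iota 1 n.+1)) gs i).
Proof.
elim: n => [|n IH] h; first by rewrite big_nil; apply/conj_sets1.
have -> : index_iota 1 n.+2 = rcons (index_iota 1 n.+1) n.+1.
  by rewrite /index_iota !subSS !subn0 -[in LHS](addn1 n) iotaD cats1 add1n.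
rewrite rev_rcons big_cons; apply: conj_sets_mul.
  by apply: IH => i /andP[i1 iN]; apply: h; rewrite i1 leqW.
by have [|t [C [_ _ _ _ []]]] := h n.+1; first by rewrite /= leqnn.
Qed.

Lemma conj_ribbon_chain X Y w : conj_sets X Y (ev w) ->
  exists (n : nat) (Xs : nat -> {set S}) (gs : nat -> artin_group m),
    [/\ Xs 0 = X, Xs n = Y, ev w = \prod_(i <- rev (index_iota 1 n.+1)) gs i
      & forall i, 1 <= i <= n -> elementary_ribbon (Xs i) (Xs i.-1) (gs i)].
Proof.
have [k le] := ubnP (size w); elim: k X w le => // k IH X w le.
case/lastP: w le => [|w t] le.
  rewrite ev_nil => /conj_sets1 ->; exists 0, (fun=> Y), (fun=> 1); split=> //.
    by rewrite big_nil.
  by case=> [|i].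
move=> /ribbon_factor[X' [d [v [rb ew sv cv]]]].
have [|n [Xs [gs [X0 Xn gE h]]]] := IH X' v _ cv.
  by apply: leq_ltn_trans sv _; move: le; rewrite size_rcons.
(* The new ribbon becomes g_1 and the chain obtained for v is shifted by one; the value of the
   second function at 0 is a filler. *)
exists n.+1, (fun i => if i is i'.+1 then Xs i' else X), (fun i => if i is i'.+2 then gs i'.+1 else d).
split=> //; last by move=> [|[|i]] //= iN; [rewrite X0 | exact: h].
have -> : index_iota 1 n.+2 = 1%N :: [seq i.+1 | i <- index_iota 1 n.+1].
  by rewrite /index_iota !subSS !subn0 /= -[2%N](addn1 1%N) iotaDl.
rewrite ew gE rev_cons -cats1 big_cat big_seq1 -map_rev big_map; congr (_ * _).
rewrite big_seq [RHS]big_seq; apply: eq_bigr => i.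
by rewrite mem_rev mem_index_iota; case: i.
Qed.
End Ribbons.

Theorem mainTheorem4 (S : finType) (m : coxeter_matrix S) (X Y : {set S})
    (g : artin_group m) (hg : artin_monoid m [set: S]%SET g) :
  conj_pos X Y g <->
  exists (n : nat) (Xs : nat -> {set S}) (gs : nat -> artin_group m),
    [/\ Xs 0 = X, Xs n = Y,
        g = (\prod_(i <- rev (index_iota 1 n.+1)) gs i)%g
      & forall i, 1 <= i <= n -> elementary_ribbon (Xs i) (Xs i.-1) (gs i)].
Proof.
split=> [[/artin_monoidP[w _ ->]]|[n [Xs [gs [<- <- gE h]]]]]; first exact: conj_ribbon_chain.
by split=> //; rewrite gE; exact: ribbon_chain_conj.
Qed.
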